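(* Let $I=[0,\gamma)$ with $0<\gamma\le\infty$. Let $\varphi$ be an Orlicz function that satisfies the $\Delta_2$-condition if $\gamma=\infty$, and the $\Delta_2^\infty$-condition if $\gamma<\infty$. Let $w$ and $(w_n)_{n=1}^\infty$ be weight functions on $I$, and put $W(t)=\int_0^t w(s)\,ds$ and $W_n(t)=\int_0^t w_n(s)\,ds$ for $n\ge1$. Assume that (i) there are positive constants $(K_n)_{n=1}^\infty$ such that $W(t)\le K_n W_n(t)$ for all $t\in I$ and $n\in\mathbb{N}$, and (ii) $\Lambda_{\varphi,w_n}\subsetneq\Lambda_{\varphi,w_{n+1}}$ for every $n\in\mathbb{N}$. Put $A=\Lambda_{\varphi,w}\setminus\bigcup_{n=1}^\infty\Lambda_{\varphi,w_n}$. Then: (I) $A$ is $(\alpha,\beta)$-dense-lineable in $\Lambda_{\varphi,w}$ for all cardinal numbers $\alpha,\beta$ with $\alpha<\mathfrak{c}$ and $\max\{\aleph_0,\alpha\}\le\beta\le\mathfrak{c}$. (II) $A$ is pointwise maximal dense-lineable (specifically, pointwise $\mathfrak{c}$-dense-lineable) in $\Lambda_{\varphi,w}$. (III) If $\alpha\ge\aleph_0$ is a cardinal number, then $A$ is not $(\alpha,\beta)$-spaceable in $\Lambda_{\varphi,w}$, for any cardinal number $\beta\ge\alpha$. (IV) If $\alpha\le\mathfrak{c}$ is a cardinal number, then $A$ is $(\alpha,\mathfrak{c})$-lineable in $\Lambda_{\varphi,w}$.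
   Context: The interval $I=[0,\gamma)$ carries Lebesgue measure $m$. $L_0$ is the space of real Lebesgue measurable functions on $I$ modulo a.e. equality. For $f\in L_0$, $d_f(\lambda)=m(\{t\in I:|f(t)|>\lambda\})$ for $\lambda>0$, and $f^*(t)=\inf\{\lambda>0:d_f(\lambda)\le t\}$ for $t\ge 0$ (with $\inf\varnothing=\infty$). An Orlicz function is a convex function $\varphi:[0,\infty)\to[0,\infty)$ with $\varphi(0)=0=\lim_{u\to0}\varphi(u)$ and $\varphi(u)>0$ for $u>0$ (put $\varphi(\infty)=\infty$). It satisfies the $\Delta_2^\infty$-condition if there are $K>2$, $u_0\ge0$ with $\varphi(2u)\le K\varphi(u)$ for all $u\ge u_0$; the $\Delta_2^0$-condition if there are $K>2$, $u_0>0$ with $\varphi(2u)\le K\varphi(u)$ for all $0\le u\le u_0$; the $\Delta_2$-condition if it satisfies both. A weight function on $I$ is a positive, decreasing (i.e. nonincreasing) function $w:I\setminus\{0\}\to(0,\infty)$ with $\int_0^t w<\infty$ for every $t\in I$; if $\gamma=\infty$ it is also assumed that $\int_0^\infty w=\infty$. The modular is $\rho_{\varphi,w}(f)=\int_I\varphi(f^*(t))w(t)\,dt$. The Orlicz-Lorentz space is $\Lambda_{\varphi,w}=\{f\in L_0:\rho_{\varphi,w}(kf)<\infty\text{ for some }k>0\}$ with the Luxemburg norm $\|f\|_{\varphi,w}=\inf\{\varepsilon>0:\rho_{\varphi,w}(f/\varepsilon)\le1\}$ (a Banach space). $\mathfrak{c}$ is the cardinality of the continuum; $\dim$ is algebraic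 dimension. Let $A$ be a subset of a topological vector space $X$ and $\alpha\le\beta$ cardinals. $A$ is $\alpha$-lineable if there is an $\alpha$-dimensional vector subspace $M$ of $X$ with $M\subset A\cup\{0\}$. $A$ is $(\alpha,\beta)$-lineable (respectively, $(\alpha,\beta)$-spaceable, $(\alpha,\beta)$-dense-lineable) if $A$ is $\alpha$-lineable and for every $\alpha$-dimensional vector subspace $M_\alpha$ of $X$ with $M_\alpha\subset A\cup\{0\}$ there is a $\beta$-dimensional (respectively, closed $\beta$-dimensional, dense $\beta$-dimensional) vector subspace $M_\beta$ of $X$ with $M_\alpha\subset M_\beta\subset A\cup\{0\}$. $A$ is pointwise $\alpha$-dense-lineable if for every $x\in A$ there is a dense $\alpha$-dimensional vector subspace $M$ of $X$ with $x\in M\subset A\cup\{0\}$; pointwise maximal dense-lineable means pointwise $\dim(X)$-dense-lineable. *)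

(* Defs.v *)
From HB Require Import structures.
From mathcomp Require Import all_boot all_order all_algebra.
From mathcomp Require Import all_classical all_reals all_analysis.
From mathcomp Require Import measurable_realfun.
Set Implicit Arguments.
Unset Strict Implicit.
Unset Printing Implicit Defensive.
Import Order.TTheory GRing.Theory Num.Theory numFieldNormedType.Exports.
Local Open Scope classical_set_scope.
Local Open Scope card_scope.
Local Open Scope ring_scope.

(* A topological vector space is given as a linear subset X of an ambient
   module V together with the family tau of its open sets. A cardinal is given
   by a type: a stands for the cardinality of [set: a]. *)
Section lineability.
Variables (R : realType) (V : lmodType R).

Definition vector_subspace (M : set V) :=
  M 0 /\ forall (c : R) (u v : V), M u -> M v -> M (c *: u + v).

Definition lin_indep (B : set V) :=
  forall (s : seq V) (c : V -> R), uniq s -> [set` s] `<=` B ->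
    \sum_(v <- s) c v *: v = 0 -> forall v, v \in s -> c v = 0.

Definition spans (B M : set V) :=
  forall u, M u <-> exists (s : seq V) (c : V -> R),
    [set` s] `<=` B /\ u = \sum_(v <- s) c v *: v.

Definition hamel_basis (M B : set V) := lin_indep B /\ spans B M.

Definition has_dim (M : set V) (a : Type) :=
  exists B : set V, hamel_basis M B /\ B #= [set: a].

Variables (X : set V) (tau : set_system V).

Definition closed_in (M : set V) := tau (X `\` M).

Definition dense_in (M : set V) :=
  forall U : set V, U !=set0 -> tau U -> U `&` M !=set0.

Variable A : set V.

Definition subspace_within (a : Type) (M : set V) :=
  [/\ vector_subspace M, M `<=` X, has_dim M a & M `<=` A `|` [set 0]].

Definition lineable (a : Type) := exists M, subspace_within a M.

(* The three (alpha, beta)-notions differ by the condition P on M_beta. *)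
Definition lineable_pair_with (P : set V -> Prop) (a b : Type) :=
  lineable a /\
  forall M, subspace_within a M ->
    exists M', [/\ subspace_within b M', P M' & M `<=` M'].

Definition lineable_pair := lineable_pair_with setT.
Definition spaceable_pair := lineable_pair_with closed_in.
Definition dense_lineable_pair := lineable_pair_with dense_in.

Definition pointwise_dense_lineable (a : Type) :=
  forall x, A x -> exists M, [/\ subspace_within a M, dense_in M & M x].

Definition pointwise_maximal_dense_lineable :=
  exists a : Type, has_dim X a /\ pointwise_dense_lineable a.

End lineability.

Definition card_lt (a b : Type) :=
  [set: a] #<= [set: b] /\ ~ ([set: b] #<= [set: a]).

Definition norm_topology (R : realType) (V : lmodType R) (X : set V)
    (N : V -> R) : set_system V :=
  [set U | U `<=` X /\ forall f, U f -> exists2 e : R, 0 < e &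
     forall g, X g -> N (g - f) < e -> U g].

Section L0.
Context d (T : measurableType d) (R : realType) (mu : {measure set T -> \bar R}).

Definition L0 : Type := {mfun_ mu, T >-> R}.
HB.instance Definition _ := Choice.on L0.

Local Open Scope quotient_scope.

Definition class_of (f : {mfun T >-> R}) : L0 := \pi_({mfun_ mu, T >-> R}) f.
Definition repr_of (f : L0) : {mfun T >-> R} := repr f.

Lemma repr_ofK f : class_of (repr_of f) = f.
Proof. exact: reprK. Qed.

Lemma class_ofP (f g : {mfun T >-> R}) :
  f = g %[ae mu] -> class_of f = class_of g.
Proof. by move=> fg; apply/eqmodP/asboolP. Qed.

Lemma repr_class_of (f : {mfun T >-> R}) : repr_of (class_of f) = f %[ae mu].
Proof.
by apply/asboolP; rewrite -/(ae_eq_op _ _ _) -eqmodE; apply/eqP; rewrite reprK.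
Qed.

Definition zeroL0 : L0 := class_of 0.
Definition addL0 (f g : L0) : L0 := class_of (repr_of f + repr_of g).
Definition oppL0 (f : L0) : L0 := class_of (- repr_of f).
Definition scaleL0 (c : R) (f : L0) : L0 := class_of (c *: repr_of f).

Lemma class_ofD f g : addL0 (class_of f) (class_of g) = class_of (f + g).
Proof.
apply: class_ofP; apply: filterS2 (repr_class_of f) (repr_class_of g).
by move=> x /= hf hg _; rewrite !fctE hf ?hg.
Qed.

Lemma class_ofN f : oppL0 (class_of f) = class_of (- f).
Proof.
by apply: class_ofP; apply: filterS (repr_class_of f) => x /= hf _; rewrite !fctE hf.
Qed.

Lemma class_ofZ c f : scaleL0 c (class_of f) = class_of (c *: f).
Proof.
by apply: class_ofP; apply: filterS (repr_class_of f) => x /= hf _; rewrite !fctE hf.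
Qed.

Lemma addL0A : associative addL0.
Proof.
move=> f g h; rewrite -(repr_ofK f) -(repr_ofK g) -(repr_ofK h).
by rewrite !class_ofD addrA.
Qed.

Lemma addL0C : commutative addL0.
Proof.
by move=> f g; rewrite -(repr_ofK f) -(repr_ofK g) !class_ofD addrC.
Qed.

Lemma add0L0 : left_id zeroL0 addL0.
Proof. by move=> f; rewrite -(repr_ofK f) class_ofD add0r. Qed.

Lemma addNL0 : left_inverse zeroL0 oppL0 addL0.
Proof. by move=> f; rewrite -(repr_ofK f) class_ofN class_ofD addNr. Qed.

HB.instance Definition _ := GRing.isZmodule.Build L0 addL0A addL0C add0L0 addNL0.

Lemma scaleL0A c e f : scaleL0 c (scaleL0 e f) = scaleL0 (c * e) f.
Proof. by rewrite -(repr_ofK f) !class_ofZ scalerA. Qed.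

Lemma scale1L0 : left_id 1 scaleL0.
Proof. by move=> f; rewrite -(repr_ofK f) class_ofZ scale1r. Qed.

Lemma scaleL0Dr : right_distributive scaleL0 +%R.
Proof.
move=> c f g; rewrite -(repr_ofK f) -(repr_ofK g).
by rewrite [_ + _]class_ofD !class_ofZ [RHS]class_ofD scalerDr.
Qed.

Lemma scaleL0Dl f : {morph scaleL0^~ f : c e / c + e}.
Proof.
by move=> c e; rewrite -(repr_ofK f) !class_ofZ [RHS]class_ofD scalerDl.
Qed.

HB.instance Definition _ :=
  GRing.Zmodule_isLmodule.Build R L0 scaleL0A scale1L0 scaleL0Dr scaleL0Dl.

End L0.

Section orlicz_functions.
Variables (R : realType) (phi : R -> R).

(* Only the restriction of phi to [0, +oo[ matters. *)
Definition orlicz_function :=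
  [/\ forall u : R, 0 <= u -> 0 <= phi u,
      convex_function [set u : R^o | 0 <= u] phi,
      phi 0 = 0,
      phi u @[u --> 0^'+] --> (0 : R) &
      forall u : R, 0 < u -> 0 < phi u].

Definition Delta2_infty := exists K u0 : R, [/\ 2 < K, 0 <= u0 &
  forall u, u0 <= u -> phi (2 * u) <= K * phi u].

Definition Delta2_zero := exists K u0 : R, [/\ 2 < K, 0 < u0 &
  forall u, 0 <= u -> u <= u0 -> phi (2 * u) <= K * phi u].

Definition Delta2 := Delta2_zero /\ Delta2_infty.

End orlicz_functions.

Section orlicz_lorentz.
Context (R : realType) (gamma : \bar R).

Definition I_gamma : set R := [set t | 0 <= t /\ (t%:E < gamma)%E].
Definition I_gamma_pos : set R := [set t | 0 < t /\ (t%:E < gamma)%E].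

Lemma measurable_I_gamma :
  ((wlength (@idfun R))^*)%mu.-cara.-measurable I_gamma.
Proof.
apply: sub_caratheodory; rewrite /I_gamma.
case: gamma => [g||].
- by rewrite (_ : mkset _ = `[0, g[%classic); [exact: measurable_itv|
    by apply/seteqP; split=> t /=; rewrite in_itv/= lte_fin => /andP].
- by rewrite (_ : mkset _ = `[0, +oo[%classic); [exact: measurable_itv|
    apply/seteqP; split=> t /=; rewrite in_itv/= ltry andbT => // -[]].
- by rewrite (_ : mkset _ = set0); [exact: measurable0|
    apply/seteqP; split=> t // [_]].
Qed.

(* The completed Lebesgue measure restricted to I_gamma. The elements of
   L0 m_gamma are represented by Lebesgue measurable functions on the whole
   line, identified when they agree almost everywhere on I_gamma. *)
Definition m_gamma := mrestr (@completed_lebesgue_measure R) measurable_I_gamma.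
HB.instance Definition _ := Measure.on m_gamma.

Definition primitive (w : R -> R) (t : R) : \bar R :=
  (\int[lebesgue_measure]_(s in `]0%R, t[) (w s)%:E)%E.

Definition weight (w : R -> R) :=
  [/\ forall t, I_gamma_pos t -> 0 < w t,
      forall s t, I_gamma_pos s -> I_gamma_pos t -> s <= t -> w t <= w s,
      forall t, I_gamma t -> (primitive w t < +oo)%E &
      gamma = +oo%E ->
        (\int[lebesgue_measure]_(s in `]0%R, +oo[) (w s)%:E = +oo)%E].

Implicit Type f : L0 m_gamma.

Definition distribution_fun f (l : R) : \bar R :=
  completed_lebesgue_measure [set t : R | I_gamma t /\ l < `|repr_of f t|].

Definition rearrangement f (t : R) : \bar R :=
  ereal_inf [set l%:E | l in [set l : R |
    0 < l /\ (distribution_fun f l <= t%:E)%E]].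

Variables (phi w : R -> R).

(* er_map phi extends phi by phi(+oo) = +oo. The weight, hence the integrand,
   is only defined away from 0. *)
Definition modular f : \bar R :=
  (\int[lebesgue_measure]_(t in I_gamma_pos)
     (er_map phi (rearrangement f t) * (w t)%:E))%E.

Definition orlicz_lorentz : set (L0 m_gamma) :=
  [set f | exists2 k : R, 0 < k & (modular (k *: f) < +oo)%E].

Definition luxemburg_norm f : R :=
  inf [set e : R | 0 < e /\ (modular (e^-1 *: f) <= 1)%E].

Definition luxemburg_topology : set_system (L0 m_gamma) :=
  norm_topology orlicz_lorentz luxemburg_norm.

End orlicz_lorentz.

(* Main.v *)
Require Import Defs.
From mathcomp Require Import all_boot all_order all_algebra.
From mathcomp Require Import all_classical all_reals all_analysis.
From mathcomp Require Import measurable_realfun ring lra.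
Set Implicit Arguments.
Unset Strict Implicit.
Unset Printing Implicit Defensive.
Import Order.TTheory GRing.Theory Num.Theory numFieldNormedType.Exports.
Local Open Scope classical_set_scope.
Local Open Scope card_scope.
Local Open Scope ring_scope.

(** Write X for the space attached to w, X_n for the one attached to w_n and
    Y for the union of the X_n. The inclusions make Y a vector subspace of X,
    and a subspace M is contained in the union of X \ Y and {0} if and only if
    M meets Y in 0 only, that is, if and only if a basis of M is linearly
    independent modulo Y. Each of the four assertions thus becomes linear
    algebra modulo Y, once four facts are known ([abstract_lineability]).

    1. X contains a family (z_r), r real, that is independent modulo Y.
    2. X has at most c elements, c being the cardinal of the reals.
    3. A sequence in Y is dense in X, and stays dense after each of its terms
       d_n is changed to d_n + c_n v_n, for given v_n and suitable c_n <> 0.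
    4. Y is not {0}, and every v in X can be scaled into any ball around 0.

    For (IV), a basis of M is extended to a basis of X modulo Y, which has c
    elements: in terms of another basis, one that contains the z_r, each of its
    elements involves finitely many vectors, and all vectors are involved. For
    (I), if M has a < c dimensions then c vectors remain in that basis; b of
    them are added, and countably many of these are moved next to the terms d_n
    by fact 3. A perturbation b -> k b + y with k <> 0 and y in Y keeps
    independence modulo Y, so density costs nothing. (II) is (I) with a = 1 and
    b = c. For (III), a basis (b_i) of an infinite-dimensional M is altered in
    countably many places to y + c_n b_n, with 0 <> y in Y and c_n b_n -> 0; a
    closed subspace containing the altered vectors contains y.

    The analysis rests on the layer cake formula

      rho(f) = int_0^oo W(d_f(phi^-1(s))) ds,

    where W(d) is the integral of w over ]0, d[ ([modular_layer_cake]). As W is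
    nondecreasing and subadditive, an estimate of distribution functions gives
    one of the modular. The formula itself comes from Tonelli's theorem and the
    equivalence u < f^*(t) <-> t < d_f(u).

    Fact 1. W_n is not bounded by a multiple of W, for otherwise X would be
    contained in X_n, hence X_(n+1) in X_n. Suitable lengths t_j and heights
    a_j then satisfy W(t_j) phi(a_j) <= 2^-j and W_n(t_j) phi(2 a_j) >= 2^j,
    with n = n(j) prescribed ([exists_block]). A function equal to y_j a_j on
    the j-th of a sequence of disjoint intervals of lengths t_j lies in X when
    y is bounded by 1, and, by Delta_2, outside X_n as soon as |y_j| stays away
    from 0 for infinitely many j with n(j) = n. Let j run over the triples
    (n, m, k) with k an integer, and for a real r put y_j = 1 if k is the floor
    of m r and y_j = 0 otherwise. For distinct reals these floors differ when m
    is large, so that a linear combination has y_j = c_r, for one chosen r,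
    infinitely often ([exists_independent_family]).

    Facts 2 and 3. Under Delta_2 every f in X is the limit of its truncations
    ([modular_truncate]), and these are approximated by step functions with
    rational data, which lie in every X_n ([step_dense]). A separable metric
    space has at most c points. *)

(** * Cardinals and the continuum *)

Lemma card_le_fun (T U : Type) (A : set T) (B : set U) (f : T -> U) :
  (forall x, A x -> B (f x)) -> {in A &, injective f} -> A #<= B.
Proof.
move=> AB /inj_card_eq fA.
apply: (@card_le_trans _ _ _ (f @` A)).
  by have [] := card_eqPle A (f @` A); rewrite card_eq_sym fA => /(_ isT)[].
by apply: subset_card_le => _ [x Ax <-]; exact: AB.
Qed.

Lemma card_le_surj (T U : Type) (A : set T) (B : set U) (g : U -> T) :
  (forall x, A x -> exists2 u, B u & g u = x) -> A #<= B.
Proof.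
move=> AB; apply: card_le_trans (card_image_le g B).
by apply: subset_card_le => x /AB[u Bu <-]; exists u.
Qed.

Lemma card_leT_set_fun (T U : Type) (B : set U) : [set: T] #<= B ->
  exists2 f : T -> U, (forall x, B (f x)) & injective f.
Proof.
move=> /card_leP[f]; exists (fun x => val (f (to_setT x))) => [x|x y /val_inj fxy].
  exact/set_mem/(valP (f _)).
have : to_setT x = to_setT y by apply: (@inj _ _ _ f); rewrite ?inE.
by move/(congr1 val).
Qed.

Lemma card_leT_fun (T U : Type) : [set: T] #<= [set: U] ->
  exists f : T -> U, injective f.
Proof. by move=> /card_leT_set_fun[f _ fi]; exists f. Qed.

Lemma card_le_pfun (T : Type) (U : pointedType) (A : set T) (B : set U) :
  A #<= B -> exists2 f : T -> U, (forall x, A x -> B (f x)) & {in A &, injective f}.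
Proof. by move=> /pcard_leP/injfunPex[f]; exists f. Qed.

Lemma card_eqI (T U : Type) (A : set T) (B : set U) :
  A #<= B -> B #<= A -> A #= B.
Proof. by move=> AB BA; apply: Cantor_Bernstein. Qed.

Lemma card_setU_le (T U : Type) (A1 A2 : set T) (B1 B2 : set U) :
  A1 #<= B1 -> A2 #<= B2 -> B1 `&` B2 = set0 -> A1 `|` A2 #<= B1 `|` B2.
Proof.
elim/Ppointed: U => U in B1 B2 *.
  by rewrite !emptyE => -> -> _; rewrite setU0.
move=> /card_le_pfun[f fA fi] /card_le_pfun[g gA gi] B12.
have B12F x : B1 x -> B2 x -> False.
  by move=> B1x B2x; have : (B1 `&` B2) x by []; rewrite B12.
apply: (@card_le_fun _ _ _ _ (fun x => if `[< A1 x >] then f x else g x)).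
  move=> x; case: asboolP => [/fA|nA [//|/gA]]; by [left|right].
move=> x y; rewrite !inE => -[] Ax [] Ay;
  case: asboolP => [|] Ax1; case: asboolP => [|] Ay1 // E.
all: try by apply: fi; rewrite ?inE.
all: try by apply: gi; rewrite ?inE.
all: by exfalso; first [apply: (B12F (f x)); [exact: fA|rewrite E; exact: gA]
   | apply: (B12F (f y)); [exact: fA|rewrite -E; exact: gA]].
Qed.

Lemma card_setU_eq (T U : Type) (A1 A2 : set T) (B1 B2 : set U) :
  A1 #= B1 -> A2 #= B2 -> A1 `&` A2 = set0 -> B1 `&` B2 = set0 ->
  A1 `|` A2 #= B1 `|` B2.
Proof.
move=> /card_eqPle[a b] /card_eqPle[c d] A12 B12.
by apply: card_eqI; exact: card_setU_le.
Qed.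

(** A set of codes is a 0-1 sequence, which is read as a ternary expansion with
    digits 0 and 1: the first digit where two sequences differ outweighs all the
    later ones, so distinct sets get distinct sums. *)
Lemma card_set_countType (R : realType) (T : countType) :
  [set: set T] #<= [set: R].
Proof.
pose c (s : set T) (i : nat) : R :=
  if `[< exists2 t, s t & pickle t = i >] then 1 else 0.
pose S (s : set T) n : R := \sum_(i < n) c s i * 3^-1 ^+ i.
have c0 s i : 0 <= c s i <= 1 by rewrite /c; case: asboolP => _; rewrite !lexx ler01.
(* The digits from place n on contribute at most (3/2) 3^-n, half of what a
   digit 1 at place n - 1 contributes. *)
have S_le s n m : S s (n + m)%N <= S s n + 3 / 2 * (3^-1 ^+ n - 3^-1 ^+ (n + m)).
  elim: m => [|m IH]; first by rewrite addn0 subrr mulr0 addr0.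
  rewrite addnS [leLHS]big_ord_recr/= -/(S s (n + m)%N) exprS.
  have /andP[_ c1] := c0 s (n + m)%N.
  have p0 : 0 <= 3^-1 ^+ (n + m) :> R by rewrite exprn_ge0// invr_ge0.
  have := ler_wpM2r p0 c1; rewrite mul1r => h.
  move: h IH; set p := _ ^+ (n + m); lra.
have S_nd s : {homo S s : n m / (n <= m)%N >-> n <= m}.
  apply: homo_leq => //; first exact: le_trans.
  move=> n; rewrite /S big_ord_recr/= lerDl mulr_ge0 ?exprn_ge0 ?invr_ge0//.
  by have /andP[] := c0 s n.
have S_ub s n m : S s m <= S s n + 3 / 2 * 3^-1 ^+ n.
  have p0 k : 0 <= 3^-1 ^+ k :> R by rewrite exprn_ge0// invr_ge0.
  have [mn|nm] := leqP m n.
    by rewrite (le_trans (S_nd s _ _ mn))// lerDl mulr_ge0.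
  have := S_le s n (m - n)%N; rewrite subnKC 1?ltnW// => /le_trans; apply.
  by have := p0 m; lra.
pose g s := sup (range (S s)).
have g_sup s : has_sup (range (S s)).
  split; first by exists (S s 0); exists 0%N.
  exists (S s 0%N + 3 / 2 * 3^-1 ^+ 0) => _ [m _ <-]; exact: S_ub.
have g_lb s n : S s n <= g s by apply: ub_le_sup; [exact: (g_sup s).2|exists n].
have g_ub s n : g s <= S s n + 3 / 2 * 3^-1 ^+ n.
  by apply: ge_sup; [exact: (g_sup s).1|move=> _ [m _ <-]; exact: S_ub].
have main (s t : set T) n : (forall i, (i < n)%N -> c s i = c t i) ->
    c s n = 1 -> c t n = 0 -> g s <> g t.
  move=> st cs ct E.
  have := g_lb s n.+1; have := g_ub t n.+1; rewrite E.
  rewrite [S s n.+1]big_ord_recr [S t n.+1]big_ord_recr/= cs ct -/(S s n) -/(S t n).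
  have -> : S s n = S t n by apply: eq_bigr => i _; rewrite st.
  have : 0 < 3^-1 ^+ n :> R by rewrite exprn_gt0// invr_gt0.
  rewrite exprS; set p := _ ^+ n; lra.
apply: (@card_le_fun _ _ _ _ g) => // s t _ _ gst.
have cst : c s =1 c t.
  apply: contrapT => /existsNP cst.
  have ex : exists n, c s n != c t n by case: cst => n /eqP; exists n.
  case: (ex_minnP ex) => n cn nmin.
  have lt i : (i < n)%N -> c s i = c t i.
    by move=> i_n; apply/eqP; apply: contraTT i_n => /nmin; rewrite -leqNgt.
  have := main s t n lt; have := main t s n (fun i h => esym (lt i h)).
  move: cn gst; rewrite /c; case: asboolP; case: asboolP => _ _; rewrite ?eqxx//.
  - by move=> _ gst _ h; case: (h erefl erefl).
  - by move=> _ gst h _; case: (h erefl erefl).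
apply/seteqP; split => x xin; have := cst (pickle x); rewrite /c.
- rewrite asboolT; last by exists x.
  case: asboolP => [[u tu /(pcan_inj pickleK) <-]//|_ /eqP].
  by rewrite oner_eq0.
- rewrite [X in _ = X]ifT; last by apply/asboolP; exists x.
  case: asboolP => [[u tu /(pcan_inj pickleK) <-]//|_ /eqP].
  by rewrite eq_sym oner_eq0.
Qed.

Lemma card_le_setR (R : realType) (T : Type) (C : countType) (f : T -> set C) :
  injective f -> [set: T] #<= [set: R].
Proof.
move=> fi; apply: card_le_trans (card_set_countType R C).
by apply: (@card_le_fun _ _ _ _ f) => // x y _ _; exact: fi.
Qed.

(** A sequence of reals is determined by the pairs (n, q), q rational, with
    q below its n-th term. *)
Lemma card_seqR_le (R : realType) : [set: nat -> R] #<= [set: R].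
Proof.
pose f (x : nat -> R) : set (nat * rat) := [set p | ratr p.2 < x p.1].
apply: (@card_le_setR _ _ _ f) => x y fxy.
apply/funext => n; apply: contrapT => /eqP; rewrite neq_lt => /orP[] h.
- have [q /[!in_itv]/= /andP[xq qy]] := rat_in_itvoo h.
  have : f y (n, q) by [].
  by rewrite -fxy /f/= => /(lt_trans xq); rewrite ltxx.
- have [q /[!in_itv]/= /andP[xq qy]] := rat_in_itvoo h.
  have : f x (n, q) by [].
  by rewrite fxy /f/= => /(lt_trans xq); rewrite ltxx.
Qed.

Lemma card_pairR_le (R : realType) : [set: R * R] #<= [set: R].
Proof.
apply: card_le_trans (card_seqR_le R).
apply: (@card_le_fun _ _ _ _ (fun p n => if n == 0%N then p.1 else p.2)) => //.
move=> [a b] [c d] _ _ /= E.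
by have := congr1 (@^~ 0%N) E; have := congr1 (@^~ 1%N) E => /= -> ->.
Qed.

(** A diagonal argument for the countable cover of R^N by the pieces whose image
    has a given second component: if for no n the n-th coordinates on the n-th
    piece exhausted R, a sequence whose n-th term is not among them, for each n,
    would lie in no piece. A piece that is mapped onto R embeds in E. *)
Lemma card_R_le_prod_nat (R : realType) (T : Type) (E : set T) :
  [set: R] #<= E `*` [set: nat] -> [set: R] #<= E.
Proof.
elim/Ppointed: T => T in E *; first by rewrite emptyE set0X !card_le0.
move=> /(card_le_trans (card_seqR_le R))/card_le_pfun[h hE hi].
have [n nP] : exists n, forall x, exists f, (h f).2 = n /\ f n = x.
  apply: contrapT => /forallNP H.
  have /choice[x xP] : forall n, exists x, ~ exists f, (h f).2 = n /\ f n = x.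
    by move=> n; apply/existsNP/H.
  by apply: (xP (h x).2); exists x.
have [f fP] := choice nP.
apply: (@card_le_fun _ _ _ _ (fun x => (h (f x)).1)).
  by move=> x _; have [] := hE (f x) I.
move=> x y _ _ E1; have [Ex <-] := fP x; have [Ey <-] := fP y.
by congr (_ n); apply: hi; rewrite ?inE//; apply: injective_projections; rewrite ?Ex ?Ey.
Qed.

(** R is replaced by R x R: either some vertical line is mapped into D, or every
    vertical line has a point outside D, and these points embed R in B. *)
Lemma card_R_le_setU (R : realType) (T : Type) (B D : set T) :
  [set: R] #<= B `|` D -> [set: R] #<= B \/ [set: R] #<= D.
Proof.
elim/Ppointed: T => T in B D *; first by rewrite !emptyE; left.
move=> /(card_le_trans (card_pairR_le R))/card_le_pfun[h hE hi].
have hi' p q : h p = h q -> p = q by apply: hi; rewrite inE.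
have [[x xP]|H] := pselect (exists x, forall y, D (h (x, y))).
  right; apply: (@card_le_fun _ _ _ _ (fun y => h (x, y))) => // y z _ _ /hi'.
  by case.
left; have /choice[y yP] : forall x, exists y, ~ D (h (x, y)).
  by move=> x; apply/existsNP => xP; apply: H; exists x.
apply: (@card_le_fun _ _ _ _ (fun x => h (x, y x))).
  by move=> x _; have [//|/yP] := hE (x, y x) I.
by move=> x z _ _ /hi' [].
Qed.

(** Hilbert's hotel: the points of a copy of nat inside b are moved to its odd
    places, and the new copy of nat takes the even ones. *)
Lemma card_sumnat_eq (b : Type) : [set: nat] #<= [set: b] ->
  [set: b + nat] #= [set: b].
Proof.
move=> /card_leT_fun[i ii]; apply: card_eqI; last first.
  by apply: (@card_le_fun _ _ _ _ inl) => // x y _ _ [].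
pose j (x : b) : b := if pselect (exists n, i n = x) is left e
  then i (projT1 (cid e)).*2.+1 else x.
have jP x : (exists n, i n = x /\ j x = i n.*2.+1) \/ (forall n, i n <> x) /\ j x = x.
  rewrite /j; case: pselect => [e|ne]; last by right; split=> // n E; apply: ne; exists n.
  by left; case: cid => n /= E; exists n.
apply: (@card_le_fun _ _ _ _ (fun s => match s with inl x => j x | inr n => i n.*2 end)) => //.
move=> [x|n] [y|m] _ _ /=.
- case: (jP x) => -[]; case: (jP y) => -[].
  + by move=> m [<- ->] n [<- ->] /ii[] /double_inj ->.
  + by move=> ny -> n [_ ->] E; have := ny _ E.
  + by move=> m [_ ->] nx -> /esym E; have := nx _ E.
  + by move=> _ -> _ -> ->.
- case: (jP x) => -[]; last by move=> nx -> /esym E; have := nx _ E.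
  by move=> n [_ ->] /ii /(congr1 odd); rewrite /= !odd_double.
- case: (jP y) => -[]; last by move=> nx -> E; have := nx _ E.
  by move=> k [_ ->] /ii /(congr1 odd); rewrite /= !odd_double.
- by move=> /ii/double_inj ->.
Qed.

Lemma card_natsum_leR (R : realType) (b : Type) : [set: b] #<= [set: R] ->
  [set: b + nat] #<= [set: R].
Proof.
move=> /card_leT_fun[j ji]; apply: card_le_trans (card_pairR_le R).
apply: (@card_le_fun _ _ _ _ (fun s => match s with
   inl x => (0, j x) | inr n => (1, n%:R) end)) => //.
move=> [x|n] [y|m] _ _ /=.
- by move=> [/ji ->].
- by move=> [/eqP]; rewrite eq_sym oner_eq0.
- by move=> [/eqP]; rewrite oner_eq0.
- by move=> [/eqP]; rewrite eqr_nat => /eqP ->.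
Qed.

(** * Linear independence modulo a subspace *)

Section linear_algebra.
Variables (R : realType) (V : lmodType R).
Implicit Types (X Y W B E Z : set V) (s : seq V) (c : V -> R).

(** This is the sum of Y and of the linear span of B. *)
Definition spanmod Y B : set V := [set u | exists s c,
  [set` s] `<=` B /\ Y (u - \sum_(v <- s) c v *: v)].

(** The images of the elements of B in the quotient by Y are distinct and
    linearly independent. *)
Definition indep_mod Y B := forall s c, uniq s -> [set` s] `<=` B ->
  Y (\sum_(v <- s) c v *: v) -> forall v, v \in s -> c v = 0.

Lemma subspace0 W : vector_subspace W -> W 0. Proof. by case. Qed.

Lemma subspaceZ W a u : vector_subspace W -> W u -> W (a *: u).
Proof. by move=> [W0 WL] Wu; rewrite -[_ *: _]addr0; exact: WL. Qed.

Lemma subspaceD W u v : vector_subspace W -> W u -> W v -> W (u + v).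
Proof. by move=> [W0 WL] Wu Wv; rewrite -[u]scale1r; exact: WL. Qed.

Lemma subspaceN W u : vector_subspace W -> W u -> W (- u).
Proof. by move=> sW Wu; rewrite -scaleN1r; exact: subspaceZ. Qed.

Lemma subspaceB W u v : vector_subspace W -> W u -> W v -> W (u - v).
Proof. by move=> sW Wu Wv; apply: subspaceD => //; exact: subspaceN. Qed.

Lemma subspace_sum W (I : Type) (r : seq I) (P : pred I) (F : I -> V) :
  vector_subspace W -> (forall i, P i -> W (F i)) -> W (\sum_(i <- r | P i) F i).
Proof.
move=> sW WF; elim/big_ind : _ => //; first exact: subspace0.
by move=> x y; exact: subspaceD.
Qed.

Lemma subspace_sumin W s (F : V -> V) :
  vector_subspace W -> (forall i, i \in s -> W (F i)) -> W (\sum_(i <- s) F i).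
Proof. by move=> sW WF; rewrite big_seq; exact: subspace_sum. Qed.

Lemma subspace_set0 : vector_subspace [set (0 : V)].
Proof. by split=> // a u v /= -> ->; rewrite scaler0 addr0. Qed.

(** Spans are given by sequences with possible repetitions, independence by
    duplicate-free ones; collecting equal terms passes from the first to the
    second. *)
Lemma sum_count_undup s c :
  \sum_(v <- s) c v *: v = \sum_(v <- undup s) ((count_mem v s)%:R * c v) *: v.
Proof.
rewrite -big_undup_iterop_count; apply: eq_bigr => v _.
by rewrite Monoid.iteropE /= iter_addr_0 -scalerA scaler_nat.
Qed.

Lemma spanmod_min Y B W : vector_subspace W -> Y `<=` W -> B `<=` W ->
  spanmod Y B `<=` W.
Proof.
move=> sW YW BW u [s [c [sB uY]]]; rewrite -[u](subrK (\sum_(v <- s) c v *: v)).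
apply: subspaceD => //; first exact: YW.
by apply: subspace_sumin => // v vs; apply: subspaceZ => //; apply/BW/sB.
Qed.

Lemma spanmodS Y B B' : B `<=` B' -> spanmod Y B `<=` spanmod Y B'.
Proof. by move=> BB' u [s [c [sB uY]]]; exists s, c; split=> // v /sB/BB'. Qed.

Section with_subspace.
Variables (Y : set V) (sY : vector_subspace Y).

Lemma sub_spanmod B : B `<=` spanmod Y B.
Proof.
move=> v Bv; exists [:: v], (fun=> 1); split; first by move=> u /=; rewrite inE => /eqP ->.
by rewrite big_seq1 scale1r subrr; exact: subspace0.
Qed.

Lemma sub_spanmodl B : Y `<=` spanmod Y B.
Proof. by move=> v Yv; exists [::], (fun=> 0); split=> //; rewrite big_nil subr0. Qed.

Lemma spanmod_subspace B : vector_subspace (spanmod Y B).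
Proof.
split; first by apply: sub_spanmodl; exact: subspace0.
move=> a u v [s [c [sB Yu]]] [t [d [tB Yv]]].
pose e w := (count_mem w s)%:R * (a * c w) + (count_mem w t)%:R * d w.
exists (undup (s ++ t)), e; split.
  by move=> w /=; rewrite mem_undup mem_cat => /orP[/sB|/tB].
have sub r f : {subset r <= s ++ t} ->
    \sum_(w <- undup (s ++ t)) ((count_mem w r)%:R * f w) *: w = \sum_(w <- r) f w *: w.
  move=> rst; rewrite [RHS]sum_count_undup [LHS](bigID (mem r))/= [X in _ + X]big1 ?addr0.
    rewrite -big_filter; apply: perm_big; apply: uniq_perm; rewrite ?filter_uniq ?undup_uniq//.
    move=> w; rewrite mem_filter !mem_undup; case wr: (w \in r) => //=.
    exact: rst.
  by move=> w; move=> /count_memPn ->; rewrite mul0r scale0r.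
rewrite (eq_bigr (fun w => ((count_mem w s)%:R * (a * c w)) *: w +
    ((count_mem w t)%:R * d w) *: w));
  last by move=> w _; rewrite /e scalerDl.
rewrite big_split/= (sub s (fun w => a * c w)); last by move=> w; rewrite mem_cat => ->.
rewrite (sub t d); last by move=> w; rewrite mem_cat => ->; rewrite orbT.
rewrite (eq_bigr (fun w => a *: (c w *: w))); last by move=> w _; rewrite scalerA.
by rewrite -scaler_sumr opprD addrACA -scalerBr; exact: sY.2.
Qed.

Lemma indep_mod_notin B v : indep_mod Y B -> B v -> ~ spanmod Y (B `\ v) v.
Proof.
move=> iB Bv [s [c [sB]]]; rewrite sum_count_undup.
pose s' := undup s; pose c' w := (count_mem w s)%:R * c w.
rewrite -/s' -[\sum_(w <- s') _]/(\sum_(w <- s') c' w *: w) => Yv.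
have vs : v \notin s' by apply/negP; rewrite mem_undup => /sB[_ /=].
pose d w := if w == v then 1 else - c' w.
have /(_ v) : forall w, w \in v :: s' -> d w = 0.
  apply: iB; first by rewrite /= vs undup_uniq.
    by move=> w /=; rewrite inE mem_undup => /orP[/eqP ->//|/sB[]].
  rewrite big_cons {1}/d eqxx scale1r.
  rewrite (_ : \sum_(w <- s') d w *: w = - \sum_(w <- s') c' w *: w)//.
  rewrite -sumrN [in LHS]big_seq [in RHS]big_seq; apply: eq_bigr => w ws; rewrite /d.
  by case: eqVneq => [wv|_]; [rewrite -wv ws in vs | rewrite scaleNr].
by rewrite mem_head /d eqxx => /(_ isT) /eqP; rewrite oner_eq0.
Qed.

Lemma indep_modU1 B v : indep_mod Y B -> ~ spanmod Y B v -> indep_mod Y (v |` B).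
Proof.
move=> iB nv s c us sB Ys.
have [vs|vs] := boolP (v \in s); last first.
  by apply: (iB s c) => // w ws; have [/= wv|//] := sB w ws; rewrite -wv ws in vs.
have rB : [set` rem v s] `<=` B.
  move=> w /=; rewrite (mem_rem_uniq _ us) !inE => /andP[wv ws].
  by have [/= /eqP|//] := sB w ws; rewrite (negbTE wv).
have E : \sum_(w <- s) c w *: w = c v *: v + \sum_(w <- rem v s) c w *: w.
  by rewrite (perm_big _ (perm_to_rem vs)) big_cons.
have cv : c v = 0.
  apply: contrapT => /eqP cv; apply: nv.
  exists (rem v s), (fun w => - (c v)^-1 * c w); split => //.
  have := subspaceZ (c v)^-1 sY Ys; rewrite E scalerDr scalerA mulVf// scale1r.
  congr Y; congr (_ + _); rewrite -sumrN scaler_sumr; apply: eq_bigr => w _.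
  by rewrite -scaleNr mulNr opprK scalerA.
move=> w ws; have [->//|wv] := eqVneq w v.
apply: (iB (rem v s) c) => //; first exact: rem_uniq.
  by move: Ys; rewrite E cv scale0r add0r.
by rewrite (mem_rem_uniq _ us) !inE wv.
Qed.

(** Zorn's lemma: a maximal independent subset of X spans X modulo Y. *)
Lemma indep_mod_extend X B : indep_mod Y B -> B `<=` X ->
  exists E, [/\ indep_mod Y E, B `<=` E, E `<=` X & X `<=` spanmod Y E].
Proof.
move=> iB BX.
(* The empty set is admitted for the sake of the union of the empty chain; the
   maximal element is shown afterwards to satisfy the second alternative. *)
pose P C := C = set0 \/ [/\ indep_mod Y C, B `<=` C & C `<=` X].
have [|E [PE Emax]] := @Zorn_bigcup V P.
  move=> F FP Ftot.
  have [[C0 FC0 BC0]|none] := pselect (exists2 C, F C & C !=set0); last first.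
    left; apply/seteqP; split => // v [C FC Cv]; apply: none; exists C => //.
    by exists v.
  have FP' C v : F C -> C v -> [/\ indep_mod Y C, B `<=` C & C `<=` X].
    by move=> /FP[->|].
  right; split; last first.
    by move=> v [C FC Cv]; have [_ _ ] := FP' _ _ FC Cv; exact.
    case: BC0 => u C0u; have [_ BC _] := FP' _ _ FC0 C0u.
    by move=> v /BC ?; exists C0.
  move=> s c us sF Ys.
  have [C FC sC] : exists2 C, F C & [set` s] `<=` C.
    elim: s sF {us Ys} => [|v s IH] sF; first by exists C0.
    have [|C FC sC] := IH; first by move=> w ws; apply: sF; rewrite /= inE ws orbT.
    have [|D FD Dv] := sF v; first by rewrite /= mem_head.
    have [CD|DC] := Ftot _ _ FC FD.
      by exists D => // w /=; rewrite inE => /orP[/eqP ->//|/sC/CD].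
    by exists C => // w /=; rewrite inE => /orP[/eqP ->|/sC//]; exact: DC.
  case: s us sF Ys sC => // v s us sF Ys sC.
  have [|iC _ _] := FP' C v FC; first by apply: sC; rewrite /= mem_head.
  exact: iC.
have {}PE : [/\ indep_mod Y E, B `<=` E & E `<=` X].
  case: PE => [E0|//]; have [B0|/set0P[v Bv]] := eqVneq B set0; first by rewrite E0 -B0; split.
  exfalso; apply: (Emax B); last by right; split.
  by rewrite E0; split => // /(_ _ Bv).
case: PE => iE BE EX; exists E; split => // v Xv; apply: contrapT => nv.
apply: (Emax (v |` E)); last first.
  right; split; [exact: indep_modU1|by move=> w /BE; right|].
  by move=> w [->//|/EX].
split; first by move=> w; right.
by move=> /(_ v (or_introl erefl)) Ev; apply: nv; exact: sub_spanmod.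
Qed.

(** Each e in E involves finitely many vectors of a basis Z' of X modulo Y that
    contains Z. Every z in Z' is involved by some e, since otherwise the rest of
    Z' would span E, hence X, hence z. Listing the finite supports maps E x nat
    onto a superset of Z. *)
Lemma card_indep_mod_le X Z E : indep_mod Y Z -> Z `<=` X -> E `<=` X ->
  X `<=` spanmod Y E -> Z #<= E `*` [set: nat].
Proof.
move=> iZ ZX EX XE.
(* Z itself need not span X, so it is first completed to a basis. *)
have [Z' [iZ' ZZ' Z'X XZ']] := indep_mod_extend iZ ZX.
apply: card_le_trans (subset_card_le ZZ') _.
have /choice[s sP] : forall e, exists s, E e -> [set` s] `<=` Z' /\
    spanmod Y [set` s] e.
  move=> e; have [Ee|] := pselect (E e); last by exists [::].
  have [s [c [sZ Ys]]] := XZ' _ (EX _ Ee); exists s => _; split=> //; exists s, c; split=> //.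
apply: (@card_le_surj _ _ _ _ (fun p => nth 0 (s p.1) p.2)) => z Zz.
apply: contrapT => H; apply: (indep_mod_notin iZ' Zz).
apply: spanmod_min (XE _ (Z'X _ Zz)); first exact: spanmod_subspace.
  exact: sub_spanmodl.
move=> e Ee; have [sZ es] := sP e Ee.
apply: spanmodS es => v vs; split; first exact: sZ.
move=> /= vz; apply: H; exists (e, index z (s e)) => //.
by rewrite /= nth_index// -vz.
Qed.

(** In the quotient by Y the map f multiplies each b by the nonzero scalar k b. *)
Lemma indep_mod_perturb B (f : V -> V) (k : V -> R) : indep_mod Y B ->
  (forall b, B b -> k b != 0) -> (forall b, B b -> Y (f b - k b *: b)) ->
  {in B &, injective f} /\ indep_mod Y (f @` B).
Proof.
move=> iB k0 fk; split.
  move=> b b'; rewrite !inE => Bb Bb' E; apply: contrapT => /eqP bb'.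
  have /(_ b) : forall v, v \in [:: b; b'] -> (if v == b then k b else - k b') = 0.
    apply: iB; first by rewrite /= inE bb'.
      by move=> v /=; rewrite !inE => /orP[] /eqP ->.
    rewrite !big_cons big_nil addr0 eqxx eq_sym (negbTE bb').
    have := subspaceB sY (fk _ Bb') (fk _ Bb).
    by rewrite E opprB addrC addrA subrK scaleNr.
  by rewrite mem_head eqxx => /(_ isT)/eqP; rewrite (negbTE (k0 _ Bb)).
move=> s c us sB Ys.
have /choice[g gP] : forall v, exists b, (f @` B) v -> B b /\ f b = v.
  move=> v; have [[b Bb <-]|] := pselect ((f @` B) v); first by exists b.
  by exists 0.
have gP' v : v \in s -> B (g v) /\ f (g v) = v by move=> /sB; exact: gP.
have ug : uniq (map g s).
  by rewrite map_inj_in_uniq// => u v /gP'[_ {2}<-] /gP'[_ {2}<-] ->.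
have H : forall b, b \in map g s -> c (f b) * k b = 0.
  apply: (iB) => //; first by move=> b /mapP[v /gP'[? _] ->].
  rewrite big_map big_seq (eq_bigr (fun v => c v *: v - c v *: (v - k (g v) *: g v))); last first.
    by move=> v /gP'[_ ->]; rewrite scalerBr opprB addrC subrK scalerA.
  rewrite -big_seq big_split/= sumrN; apply: subspaceB => //.
  apply: subspace_sumin => // v /gP'[Bg fg].
  by apply: subspaceZ => //; have := fk _ Bg; rewrite fg.
move=> v vs; have [Bg fg] := gP' v vs.
have /eqP := H (g v) (map_f g vs); rewrite fg mulf_eq0 (negbTE (k0 _ Bg)) orbF.
by move/eqP.
Qed.

Lemma indep_mod0 B : indep_mod Y B -> lin_indep B.
Proof. by move=> iB s c us sB s0; apply: iB => //; rewrite s0; exact: subspace0. Qed.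

Lemma indep_mod_sub B B' : B `<=` B' -> indep_mod Y B' -> indep_mod Y B.
Proof. by move=> BB' iB s c us sB; apply: iB => // v /sB/BB'. Qed.

End with_subspace.

Section complement.
Variables X Y : set V.
Hypotheses (sX : vector_subspace X) (sY : vector_subspace Y).

Lemma hamel_basis_spanmod0 B : indep_mod Y B ->
  hamel_basis (spanmod [set 0] B) B.
Proof.
move=> iB; split; first exact: (@indep_mod0 Y).
by move=> u; split=> -[s [c [sB /= H]]]; exists s, c; split=> //;
  [apply/eqP; rewrite -subr_eq0 H|rewrite H subrr].
Qed.

(** Independence modulo Y makes the span of B meet Y in 0 only. *)
Lemma subspace_within_span (a : Type) B : indep_mod Y B -> B `<=` X ->
  B #= [set: a] ->
  subspace_within X (X `\` Y) a (spanmod [set 0] B).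
Proof.
move=> iB BX Ba; have s0 := subspace_set0.
have BsX : spanmod [set 0] B `<=` X.
  by apply: spanmod_min => // _ ->; exact: subspace0.
split => //; first exact: spanmod_subspace.
  by exists B; split=> //; exact: hamel_basis_spanmod0.
move=> u Mu; have [Yu|] := pselect (Y u); last by left; split=> //; exact: BsX.
right; have [s [c [sB /= /eqP]]] := Mu; rewrite subr_eq0 => /eqP uE.
move: Yu; rewrite {}uE sum_count_undup => Yu.
rewrite big_seq big1// => v vs; rewrite (iB _ _ _ _ Yu)// ?scale0r ?undup_uniq//.
by move=> w /=; rewrite mem_undup; exact: sB.
Qed.

(** A combination of basis vectors that lies in Y is in M, hence outside Y or
    0; being in Y, it is 0. *)
Lemma subspace_within_basis (a : Type) M : subspace_within X (X `\` Y) a M ->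
  exists B, [/\ indep_mod Y B, B `<=` X, B #= [set: a] & M = spanmod [set 0] B].
Proof.
move=> [sM MX [B [[iB BM] Ba]] MA]; exists B.
have BsubM : B `<=` M.
  move=> v Bv; apply/BM; exists [:: v], (fun=> 1); rewrite big_seq1 scale1r; split=> //.
  by move=> w /=; rewrite inE => /eqP ->.
split=> //; last 1 first.
  apply/seteqP; split=> u.
    by move=> /BM[s [c [sB ->]]]; exists s, c; rewrite subrr.
  by move=> [s [c [sB /= /eqP]]]; rewrite subr_eq0 => /eqP ->; apply/BM; exists s, c.
  move=> s c us sB Ys; apply: iB => //.
  have [|[]//|//] := MA (\sum_(v <- s) c v *: v); apply/BM; by exists s, c.
by move=> v /BsubM/MX.
Qed.

End complement.
End linear_algebra.

(** * Lineability of the complement of a subspace *)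

(** Lets a family be altered at the points v n and nowhere else. *)
Lemma partial_inverse (T : Type) (v : nat -> T) : injective v ->
  exists2 ix : T -> option nat, forall n, ix (v n) = Some n &
    forall u, (forall n, u <> v n) -> ix u = None.
Proof.
move=> vi; have /choice[ix ixP] : forall u, exists o : option nat,
    (forall n, u = v n -> o = Some n) /\ ((forall n, u <> v n) -> o = None).
  move=> u; have [[n un]|h] := pselect (exists n, u = v n).
    exists (Some n); split => [m|/(_ n)//].
    by rewrite un => /vi ->.
  by exists None; split=> // n un; exfalso; apply: h; exists n.
by exists ix => [n|u]; [exact: (ixP _).1|exact: (ixP _).2].
Qed.

Section abstract_lineability.
Variables (R : realType) (V : lmodType R) (X Y : set V) (N : V -> R).
Hypotheses (sX : vector_subspace X) (sY : vector_subspace Y) (YX : Y `<=` X).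
Variable z : R -> V.
Hypotheses (z_inj : injective z) (zX : range z `<=` X) (zY : indep_mod Y (range z)).
Hypothesis (card_X : X #<= [set: R]).
Hypothesis small_scale : forall v (e : R), X v -> 0 < e ->
  exists2 c : R, c != 0 & N (c *: v) < e.
Variable y : V.
Hypotheses (Yy : Y y) (y_neq0 : y != 0).
Hypothesis dense_perturb : exists2 d : nat -> V, forall n, Y (d n) &
  forall v : nat -> V, (forall n, X (v n)) ->
  exists2 c : nat -> R, forall n, c n != 0 &
  forall f (e : R), X f -> 0 < e -> exists n, N (d n + c n *: v n - f) < e.

Let A := X `\` Y.
Let tau := norm_topology X N.

Lemma card_range_z : range z #= [set: R].
Proof. by apply: inj_card_eq => x1 x2 _ _; exact: z_inj. Qed.

(** The continuum many z_r are independent modulo Y, so a spanning set E has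
    c <= #|E x nat|, and the factor nat can be dropped. *)
Lemma card_R_le_spanning E : E `<=` X -> X `<=` spanmod Y E -> [set: R] #<= E.
Proof.
move=> EX XE; apply: card_R_le_prod_nat.
apply: card_le_trans (card_indep_mod_le sY zY zX EX XE).
by have /card_eqPle[] := card_range_z.
Qed.

Lemma lineable_le (a : Type) : [set: a] #<= [set: R] -> lineable X A a.
Proof.
move=> /card_leT_fun[i ii]; exists (spanmod [set 0] (range (z \o i))).
have sub : range (z \o i) `<=` range z by move=> _ [x _ <-]; exists (i x).
apply: subspace_within_span => //.
- exact: indep_mod_sub zY.
- exact: subset_trans zX.
- by apply: inj_card_eq => x1 x2 _ _ /= /z_inj/ii.
Qed.

Lemma has_dim_R : has_dim X R.
Proof.
have s0 := @subspace_set0 R V.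
have iz : indep_mod [set 0] (range z).
  by move=> s c us sz s0'; apply: zY => //; rewrite s0'; exact: subspace0.
have [B [iB zB BX XB]] := indep_mod_extend s0 iz zX.
exists B; split; last first.
  apply: card_eqI; first exact: card_le_trans (subset_card_le BX) card_X.
  apply: card_le_trans (subset_card_le zB).
  by have /card_eqPle[] := card_range_z.
rewrite (_ : X = spanmod [set 0] B); first exact: (hamel_basis_spanmod0 s0).
apply/seteqP; split => //; apply: spanmod_min => // _ ->; exact: subspace0.
Qed.

Lemma lineable_pair_R (a : Type) : [set: a] #<= [set: R] -> lineable_pair X A a R.
Proof.
move=> aR; split; first exact: lineable_le.
move=> M /subspace_within_basis[B [iB BX _ ->]].
have [E [iE BE EX XE]] := indep_mod_extend sY iB BX.
exists (spanmod [set 0] E); split => //; last exact: spanmodS.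
apply: subspace_within_span => //; apply: card_eqI.
  exact: card_le_trans (subset_card_le EX) card_X.
exact: card_R_le_spanning.
Qed.

(** Replace countably many basis vectors v_n of the given subspace by
    y + c_n v_n with c_n v_n -> 0 and 0 <> y in Y. The new vectors are still
    independent modulo Y, so they span an a-dimensional subspace inside the
    union of A and {0}. A closed subspace containing it contains the limit y,
    which is not in A. *)
Lemma not_spaceable_pair (a b : Type) : [set: nat] #<= [set: a] ->
  ~ spaceable_pair X tau A a b.
Proof.
move=> /card_leT_fun[i ii] [[M]] /subspace_within_basis[B [iB BX Ba _]].
move=> spc.
have [g gB gi] : exists2 g : a -> V, (forall x, B (g x)) & injective g.
  by have /card_eqPle[_ /card_leT_set_fun] := Ba.
pose v n := g (i n).
have vi : injective v by move=> n m /gi/ii.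
have /choice[c cP] : forall n, exists c : R, c != 0 /\ N (c *: v n) < n.+1%:R^-1.
  by move=> n; have [|c] := @small_scale (v n) n.+1%:R^-1 (BX _ (gB _)); [|exists c].
have [ix ixv _] := partial_inverse vi.
pose f u := if ix u is Some n then y + c n *: u else u.
pose k u := if ix u is Some n then c n else 1.
have [fi iE] : {in B &, injective f} /\ indep_mod Y (f @` B).
  apply: (@indep_mod_perturb _ _ _ sY B f k) => // u Bu; rewrite /k /f; case: (ix u) => [n|].
  - exact: (cP n).1.
  - exact: oner_neq0.
  - by rewrite addrK.
  - by rewrite scale1r subrr; exact: subspace0.
have fBX : f @` B `<=` X.
  move=> _ [u Bu <-]; rewrite /f; case: (ix u) => [n|]; last exact: BX.
  by apply: subspaceD => //; [exact: YX|apply: subspaceZ => //; exact: BX].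
have fBa : f @` B #= [set: a].
  by apply: card_eq_trans Ba; exact: inj_card_eq.
have [M' [[sM' M'X _ M'A] clM' MM']] := spc _ (subspace_within_span sX sY iE fBX fBa).
have nM'y : (X `\` M') y.
  split; first exact: YX.
  by move=> /M'A[[_ //]|/= y0]; move: y_neq0; rewrite y0 eqxx.
have [_ /(_ _ nM'y)[e e0 eP]] := clM'.
have [n ne] : exists n, n.+1%:R^-1 < e.
  exists (Num.truncn e^-1); rewrite invf_plt ?posrE//.
  by rewrite truncnS_gt.
have My : M' (y + c n *: v n).
  apply/MM'/sub_spanmod; first exact: subspace_set0.
  by exists (v n); [exact: gB|rewrite /f ixv].
have [//|_] := eP (y + c n *: v n) (M'X _ My); last by apply.
by rewrite addrC addKr; exact: lt_trans (cP n).2 ne.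
Qed.

(** A basis E of X modulo Y extending a basis B of M keeps c vectors outside B,
    because #|B| < c. From them are taken a set indexed by the part of b that B
    does not already fill, and a sequence v_n. Moving v_n to d_n + c_n v_n makes
    the span dense; B is left untouched, so M stays inside. *)
Lemma dense_lineable_pair_lt (a b : Type) : card_lt a R ->
  [set: nat] #<= [set: b] -> [set: a] #<= [set: b] -> [set: b] #<= [set: R] ->
  dense_lineable_pair X tau A a b.
Proof.
move=> [aR Ra] nb ab bR; split; first exact: lineable_le.
move=> M /subspace_within_basis[B [iB BX Ba ->]].
have [E [iE BE EX XE]] := indep_mod_extend sY iB BX.
have RD : [set: R] #<= E `\` B.
  have : [set: R] #<= B `|` (E `\` B) by rewrite setDUK//; exact: card_R_le_spanning.
  by move=> /card_R_le_setU[|//]; have /card_eqPle[Ba' _] := Ba;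
     move=> /card_le_trans/(_ Ba').
have [h hE hi] : exists2 h : b + nat -> V, (forall x, (E `\` B) (h x)) & injective h.
  exact/card_leT_set_fun/(card_le_trans (card_natsum_leR bR) RD).
have [i ii] := card_leT_fun ab.
(* The new vectors: h (inl x) for the x in b outside the copy of a, and the
   sequence v n = h (inr n), so that B and G together have b + nat elements. *)
pose G := (h \o inl) @` (~` range i) `|` range (h \o inr).
have GED : G `<=` E `\` B by move=> _ [[x _ <-]|[x _ <-]]; exact: hE.
have Cb : B `|` G #= [set: b].
  apply: card_eq_trans (card_sumnat_eq nb).
  have BG : B `&` G = set0.
    by rewrite -subset0 => u [Bu /GED[]].
  have -> : [set: b + nat] = inl @` range i `|` (inl @` (~` range i) `|` range inr).
    apply/seteqP; split => // -[x|n] _; last by right; right; exists n.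
    by have [ix|ix] := pselect (range i x); [left|right; left]; exists x.
  apply: card_setU_eq => //.
  - apply: card_eq_trans Ba _; rewrite card_eq_sym image_comp.
    by apply: inj_card_eq => x1 x2 _ _ /= [/ii].
  - apply: card_setU_eq.
    + rewrite card_eq_sym; apply: (@card_eq_trans _ _ _ _ (~` range i)).
        by apply: inj_card_eq => x1 x2 _ _ [].
      by rewrite card_eq_sym; apply: inj_card_eq => x1 x2 _ _ /= /hi [].
    + rewrite card_eq_sym; apply: (@card_eq_trans _ _ _ _ [set: nat]).
        by apply: inj_card_eq => x1 x2 _ _ [].
      by rewrite card_eq_sym; apply: inj_card_eq => x1 x2 _ _ /= /hi [].
    + by rewrite -subset0 => u [[x _ <-] [n _ /= /hi]].
    + by rewrite -subset0 => u [[x _ <-] [n _]].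
  - rewrite -subset0 => u [[_ [x _ <-] <-] [[x' nx [xx']]|[n _]//]].
    by apply: nx; exists x.
have [d dY dP] := dense_perturb.
pose v n := h (inr n).
have [|c c0 cP] := dP v; first by move=> n; apply: EX; have [] := hE (inr n).
have vi : injective v by move=> n p /hi [].
have [ix ixv ixN] := partial_inverse vi.
have ixB u : B u -> ix u = None.
  by move=> Bu; apply: ixN => n un; have [_] := hE (inr n); rewrite -/(v n) -un.
pose f u := if ix u is Some n then d n + c n *: u else u.
pose k u := if ix u is Some n then c n else 1.
have BGX : B `|` G `<=` X by move=> u [/BX//|/GED[/EX]].
have iBG : indep_mod Y (B `|` G).
  by apply: indep_mod_sub iE => u [/BE//|/GED[]].
have [fi ifE] : {in B `|` G &, injective f} /\ indep_mod Y (f @` (B `|` G)).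
  apply: (@indep_mod_perturb _ _ _ sY _ f k) => // u Bu; rewrite /k /f; case: (ix u) => [n|] //.
  - by rewrite addrK.
  - by rewrite scale1r subrr; exact: subspace0.
have fBX : f @` (B `|` G) `<=` X.
  move=> _ [u Bu <-]; rewrite /f; case: (ix u) => [n|]; last exact: BGX.
  by apply: subspaceD => //; [exact/YX/dY|apply: subspaceZ => //; exact: BGX].
have fBb : f @` (B `|` G) #= [set: b].
  by apply: card_eq_trans Cb; exact: inj_card_eq.
exists (spanmod [set 0] (f @` (B `|` G))); split.
- exact: subspace_within_span.
- move=> U [f0 Uf0] [UX Uo].
  have [e e0 eP] := Uo _ Uf0.
  have [n ne] := cP _ _ (UX _ Uf0) e0.
  have Mn : (f @` (B `|` G)) (d n + c n *: v n).
    by exists (v n); [right; right; exists n|rewrite /f ixv].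
  exists (d n + c n *: v n); split.
    by apply: eP => //; exact: fBX.
  apply: sub_spanmod => //; exact: subspace_set0.
- apply: spanmodS => u Bu; exists u; first by left.
  by rewrite /f ixB.
Qed.

(** The case a = 1, b = c of the previous result, applied to the line of x. *)
Lemma pointwise_dense_lineable_R : pointwise_dense_lineable X tau A R.
Proof.
move=> x [Xx nYx].
have i0 : indep_mod Y set0.
  move=> [//|v s] c _ sB _; have := sB v; rewrite /= mem_head => /(_ isT) [].
have ix : indep_mod Y [set x].
  rewrite -[X in indep_mod _ X]setU0; apply: indep_modU1 => //.
  move=> /(spanmod_min sY (@subset_refl _ Y)) -/(_ (@sub0set _ _)) //.
have unitR : card_lt unit R.
  split; first by apply: (@card_le_fun _ _ _ _ (fun=> 0)) => // -[] [].
  move=> /card_leT_fun[j ji].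
  have /ji/eqP : j 0 = j 1 by case: (j 0); case: (j 1).
  by rewrite eq_sym oner_eq0.
have [|||_] := @dense_lineable_pair_lt unit R unitR.
- by apply: (@card_le_fun _ _ _ _ (fun n => n%:R)) => // n m _ _ /eqP; rewrite eqr_nat => /eqP.
- by case: unitR.
- exact: card_lexx.
have x1 : [set x] #= [set: unit].
  by rewrite (_ : [set: unit] = [set tt]); [exact: eq_card1|apply/seteqP; split=> -[]].
have sx : [set x] `<=` X by move=> _ ->.
move=> /(_ _ (subspace_within_span sX sY ix sx x1))[M' [sM' dM' MM']].
exists M'; split=> //; apply: MM'; apply: sub_spanmod => //; exact: subspace_set0.
Qed.

Theorem abstract_lineability :
  [/\ (forall a b : Type, card_lt a R -> [set: nat] #<= [set: b] ->
         [set: a] #<= [set: b] -> [set: b] #<= [set: R] ->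
         dense_lineable_pair X tau A a b),
      (pointwise_maximal_dense_lineable X tau A /\
       pointwise_dense_lineable X tau A R),
      (forall a b : Type, [set: nat] #<= [set: a] -> [set: a] #<= [set: b] ->
         ~ spaceable_pair X tau A a b) &
      (forall a : Type, [set: a] #<= [set: R] -> lineable_pair X A a R)].
Proof.
split.
- exact: dense_lineable_pair_lt.
- split; last exact: pointwise_dense_lineable_R.
  by exists R; split; [exact: has_dim_R|exact: pointwise_dense_lineable_R].
- by move=> a b na _; exact: not_spaceable_pair.
- exact: lineable_pair_R.
Qed.

End abstract_lineability.

(** * Orlicz functions and their inverses *)

Section orlicz.
Variables (R : realType) (phi : R -> R).
Hypothesis phi_orlicz : orlicz_function phi.

Lemma orlicz_ge0 u : 0 <= u -> 0 <= phi u.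
Proof. by case: phi_orlicz => p0 _ _ _ _; exact: p0. Qed.

Lemma orlicz0 : phi 0 = 0. Proof. by case: phi_orlicz. Qed.

Lemma orlicz_gt0 u : 0 < u -> 0 < phi u.
Proof. by case: phi_orlicz => _ _ _ _; exact. Qed.

Lemma orlicz_conv l u v : 0 <= l <= 1 -> 0 <= u -> 0 <= v ->
  phi (l * u + (1 - l) * v) <= l * phi u + (1 - l) * phi v.
Proof.
move=> /andP[l0 l1] u0 v0; case: phi_orlicz => _ + _ _ _.
move=> /(_ (Itv01 l0 l1) u v).
by rewrite !inE => /(_ u0 v0); rewrite !convRE/=; exact.
Qed.

Lemma orlicz_scale l u : 0 <= l <= 1 -> 0 <= u -> phi (l * u) <= l * phi u.
Proof.
move=> l01 u0; have := @orlicz_conv l u 0 l01 u0 (lexx _).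
by rewrite orlicz0 !mulr0 !addr0.
Qed.

Lemma orlicz_lt u v : 0 <= u -> u < v -> phi u < phi v.
Proof.
move=> u0 uv; have v0 := le_lt_trans u0 uv.
have := @orlicz_scale (u / v) v _ (ltW v0).
rewrite divfK ?gt_eqF// => /(_ _)/le_lt_trans; apply.
  by rewrite divr_ge0 ?(ltW v0)//= ler_pdivrMr// mul1r ltW.
by rewrite gtr_pMl ?orlicz_gt0// ltr_pdivrMr// mul1r.
Qed.

Lemma orlicz_le u v : 0 <= u -> u <= v -> phi u <= phi v.
Proof.
by move=> u0; rewrite le_eqVlt => /predU1P[->//|/(orlicz_lt u0)/ltW].
Qed.

Lemma orlicz_unbounded s : exists2 u, 1 <= u & s < phi u.
Proof.
have p1 : 0 < phi 1 by exact: orlicz_gt0.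
pose u := 1 + `|s| / phi 1.
have u1 : 1 <= u by rewrite lerDl divr_ge0// ltW.
exists u => //; have u0 : 0 < u by exact: lt_le_trans u1.
have := @orlicz_scale u^-1 u _ (ltW u0).
rewrite mulVf ?gt_eqF// invr_ge0 (ltW u0) invf_le1// u1 => /(_ isT).
rewrite ler_pdivlMl// => /(lt_le_trans _); apply.
by rewrite mulrDl mul1r divfK ?gt_eqF// ltr_pwDl// ler_norm.
Qed.

(** A generalized inverse, for which the continuity of phi need not be known; it
    is used through the equivalence of u <= phi^-1(s) and phi u <= s. *)
Definition orlicz_inv (s : R) : R := sup [set u : R | 0 <= u /\ phi u <= s].

Let inv_sup s : 0 < s -> has_sup [set u : R | 0 <= u /\ phi u <= s].
Proof.
move=> s0; split; first by exists 0; rewrite /= orlicz0; split => //; exact: ltW.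
have [b b1 sb] := orlicz_unbounded s; exists b => u [u0 us].
rewrite leNgt; apply/negP => /(orlicz_lt (le_trans ler01 b1))/(lt_trans sb).
by rewrite ltNge us.
Qed.

Lemma orlicz_inv_gt0 s : 0 < s -> 0 < orlicz_inv s.
Proof.
move=> s0; have p1 : 0 < phi 1 by exact: orlicz_gt0.
pose u := Num.min 1 (s / phi 1).
have u0 : 0 < u by rewrite lt_min ltr01 divr_gt0.
apply: (lt_le_trans u0); apply: ub_le_sup; first exact: (inv_sup s0).2.
split; first exact: ltW.
have := @orlicz_scale u 1 _ ler01; rewrite mulr1 => /(_ _)/le_trans; apply.
  by rewrite (ltW u0)/= ge_min lexx.
by rewrite -ler_pdivlMr// ge_min lexx orbT.
Qed.

(** The supremum is attained because phi, being convex, is left continuous at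
    positive points. *)
Lemma orlicz_le_inv s u : 0 < s -> 0 <= u -> (u <= orlicz_inv s) = (phi u <= s).
Proof.
move=> s0 u0; apply/idP/idP; last first.
  by move=> us; apply: ub_le_sup => //; exact: (inv_sup s0).2.
have below v : 0 <= v -> v < orlicz_inv s -> phi v <= s.
  move=> v0 vs; have d0 : 0 < orlicz_inv s - v by rewrite subr_gt0.
  have [w [w0 ws]] := sup_adherent d0 (inv_sup s0); rewrite subKr => vw.
  by apply: le_trans ws; exact: orlicz_le (ltW vw).
rewrite le_eqVlt => /predU1P[->|/below]; last by apply.
set x := orlicz_inv s; have x0 : 0 < x by exact: orlicz_inv_gt0.
apply/ler_addgt0Pr => e e0.
pose B := phi (x + 1); have B0 : 0 < B by rewrite orlicz_gt0// addr_gt0.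
(* x is written as l (x + 1) + (1 - l) v with l near 0 and v < x, so that
   convexity bounds phi x by phi v + l phi (x + 1), the last term being <= e. *)
pose l := Num.min (2^-1) (Num.min (x / (x + 1)) (e / B)).
have l0 : 0 < l by rewrite !lt_min invr_gt0 ltr0n !divr_gt0// addr_gt0.
have l1 : l < 1 by rewrite gt_min invf_lt1// ltr1n.
have lx : l <= x / (x + 1) by rewrite /l !ge_min lexx !orbT.
have lB : l * B <= e by rewrite -ler_pdivlMr// /l !ge_min lexx !orbT.
have l1' : 0 < 1 - l by rewrite subr_gt0.
pose v := (x - l * (x + 1)) / (1 - l).
have v0 : 0 <= v.
  by rewrite divr_ge0 ?(ltW l1')// subr_ge0 -ler_pdivlMr ?addr_gt0.
have vx : v < x by rewrite ltr_pdivrMr// mulrBr mulr1 mulrDr mulr1; lra.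
have E : l * (x + 1) + (1 - l) * v = x by rewrite /v; field; rewrite gt_eqF.
have := @orlicz_conv l (x + 1) v; rewrite E (ltW l0) (ltW l1) => /(_ isT).
move=> /(_ _ v0)/le_trans; apply; first by rewrite addr_ge0// ltW.
rewrite addrC lerD//.
have pv := below v v0 vx.
apply: le_trans pv; rewrite ler_piMl//; first exact: orlicz_ge0.
by rewrite gerBl ltW.
Qed.

Lemma orlicz_inv_lt s u : 0 < s -> 0 <= u -> (orlicz_inv s < u) = (s < phi u).
Proof. by move=> s0 u0; rewrite !ltNge orlicz_le_inv. Qed.

Lemma orlicz_inv_homo s t : 0 < s -> s <= t -> orlicz_inv s <= orlicz_inv t.
Proof.
move=> s0 st; have t0 := lt_le_trans s0 st.
have p0 := ltW (orlicz_inv_gt0 s0).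
by rewrite orlicz_le_inv//; apply: le_trans st; rewrite -orlicz_le_inv.
Qed.

End orlicz.

(** * Weights, their primitives and the layer cake formula *)

(** The sets where f is at least r are intervals. *)
Lemma nonincreasing_emeasurable (R : realType) (D : set R) (f : R -> \bar R) :
  is_interval D -> (forall s t, D s -> D t -> s <= t -> (f t <= f s)%E) ->
  measurable_fun D f.
Proof.
move=> iD f_ni.
apply: (measurability _ (ErealGenCInfty.measurableE R)) => _ [_ [r] -> <-].
apply: is_interval_measurable => s t [Ds/= fs] [Dt/= ft] u /andP[su ut].
have Du : D u by apply: (iD s t) => //; rewrite su ut.
split=> //=; move: ft; rewrite !in_itv/= !andbT => /le_trans; apply; exact: f_ni.
Qed.

Section weight_primitive.
Local Open Scope ereal_scope.
Variables (R : realType) (gamma : \bar R).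
Let mu := @lebesgue_measure R.
Let Ipos := I_gamma_pos gamma.

Lemma Ipos_interval : is_interval Ipos.
Proof.
move=> s t [s0 sg] [t0 tg] u /andP[su ut]; split; first exact: lt_le_trans su.
by apply: le_lt_trans tg; rewrite lee_fin.
Qed.

(** The interval of positive t below d and gamma; d may be infinite, as the
    values of distribution functions are. *)
Definition below (d : \bar R) : set R := Ipos `&` [set t | t%:E < d].

Lemma below_interval d : is_interval (below d).
Proof.
move=> s t [Is sd] [It td] u sut; split; first exact: Ipos_interval sut.
by apply: le_lt_trans td; rewrite lee_fin; case/andP: sut.
Qed.

Lemma measurable_Ipos : measurable (Ipos : set (measurableTypeR R)).
Proof. apply: is_interval_measurable; exact: Ipos_interval. Qed.

Lemma measurable_below d : measurable (below d : set (measurableTypeR R)).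
Proof. apply: is_interval_measurable; exact: below_interval. Qed.

Variable w : R -> R.
Hypothesis ww : weight gamma w.

Lemma weight_gt0 t : Ipos t -> (0 < w t)%R.
Proof. by case: ww => w0 _ _ _; exact: w0. Qed.

Lemma weight_ni s t : Ipos s -> Ipos t -> (s <= t)%R -> (w t <= w s)%R.
Proof. by case: ww => _ wni _ _; exact: wni. Qed.

Lemma measurable_weight : measurable_fun Ipos (EFin \o w).
Proof.
apply: nonincreasing_emeasurable; first exact: Ipos_interval.
by move=> s t Is It st; rewrite lee_fin weight_ni.
Qed.

(** The primitive of w, on the extended reals so that it can be evaluated at
    distribution functions. *)
Definition cumul (d : \bar R) : \bar R := \int[mu]_(t in below d) (w t)%:E.

Lemma measurable_weight_below d : measurable_fun (below d) (EFin \o w).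
Proof. by apply: measurable_funS measurable_weight => //; [exact: measurable_Ipos|move=> t []]. Qed.

Lemma cumul_ge0 d : 0 <= cumul d.
Proof. by apply: integral_ge0 => t [It _]; rewrite lee_fin ltW// weight_gt0. Qed.

Lemma cumul_le d e : d <= e -> cumul d <= cumul e.
Proof.
move=> de; apply: ge0_subset_integral => //.
- exact: measurable_below.
- exact: measurable_below.
- exact: measurable_weight_below.
- by move=> t [It _]; rewrite lee_fin ltW// weight_gt0.
- by move=> t [It /= td]; split=> //=; exact: lt_le_trans td de.
Qed.

Lemma cumul0 d : d <= 0 -> cumul d = 0.
Proof.
move=> d0; rewrite /cumul (_ : below d = set0) ?integral_set0//.
rewrite -subset0 => t [[/= t0 _] /= td].
by have := lt_le_trans td d0; rewrite lte_fin ltNge (ltW t0).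
Qed.

Lemma primitive_cumul t : I_gamma gamma t -> primitive w t = cumul t%:E.
Proof.
move=> [t0 tg]; rewrite /primitive /cumul; congr (integral _ _ _).
apply/seteqP; split => s /=; rewrite in_itv/=.
  move=> /andP[s0 st]; split=> //=; split => //=.
  by apply: le_lt_trans tg; rewrite lee_fin ltW.
by move=> [[/= -> _] /=]; rewrite lte_fin.
Qed.

(** Both sides are the w-weighted measure of the region under the graph of H,
    computed by Tonelli's theorem along the two axes: the first hypothesis says
    that its horizontal section at height s is the interval of all t below K s. *)
Lemma layer_cake (K H : R -> \bar R) :
  (forall t s, Ipos t -> (0 < s)%R -> (s%:E < H t) = (t%:E < K s)) ->
  (forall t, Ipos t -> 0 <= H t) ->
  (forall s t, (0 < s)%R -> (s <= t)%R -> K t <= K s) ->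
  \int[mu]_(t in Ipos) (H t * (w t)%:E) = \int[mu]_(s in `]0%R, +oo[) cumul (K s).
Proof.
move=> HK H0 Kni.
pose G : set (measurableTypeR R * measurableTypeR R) :=
  [set p | [/\ Ipos p.1, (0 < p.2)%R & p.1%:E < K p.2]].
pose w' : R -> \bar R := (EFin \o w) \_ Ipos.
have w'0 t : 0 <= w' t.
  by apply: erestrict_ge0 => x Ix; rewrite lee_fin ltW// weight_gt0.
have mw' : measurable_fun setT w'.
  exact: (measurable_restrictT (EFin \o w) measurable_Ipos).1 measurable_weight.
pose h (p : measurableTypeR R * measurableTypeR R) := w' p.1 * (\1_G p)%:E.
pose P : set R := `]0%R, +oo[%classic.
have Ki : measurable_fun P K.
  apply: nonincreasing_emeasurable; first exact: interval_is_interval.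
  by move=> s t; rewrite /P /= !in_itv/= !andbT => s0 _; exact: Kni.
have mG : measurable G.
  have -> : G = (fst @^-1` Ipos) `&` (snd @^-1` P) `&`
      (setT `&` [set p | (EFin \o fst) p < ((K \_ P) \o snd) p]).
    apply/seteqP; split => [[t s] [/= It s0 tK]|[t s] [[/= It sP] [_ /=]]].
      have sP : P s by rewrite /P/= in_itv/= s0.
      by split => //; split => //=; rewrite patchE mem_set.
    rewrite patchE mem_set//; split => //=.
    by move: sP; rewrite /P/= in_itv/= andbT.
  apply: measurableI; first apply: measurableI.
  - rewrite -[X in measurable X]setTI.
    exact: (@measurable_fst _ _ _ _ measurableT _ measurable_Ipos).
  - rewrite -[X in measurable X]setTI.
    exact: (@measurable_snd _ _ _ _ measurableT _ (measurable_itv _)).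
  - apply: measurable_lte => //; first by apply/measurable_EFinP; exact: measurable_fst.
    apply: measurableT_comp; last exact: measurable_snd.
    exact: (measurable_restrictT K (measurable_itv _)).1 Ki.
have mh : measurable_fun setT h.
  apply: emeasurable_funM; first by apply: measurableT_comp => //; exact: measurable_fst.
  by apply/measurable_EFinP; exact: measurable_indic.
have h0 p : 0 <= h p by rewrite mule_ge0// lee_fin.
have e1 : \int[mu]_(t in Ipos) (H t * (w t)%:E) = \int[mu]_t \int[mu]_s h (t, s).
  rewrite integral_mkcond; apply: eq_integral => t _; rewrite patchE.
  case: ifPn => [/[!inE] It|nIt]; last first.
    rewrite integral0_eq// => s _; rewrite /h/= /w' patchE (negbTE nIt).
    by rewrite mul0e.
  rewrite /h/= ge0_integralZl//; last first.
    by apply/measurable_EFinP; apply: (measurableT_comp (measurable_indic mG)).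
  rewrite muleC; congr (_ * _); first by rewrite /w' patchE mem_set.
  rewrite (_ : (fun s => (\1_G (t, s))%:E) = (fun s => (\1_(xsection G t) s)%:E)); last first.
    by apply/funext => s; rewrite !indicE mem_xsection.
  rewrite integral_indic//; last exact: measurable_xsection.
  rewrite setIT (_ : xsection G t = [set s | (0 < s)%R /\ s%:E < H t]); last first.
    apply/seteqP; split => s; rewrite /xsection/= inE.
      by move=> [/= _ s0]; rewrite -HK.
    by move=> [s0]; rewrite HK.
  have := H0 t It; case: (H t) => [r r0|_|//].
    rewrite (_ : mkset _ = `]0%R, r[%classic); last first.
      by apply/seteqP; split => s /=; rewrite in_itv/= lte_fin => /andP.
    rewrite -[RHS]/(lebesgue_measure ([set` `]0%R, r[] : set R)) lebesgue_measure_itv/= lte_fin.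
    move: r0; rewrite lee_fin le_eqVlt.
    by case: eqP => [<-|_ /= ->]; rewrite ?ltxx// sube0.
  rewrite (_ : mkset _ = `]0%R, +oo[%classic); last first.
    by apply/seteqP; split => s /=; rewrite in_itv/= ltry andbT// => -[].
  by rewrite -[RHS]/(lebesgue_measure ([set` `]0%R, +oo[] : set R)) lebesgue_measure_itv/= ltry.
rewrite e1 (@fubini_tonelli _ _ _ _ _ mu mu h mh h0) [RHS]integral_mkcond.
apply: eq_integral => s _; rewrite patchE.
case: ifPn => [/[!inE]/= sP|sP]; last first.
  rewrite integral0_eq// => t _; rewrite /h/= indicE memNset ?mule0//.
  move=> [/= _ s0 _]; move: sP; rewrite mem_set//= in_itv/= s0//.
have s0 : (0 < s)%R by move: sP; rewrite /= in_itv/= andbT.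
rewrite /cumul [RHS]integral_mkcond; apply: eq_integral => t _.
rewrite /h/= /w' !patchE indicE.
have [[It tK]|nc] := pselect (below (K s) t).
  by rewrite !mem_set//= mule1.
rewrite (@memNset _ G); last by move=> [/= It _ tK]; apply: nc.
by rewrite mule0 (memNset nc).
Qed.

End weight_primitive.

Section cumul_theory.
Local Open Scope ereal_scope.
Variables (R : realType) (gamma : \bar R).
Hypothesis gamma_gt0 : 0 < gamma.
Variable w : R -> R.
Hypothesis ww : weight gamma w.
Let mu := @lebesgue_measure R.
Let Ipos := I_gamma_pos gamma.
Let W := cumul gamma w.

Let w_ge0 (d : \bar R) t : below gamma d t -> 0 <= (w t)%:E.
Proof. by move=> [It _]; rewrite lee_fin ltW// (weight_gt0 ww). Qed.

Lemma exists_Ipos (d : \bar R) : 0 < d -> exists2 r : R, Ipos r & r%:E < d.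
Proof.
have aux (e : \bar R) : 0 < e -> exists2 r : R, (0 < r)%R & r%:E < e.
  case: e => [r|_|//]; last by exists 1%R; rewrite ?ltr01 ?ltry.
  rewrite lte_fin => r0; exists (r / 2)%R; first by rewrite divr_gt0.
  by rewrite lte_fin ltr_pdivrMr// ltr_pMr// ltr1n.
move=> d0; have [|r r0] := aux (Order.min d gamma); first by rewrite lt_min d0.
by rewrite lt_min => /andP[rd rg]; exists r.
Qed.

Lemma below_fin_Ipos a : Ipos a -> below gamma a%:E = `]0%R, a[%classic.
Proof.
move=> [a0 ag]; apply/seteqP; split => s /=; rewrite in_itv/=.
  by move=> [[/= -> _]]; rewrite /= lte_fin.
move=> /andP[s0 sa]; split=> //=; split=> //.
by apply: lt_trans ag; rewrite lte_fin.
Qed.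

(** On ]0, a[ the weight is at least w b. *)
Lemma cumul_ge_cst a b : Ipos b -> (0 < a <= b)%R -> (w b * a)%:E <= W a%:E.
Proof.
move=> Ib /andP[a0 ab].
have Ia : Ipos a.
  by case: Ib => b0 bg; split; [|apply: le_lt_trans bg; rewrite lee_fin].
have cutE := below_fin_Ipos Ia.
have <- : \int[mu]_(t in below gamma a%:E) (cst (w b)%:E) t = (w b * a)%:E.
  rewrite integral_cst; last exact: measurable_below.
  rewrite cutE -[X in _ * X]/(lebesgue_measure ([set` `]0%R, a[] : set R)).
  by rewrite lebesgue_measure_itv/= lte_fin a0 sube0.
apply: ge0_le_integral => //.
- exact: measurable_below.
- by move=> t _; rewrite lee_fin ltW// (weight_gt0 ww).
- exact: (measurable_weight_below ww).
- move=> t [It /=]; rewrite lte_fin => ta; rewrite lee_fin (weight_ni ww)//.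
  by rewrite (le_trans (ltW ta)).
Qed.

Lemma cumul_gt0 d : 0 < d -> 0 < W d.
Proof.
move=> /exists_Ipos[r Ir rd]; apply: lt_le_trans (cumul_le ww (ltW rd)).
have r0 : (0 < r)%R by case: Ir.
apply: lt_le_trans (cumul_ge_cst Ir _); last by rewrite r0 lexx.
by rewrite lte_fin mulr_gt0// (weight_gt0 ww).
Qed.

(** For a <= b the integral over [b, a + b[ is at most w(b) a, which is at most
    the integral over ]0, a[. *)
Let cumulD_fin (a b : R) : (0 <= a)%R -> (a <= b)%R -> W (a%:E + b%:E) <= W a%:E + W b%:E.
Proof.
move=> a0 ab.
have [->|ane] := eqVneq a 0%R; first by rewrite add0e leeDr// cumul_ge0.
have {ane}a0 : (0 < a)%R by rewrite lt_neqAle eq_sym ane.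
have b0 := lt_le_trans a0 ab.
have cE : below gamma (a%:E + b%:E) = below gamma b%:E `|`
    (below gamma (a%:E + b%:E) `\` below gamma b%:E).
  rewrite setDUK// => t [It /= tb]; split => //=; apply: lt_le_trans tb _.
  by rewrite leeDr// lee_fin ltW.
have mD : measurable ((below gamma (a%:E + b%:E) `\` below gamma b%:E) : set (measurableTypeR R)).
  apply: measurableD; exact: measurable_below.
rewrite /W {1}/cumul cE ge0_integral_setU//; last 4 first.
- exact: measurable_below.
- rewrite -cE; exact: (measurable_weight_below ww).
- by move=> t; rewrite -cE; exact: w_ge0.
- by rewrite disj_set2E setDIK.
rewrite addeC leeD2r//.
have [Ib|nIb] := pselect (Ipos b); last first.
  rewrite (_ : _ `\` _ = set0) ?integral_set0 ?cumul_ge0//.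
  rewrite -subset0 => t [[It _] /=]; apply; split => //=.
  case: It => t0 tg; rewrite ltNge; apply/negP => bt; apply: nIb; split => //.
  exact: le_lt_trans tg.
apply: le_trans (@cumul_ge_cst a b Ib _); last by rewrite a0 ab.
pose J := `[b, (a + b)[%R.
have -> : (w b * a)%:E = \int[mu]_(t in [set` J]) (cst (w b)%:E) t.
  rewrite integral_cst// -[X in _ * X]/(lebesgue_measure ([set` J] : set R)).
  rewrite lebesgue_measure_itv/= lte_fin ltrDr a0.
  by rewrite -EFinB addrK EFinM.
apply: (@le_trans _ _ (\int[mu]_(t in
    (below gamma (a%:E + b%:E) `\` below gamma b%:E)) (cst (w b)%:E) t)).
  apply: ge0_le_integral => //.
  - by move=> t [It _]; exact: w_ge0 It.
  - apply: measurable_funS (measurable_weight_below ww (d := a%:E + b%:E)) => //.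
    exact: measurable_below.
  - move=> t [[It _] ntb]; rewrite lee_fin (weight_ni ww)// leNgt; apply/negP => tb.
    by apply: ntb; split.
apply: ge0_subset_integral => //.
- by move=> t _; rewrite lee_fin ltW// (weight_gt0 ww).
- move=> t [[It /= tab] ntb]; rewrite /J in_itv/= -lte_fin tab andbT leNgt.
  by apply/negP => tb; apply: ntb; split.
Qed.

Lemma cumulD d e : 0 <= d -> 0 <= e -> W (d + e) <= W d + W e.
Proof.
move: d e => [a| |//] [b| |//].
- rewrite !lee_fin => a0 b0; have [ab|/ltW ba] := leP a b; first exact: cumulD_fin.
  by rewrite addeC [leRHS]addeC; exact: cumulD_fin.
- by move=> _ _; rewrite addey// leeDr// cumul_ge0.
- by move=> _ _; rewrite addye// leeDl// cumul_ge0.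
- by move=> _ _; rewrite addye// leeDl// cumul_ge0.
Qed.

(** For finite gamma the definition of a weight only bounds the primitive at
    points t < gamma; the bound at gamma itself follows by subadditivity from the
    one at gamma / 2. *)
Lemma cumul_lty d : d < +oo -> W d < +oo.
Proof.
have fin r : I_gamma gamma r -> W r%:E < +oo.
  by move=> Ir; rewrite /W -primitive_cumul//; case: ww => _ _ + _; exact.
case: d => [r _|//|_]; last by rewrite /W cumul0.
have [r0|/ltW r0] := leP 0%R r; last by rewrite /W cumul0 ?lee_fin.
have [rg|gr] := ltP r%:E gamma; first exact: fin.
apply: (@le_lt_trans _ _ (W gamma)).
  rewrite /W /cumul (_ : below gamma r%:E = below gamma gamma)//.
  apply/seteqP; split => t [It /= tr]; split => //=; first by case: It.
  exact: lt_le_trans tr gr.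
move: gamma_gt0 gr; case E : gamma => [g| |//]; last by rewrite leye_eq.
rewrite lte_fin => g0 _.
have g2 : I_gamma gamma (g / 2)%R.
  by split; rewrite ?divr_ge0 ?(ltW g0)// E lte_fin ltr_pdivrMr// ltr_pMr// ltr1n.
(* W(gamma) = W(g/2 + g/2) <= 2 W(g/2). *)
rewrite (_ : g%:E = (g / 2)%R%:E + (g / 2)%R%:E); last by rewrite -EFinD -splitr.
apply: le_lt_trans (cumulD _ _) _; rewrite ?lee_fin ?divr_ge0 ?(ltW g0)//.
by apply: lte_add_pinfty; exact: fin.
Qed.

Lemma cumul_fin_num d : d < +oo -> W d \is a fin_num.
Proof. by move=> d_fin; rewrite ge0_fin_numE ?cumul_lty// cumul_ge0. Qed.

Lemma cumul_infty : gamma = +oo -> W +oo = +oo.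
Proof.
move=> goo; case: ww => _ _ _ /(_ goo) E; rewrite -[RHS]E /W /cumul.
congr (integral _ _ _); apply/seteqP; split => t /=; rewrite in_itv/= andbT.
  by move=> [[]].
by move=> t0; split; [split => //; rewrite goo ltry|rewrite /= ltry].
Qed.

(** Left continuity of the primitive, by monotone convergence along an
    increasing sequence that tends to the minimum of d and gamma. *)
Lemma cumul_le_sup d B : 0 <= B ->
  (forall r, Ipos r -> r%:E < d -> W r%:E <= B) -> W d <= B.
Proof.
move=> B0 rB.
pose e := Order.min d gamma.
have cde : below gamma d = below gamma e.
  apply/seteqP; split => t [It /= td]; split => //=.
    by rewrite lt_min td; case: It.
  by apply: lt_le_trans td _; rewrite ge_min lexx.
have {}rB r : (0 < r)%R -> r%:E < e -> W r%:E <= B.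
  by rewrite lt_min => r0 /andP[rd rg]; apply: rB.
have [e0|e0] := leP e 0; first by rewrite /W /cumul cde -/(cumul _ _ e) cumul0.
have [r [r_nd r0 re rcut]] : exists r : nat -> R, [/\ nondecreasing_seq r,
    (forall n, (0 < r n)%R), (forall n, (r n)%:E < e) &
    (forall t, t%:E < e -> exists n, (t < r n)%R)].
  move: e0; case: (e) => [x|_|//].
    rewrite lte_fin => x0; exists (fun n => x * (1 - n.+2%:R^-1))%R; split.
    - apply/nondecreasing_seqP => n; rewrite ler_pM2l// lerD2l lerN2.
      by rewrite lef_pV2 ?posrE// ler_nat.
    - by move=> n; rewrite mulr_gt0// subr_gt0 invf_lt1// ltr1n.
    - by move=> n; rewrite lte_fin gtr_pMr// gtrDl oppr_lt0 invr_gt0.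
    - move=> t; rewrite lte_fin => tx.
      have d0 : (0 < 1 - t / x)%R by rewrite subr_gt0 ltr_pdivrMr// mul1r.
      exists (Num.truncn (1 - t / x)^-1)%R.
      rewrite mulrC -ltr_pdivrMr// ltrBrDl -ltrBrDr invf_plt ?posrE//.
      by apply: (lt_trans (truncnS_gt _)); rewrite ltr_nat.
  exists (fun n => n.+1%:R); split => //; first by apply/nondecreasing_seqP => n; rewrite ler_nat.
  - by move=> n; rewrite ltry.
  - by move=> t _; exists (Num.truncn t); exact: truncnS_gt.
have E : below gamma d = \bigcup_n below gamma (r n)%:E.
  rewrite cde; apply/seteqP; split => t.
    by move=> [It /rcut[n tn]]; exists n => //; split => //=; rewrite lte_fin.
  by move=> [n _ [It /= tn]]; split=> //=; exact: lt_trans tn (re n).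
rewrite /W /cumul E.
have C : \int[mu]_(t in below gamma (r i)%:E) (w t)%:E @[i --> \oo] -->
    \int[mu]_(t in \bigcup_n below gamma (r n)%:E) (w t)%:E.
  apply: ge0_nondecreasing_set_cvg_integral.
  - move=> n m nm; apply/subsetPset => t [It /= tn]; split => //=.
    by apply: lt_le_trans tn _; rewrite lee_fin; exact: r_nd.
  - by move=> n; exact: measurable_below.
  - by move=> n; exact: (measurable_weight_below ww).
  - by move=> n t; exact: w_ge0.
rewrite -(cvg_lim _ C)//; apply: lime_le; first by apply/cvg_ex; eexists; exact: C.
by apply: nearW => n; exact: rB.
Qed.

(** The primitive tends to 0 at 0, by monotone convergence for the complements
    of ]0, a/n[ in ]0, a[. *)
Lemma cumul_small (eps : R) : (0 < eps)%R ->
  exists2 delta : R, (0 < delta)%R & W delta%:E <= eps%:E.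
Proof.
move=> e0; have [a Ia _] := exists_Ipos (@lt0y R).
have a0 : (0 < a)%R by case: Ia.
have cE := below_fin_Ipos Ia.
pose F n := below gamma a%:E `\` below gamma (a / n.+1%:R)%R%:E.
have mF n : measurable (F n : set (measurableTypeR R)).
  apply: measurableD; exact: measurable_below.
have UF : \bigcup_n F n = below gamma a%:E.
  apply/seteqP; split => t; first by move=> [n _ []].
  move=> ct; have [[t0 _] _] := ct; exists (Num.truncn (a / t)) => //; split => //.
  move=> [_ /=]; rewrite lte_fin ltr_pdivlMr// mulrC -ltr_pdivlMr//.
  by rewrite ltNge ltW// truncnS_gt.
have Fsub n : F n `<=` below gamma a%:E by move=> t [].
have C : \int[mu]_(t in F i) (w t)%:E @[i --> \oo] --> \int[mu]_(t in \bigcup_n F n) (w t)%:E.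
  apply: ge0_nondecreasing_set_cvg_integral => //.
  - move=> n m nm; apply/subsetPset => t [ct nt]; split => // -[It /= tm].
    apply: nt; split => //=; apply: lt_le_trans tm _.
    by rewrite lee_fin ler_pM2l// lef_pV2 ?posrE// ler_nat.
  - move=> n; apply: measurable_funS (measurable_weight_below ww (d := a%:E)) => //.
    exact: measurable_below.
  - by move=> n t /Fsub; exact: w_ge0.
rewrite UF in C.
have Wa : W a%:E \is a fin_num by apply: cumul_fin_num; rewrite ltry.
have : \forall n \near \oo, W a%:E - eps%:E < \int[mu]_(t in F n) (w t)%:E.
  apply: (C (fun u => W a%:E - eps%:E < u)); apply: open_ereal_gt'.
  by rewrite -/(cumul _ _ _) -/W lteBlDr// lteDl ?lte_fin//.
move=> [n _ /(_ n (leqnn n)) /= Hn]; exists (a / n.+1%:R)%R; first by rewrite divr_gt0.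
have E : W a%:E = W (a / n.+1%:R)%R%:E + \int[mu]_(t in F n) (w t)%:E.
  have cU : below gamma a%:E = below gamma (a / n.+1%:R)%R%:E `|` F n.
    rewrite setDUK// => t [It /= tn]; split=> //=; apply: lt_le_trans tn _.
    by rewrite lee_fin ler_pdivrMr// ler_pMr// ler1n.
  rewrite /W /cumul {1}cU ge0_integral_setU//.
  - exact: measurable_below.
  - by rewrite -cU; exact: (measurable_weight_below ww).
  - by move=> t; rewrite -cU; exact: w_ge0.
  - by rewrite disj_set2E setDIK.
have Wfin : W (a / n.+1%:R)%R%:E \is a fin_num by apply: cumul_fin_num; rewrite ltry.
move: Hn; rewrite EFinN lteBlDr// E addeC lteD2lE; first exact: ltW.
by move: Wa; rewrite E fin_numD => /andP[].
Qed.

End cumul_theory.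

(** * Distribution functions and the modular *)

Section distribution.
Local Open Scope ereal_scope.
Variables (R : realType) (gamma : \bar R).
Local Notation lebT := (caratheodory_type ((wlength (@idfun R))^*)%mu).
Local Notation lmeasurable := (((wlength (@idfun R))^*)%mu.-cara.-measurable).
Let cm : {measure set lebT -> \bar R} := @completed_lebesgue_measure R.
Implicit Types (g h : {mfun lebT >-> R}) (f : L0 (m_gamma gamma)).

Definition superlevel g (u : R) : set R := [set t | I_gamma gamma t /\ (u < `|g t|)%R].
Definition distr g (u : R) : \bar R := cm (superlevel g u).

Lemma distribution_funE f u : distribution_fun f u = distr (Defs.repr_of f) u.
Proof. by []. Qed.

Lemma lebmeasurable_itv (i : interval R) : lmeasurable [set` i].
Proof. by apply: sub_caratheodory; exact: measurable_itv. Qed.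

Lemma measurable_superlevel g u : lmeasurable (superlevel g u).
Proof.
have -> : superlevel g u = I_gamma gamma `&` ([set: lebT] `&` (fun t => `|g t|%R) @^-1` `]u, +oo[).
  by apply/seteqP; split => t /=; rewrite in_itv/= andbT => -[] // ? [].
apply: measurableI; first exact: measurable_I_gamma.
have mg : measurable_fun [set: lebT] (fun t => `|g t|%R).
  by apply: measurableT_comp.
by apply: mg => //; exact: measurable_itv.
Qed.

Lemma ae_le_measure (P : set R) (A B : set lebT) :
  lmeasurable A -> lmeasurable B -> A `<=` I_gamma gamma ->
  {ae m_gamma gamma, forall t, P t} -> (forall t, P t -> A t -> B t) ->
  cm A <= cm B.
Proof.
move=> mA mB AI [N [mN N0 PN]] AB.
have mNI : lmeasurable (N `&` I_gamma gamma).
  by apply: measurableI => //; exact: measurable_I_gamma.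
apply: (@le_trans _ _ (cm (B `|` (N `&` I_gamma gamma)))).
  apply: le_measure; rewrite ?inE//; first exact: measurableU.
  move=> t At; have [Pt|nPt] := pselect (P t); first by left; exact: AB.
  by right; split; [exact: PN|exact: AI].
apply: le_trans (measureU2 cm mB mNI) _.
have N0' : cm (N `&` I_gamma gamma) = 0 := N0.
by rewrite -[X in _ <= X]adde0; apply: leeD => //;
  rewrite -[X in X <= _]/(cm (N `&` I_gamma gamma)) N0'.
Qed.

Lemma distr_ge0 g u : 0 <= distr g u. Proof. exact: measure_ge0. Qed.

Lemma superlevel_sub g u : superlevel g u `<=` I_gamma gamma. Proof. by move=> t []. Qed.

Lemma distr_ni g u v : (u <= v)%R -> distr g v <= distr g u.
Proof.
move=> uv; apply: le_measure; rewrite ?inE; try exact: measurable_superlevel.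
by move=> t [It /(le_lt_trans uv)].
Qed.

Lemma distr_right_cont g u d : d < distr g u -> exists2 v, (u < v)%R & d < distr g v.
Proof.
move=> du; pose F n := superlevel g (u + n.+1%:R^-1).
have UF : \bigcup_n F n = superlevel g u.
  apply/seteqP; split => t.
    by move=> [n _ [It h]]; split=> //; apply: lt_trans h; rewrite ltrDl invr_gt0.
  move=> [It ut]; have ut' : (0 < `|g t| - u)%R by rewrite subr_gt0.
  exists (Num.truncn (`|g t| - u)^-1) => //; split => //.
  by rewrite -ltrBrDl invf_plt ?posrE// truncnS_gt.
have C : cm (F n) @[n --> \oo] --> cm (\bigcup_n F n).
  apply: nondecreasing_cvg_mu.
  - by move=> n; exact: measurable_superlevel.
  - by rewrite UF; exact: measurable_superlevel.
  - move=> n m nm; apply/subsetPset => t [It h]; split=> //; apply: le_lt_trans h.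
    by rewrite lerD2l lef_pV2 ?posrE// ler_nat.
rewrite UF in C.
have [n _ /(_ n (leqnn n)) dn] := C (fun x => d < x) (open_ereal_gt' du).
by exists (u + n.+1%:R^-1)%R => //; rewrite ltrDl invr_gt0.
Qed.

(** The strict inequality on the left comes from the right continuity of the
    distribution function: d_f(v) > t for some v > u, and then f^*(t) >= v. *)
Lemma lt_rearrangement f t u : (0 < u)%R ->
  (u%:E < rearrangement f t) = (t%:E < distribution_fun f u).
Proof.
move=> u0; apply/idP/idP => [uF|].
  rewrite ltNge; apply/negP => ut; move: uF; rewrite ltNge => /negP; apply.
  by apply: ereal_inf_lbound; exists u.
rewrite distribution_funE => /distr_right_cont[v uv tv].
apply: (@lt_le_trans _ _ v%:E); first by rewrite lte_fin.
apply: le_ereal_inf_tmp => _ [l [l0 lt] <-]; rewrite lee_fin leNgt; apply/negP => lv.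
have := lt_le_trans tv (distr_ni _ (ltW lv)).
by rewrite ltNge; move: lt; rewrite distribution_funE => ->.
Qed.

Lemma rearrangement_ge0 f t : 0 <= rearrangement f t.
Proof. by apply: le_ereal_inf_tmp => _ [l [l0 _] <-]; rewrite lee_fin ltW. Qed.

Lemma rearrangement_ni f s t : (s <= t)%R -> rearrangement f t <= rearrangement f s.
Proof.
move=> st; apply: ereal_inf_le_tmp => _ [l [l0 ls] <-]; exists l => //; split=> //.
by apply: le_trans ls _; rewrite lee_fin.
Qed.

Lemma distr_fin_gamma g u : gamma < +oo -> distr g u < +oo.
Proof.
move=> goo; apply: (@le_lt_trans _ _ (cm (I_gamma gamma))).
  by apply: le_measure; rewrite ?inE; [exact: measurable_superlevel|
    exact: measurable_I_gamma|exact: superlevel_sub].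
move: goo; case E : gamma => [x| |] // _.
  apply: (@le_lt_trans _ _ (cm `[0%R, x[%classic)).
    apply: le_measure; rewrite ?inE; first by rewrite -E; exact: measurable_I_gamma.
      exact: lebmeasurable_itv.
    by move=> t [t0]; rewrite lte_fin /= in_itv/= t0.
  rewrite -[X in X < _]/(lebesgue_measure ([set` `[0%R, x[] : set R)).
  rewrite lebesgue_measure_itv/=; case: ifPn => _; last exact: ltry.
  by rewrite -EFinB ltry.
by rewrite (_ : I_gamma -oo = set0) ?measure0// -subset0 => t [].
Qed.

End distribution.

Section modular_theory.
Local Open Scope ereal_scope.
Variables (R : realType) (gamma : \bar R).
Variable phi : R -> R.
Hypothesis phi_orlicz : orlicz_function phi.
Let psi := orlicz_inv phi.
Let mu := @lebesgue_measure R.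
Let P : set R := `]0%R, +oo[%classic.
Implicit Types (f g h : L0 (m_gamma gamma)).

Let psi_gt0 s : P s -> (0 < psi s)%R.
Proof. by rewrite /P/= in_itv/= andbT => s0; exact: orlicz_inv_gt0. Qed.

Lemma distribution_fun_psi_ni f s t : (0 < s)%R -> (s <= t)%R ->
  distribution_fun f (psi t) <= distribution_fun f (psi s).
Proof.
by move=> s0 st; rewrite !distribution_funE; apply: distr_ni; exact: orlicz_inv_homo.
Qed.

Lemma er_map_orlicz_le (x y : \bar R) : 0 <= x -> x <= y -> er_map phi x <= er_map phi y.
Proof.
move: x y => [x| |//] [y| |]//=; rewrite ?leey//.
by rewrite !lee_fin; exact: orlicz_le.
Qed.

Section one_weight.
Variable w : R -> R.
Hypothesis ww : weight gamma w.
Let W := cumul gamma w.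

(** Combines u < f^*(t) <-> t < d_f(u) with phi^-1(s) < u <-> s < phi(u), which
    say that the region under the graph of t |-> phi(f^*(t)) has the horizontal
    sections ]0, d_f(phi^-1(s))[. *)
Lemma modular_layer_cake f : modular phi w f =
  \int[mu]_(s in `]0%R, +oo[) W (distribution_fun f (psi s)).
Proof.
rewrite -(@layer_cake R gamma w ww (fun s => distribution_fun f (psi s))
  (fun t => er_map phi (rearrangement f t)))//.
- move=> t s It s0; have p0 : (0 < psi s)%R by exact: orlicz_inv_gt0.
  rewrite -lt_rearrangement//; have := rearrangement_ge0 f t.
  case: rearrangement => [r|_|//] /=; last by rewrite !ltry.
  by rewrite lee_fin => r0; rewrite !lte_fin /psi orlicz_inv_lt.
- move=> t It; have := rearrangement_ge0 f t.
  by case: rearrangement => [r|//|//]; rewrite !lee_fin; exact: orlicz_ge0.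
- by move=> s t; exact: distribution_fun_psi_ni.
Qed.

Lemma measurable_cumul_distr f :
  measurable_fun P (fun s => W (distribution_fun f (psi s))).
Proof.
apply: nonincreasing_emeasurable; first exact: interval_is_interval.
move=> s t; rewrite /P /= !in_itv/= !andbT => s0 _ st; apply: (cumul_le ww).
exact: distribution_fun_psi_ni.
Qed.

Lemma modular_ge0 f : 0 <= modular phi w f.
Proof. by rewrite modular_layer_cake; apply: integral_ge0 => s _; exact: (cumul_ge0 ww). Qed.

Lemma modular_le f g :
  (forall u, (0 < u)%R -> distribution_fun f u <= distribution_fun g u) ->
  modular phi w f <= modular phi w g.
Proof.
move=> fg; rewrite !modular_layer_cake; apply: ge0_le_integral.
- exact: measurable_itv.
- by move=> s _; exact: (cumul_ge0 ww).
- exact: measurable_cumul_distr.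
- exact: measurable_cumul_distr.
- by move=> s /psi_gt0 ps; apply: (cumul_le ww); exact: fg.
Qed.

(** Subadditivity of the primitive of w carries a subadditivity of distribution
    functions over to the modular. *)
Lemma modular_leD f g h :
  (forall u, (0 < u)%R -> distribution_fun h u <= distribution_fun f u + distribution_fun g u) ->
  modular phi w h <= modular phi w f + modular phi w g.
Proof.
move=> fg; rewrite !modular_layer_cake -ge0_integralD//; first last.
- exact: measurable_cumul_distr.
- by move=> s _; exact: (cumul_ge0 ww).
- exact: measurable_cumul_distr.
- by move=> s _; exact: (cumul_ge0 ww).
apply: ge0_le_integral => //.
- by move=> s _; exact: (cumul_ge0 ww).
- exact: measurable_cumul_distr.
- apply: emeasurable_funD; exact: measurable_cumul_distr.
- move=> s /psi_gt0 ps; rewrite (le_trans (cumul_le ww (fg _ ps)))//.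
  by apply: (cumulD ww); exact: distr_ge0.
Qed.

Lemma integral_cst_below (k : \bar R) (a : R) : (0 <= a)%R ->
  \int[mu]_(s in `]0%R, a[) (cst k s) = k * a%:E.
Proof.
move=> a0; rewrite integral_cst//.
rewrite -[X in _ * X]/(lebesgue_measure ([set` `]0%R, a[] : set R)).
rewrite lebesgue_measure_itv/= lte_fin; move: a0; rewrite le_eqVlt.
by move=> /predU1P[<-|->]; rewrite ?ltxx// sube0.
Qed.

(** Chebyshev's inequality: the layers s < phi a all have length at least d. *)
Lemma modular_ge f a d : (0 <= a)%R ->
  (forall v, (0 < v)%R -> (v < a)%R -> d <= distribution_fun f v) ->
  W d * (phi a)%:E <= modular phi w f.
Proof.
move=> a0 dv; rewrite modular_layer_cake -integral_cst_below ?orlicz_ge0//.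
apply: (@le_trans _ _ (\int[mu]_(s in `]0%R, (phi a)[) W (distribution_fun f (psi s)))).
  apply: ge0_le_integral => //.
  - by move=> s _; exact: (cumul_ge0 ww).
  - apply: measurable_funS (measurable_cumul_distr f); first exact: measurable_itv.
    by move=> s; rewrite /P/= !in_itv/= andbT => /andP[].
  - move=> s /=; rewrite in_itv/= => /andP[s0 sa]; apply: (cumul_le ww).
    apply: dv; first exact: orlicz_inv_gt0.
    by rewrite /psi orlicz_inv_lt.
apply: ge0_subset_integral => //; first exact: measurable_cumul_distr.
  by move=> s _; exact: (cumul_ge0 ww).
by move=> s /=; rewrite !in_itv/= => /andP[-> _].
Qed.

(** Covers both convexity (A = c <= 1, B = 0) and Delta_2 (c = 2). An additive B
    is harmless only where the whole weight W(gamma) is finite. *)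
Lemma modular_scale_le f g (c A B : R) : (0 < A)%R -> (0 <= B)%R -> (0 < c)%R ->
  (forall u, (0 <= u)%R -> (phi (c * u) <= A * phi u + B)%R) ->
  (forall u, (0 < u)%R -> distribution_fun g (c * u)%R <= distribution_fun f u) ->
  modular phi w g <= A%:E * modular phi w f + B%:E * W gamma.
Proof.
move=> A0 B0 c0 phic gf.
have A0' : 0 <= A%:E by rewrite lee_fin ltW.
have er0 h t : 0 <= er_map phi (rearrangement h t).
  have := rearrangement_ge0 h t.
  by case: rearrangement => [r|//|//]; rewrite !lee_fin; exact: orlicz_ge0.
have w0 t : I_gamma_pos gamma t -> 0 <= (w t)%:E.
  by move=> It; rewrite lee_fin ltW// (weight_gt0 ww).
have mer h : measurable_fun (I_gamma_pos gamma) (fun t => er_map phi (rearrangement h t)).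
  apply: nonincreasing_emeasurable; first exact: Ipos_interval.
  move=> s t _ _ /(rearrangement_ni h); exact: er_map_orlicz_le (rearrangement_ge0 h t).
have mw := measurable_weight ww.
have WE : W gamma = \int[mu]_(t in I_gamma_pos gamma) (w t)%:E.
  by rewrite /W /cumul; congr (integral _ _ _); apply/seteqP; split => t [] // [].
have mI := @measurable_Ipos R gamma.
rewrite /modular WE -ge0_integralZl//; last 2 first.
- by apply: emeasurable_funM => //; exact: mer.
- by move=> t It; apply: mule_ge0 => //; exact: w0.
rewrite -ge0_integralZl//.
rewrite -ge0_integralD//; last 4 first.
- by move=> t It; rewrite mule_ge0// mule_ge0// w0.
- by apply: measurable_funeM; apply: emeasurable_funM => //; exact: mer.
- by move=> t It; rewrite mule_ge0// w0.
- exact: measurable_funeM.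
apply: ge0_le_integral => //.
- by move=> t It; rewrite mule_ge0// w0.
- by apply: emeasurable_funM => //; exact: mer.
- apply: emeasurable_funD; last exact: measurable_funeM.
  by apply: measurable_funeM; apply: emeasurable_funM => //; exact: mer.
move=> t It; rewrite muleA -ge0_muleDl//; last by rewrite mule_ge0.
apply: lee_wpmul2r; first exact: w0.
have F_le : rearrangement g t <= c%:E * rearrangement f t.
  rewrite -lee_pdivrMl//; apply: le_ereal_inf_tmp => _ [l [l0 lt] <-].
  rewrite lee_pdivrMl//; apply: ereal_inf_lbound; exists (c * l)%R => //.
  by split; [exact: mulr_gt0|exact: le_trans (gf _ l0) lt].
move: (rearrangement_ge0 g t) (rearrangement_ge0 f t) F_le (phic).
case: (rearrangement f t) => [y|_|//]; case: (rearrangement g t) => [x|_|//] //=.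
  rewrite !lee_fin => x0 y0 xy ph.
  by apply: le_trans (ph _ y0); exact: orlicz_le.
all: by move=> *; rewrite gt0_muley ?lte_fin// addye// leey.
Qed.

End one_weight.

Lemma modular_weight_le (w w' : R -> R) (K : R) f : weight gamma w -> weight gamma w' ->
  (0 <= K)%R -> (forall d, cumul gamma w d <= K%:E * cumul gamma w' d) ->
  modular phi w f <= K%:E * modular phi w' f.
Proof.
move=> ww ww' K0 KW; rewrite !modular_layer_cake// -ge0_integralZl//; first last.
- by move=> s _; exact: (cumul_ge0 ww').
- exact: measurable_cumul_distr.
apply: ge0_le_integral => //.
- by move=> s _; exact: (cumul_ge0 ww).
- exact: measurable_cumul_distr.
- by apply: measurable_funeM; exact: measurable_cumul_distr.
Qed.

(** The comparison is known at the points of ]0, gamma[ and passes to all d by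
    left continuity. *)
Lemma cumul_le_primitive (w w' : R -> R) (K : R) : weight gamma w -> weight gamma w' ->
  (0 <= K)%R ->
  (forall t, I_gamma_pos gamma t -> primitive w t <= K%:E * primitive w' t) ->
  forall d, cumul gamma w d <= K%:E * cumul gamma w' d.
Proof.
move=> ww ww' K0 KW d; apply: (cumul_le_sup ww).
  by rewrite mule_ge0 ?lee_fin// (cumul_ge0 ww').
move=> r Ir rd; have Ir' : I_gamma gamma r by case: Ir => r0 rg; split=> //; exact: ltW.
have := KW r Ir; rewrite !(primitive_cumul _ Ir') => /le_trans; apply.
by rewrite lee_wpmul2l ?lee_fin// (cumul_le ww')// ltW.
Qed.

End modular_theory.

(** * The vector space structure and the Luxemburg norm *)

Section orlicz_lorentz_space.
Local Open Scope ereal_scope.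
Variables (R : realType) (gamma : \bar R).
Hypothesis gamma_gt0 : 0 < gamma.
Local Notation lebT := (caratheodory_type ((wlength (@idfun R))^*)%mu).
Local Notation lmeasurable := (((wlength (@idfun R))^*)%mu.-cara.-measurable).
Let cm : {measure set lebT -> \bar R} := @completed_lebesgue_measure R.
Let m := m_gamma gamma.
Implicit Types (f g h : L0 m).

Lemma repr_ofZ (c : R) f :
  {ae m, forall t, Defs.repr_of (c *: f) t = (c * Defs.repr_of f t)%R}.
Proof.
have := repr_class_of m (c *: Defs.repr_of f).
by apply: filterS => t /(_ I).
Qed.

Lemma repr_ofD f g :
  {ae m, forall t, Defs.repr_of (f + g)%R t = (Defs.repr_of f t + Defs.repr_of g t)%R}.
Proof.
have := repr_class_of m (Defs.repr_of f + Defs.repr_of g)%R.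
by apply: filterS => t /(_ I).
Qed.

(** Elements of L0 are handled through representatives that are known only
    almost everywhere; this is the form in which an almost everywhere description
    of f is turned into a bound of its distribution function. *)
Lemma distribution_le_ae f (u : R) (P E : set lebT) : lmeasurable E ->
  {ae m, forall t, P t} ->
  (forall t, I_gamma gamma t -> P t -> (u < `|Defs.repr_of f t|)%R -> E t) ->
  distribution_fun f u <= cm E.
Proof.
move=> mE aeP PE;
apply: (ae_le_measure (measurable_superlevel _ _ _) mE (@superlevel_sub _ _ _ _) aeP).
by move=> t Pt [It ut]; exact: PE.
Qed.

Lemma distribution_class (g : {mfun lebT >-> R}) u :
  distribution_fun (class_of m g : L0 m) u = distr gamma g u.
Proof.
have aeg : {ae m, forall t, Defs.repr_of (class_of m g : L0 m) t = g t}.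
  by have := repr_class_of m g; apply: filterS => t /(_ I).
apply/eqP; rewrite eq_le; apply/andP; split.
  apply: (distribution_le_ae (measurable_superlevel _ _ _) aeg) => t It -> ut; split=> //.
rewrite distribution_funE.
apply: (ae_le_measure (measurable_superlevel _ _ _) (measurable_superlevel _ _ _)
  (@superlevel_sub _ _ _ _) aeg).
by move=> t Et [It ut]; split=> //; rewrite Et.
Qed.

Lemma distributionZ (c : R) f u : (0 < c)%R ->
  distribution_fun (c *: f) (c * u) <= distribution_fun f u.
Proof.
move=> c0; apply: (distribution_le_ae (measurable_superlevel _ _ _) (repr_ofZ c f)) => t It ->.
by rewrite normrM gtr0_norm// ltr_pM2l// => ut; split.
Qed.

Lemma distributionD f g u v :
  distribution_fun (f + g)%R (u + v) <= distribution_fun f u + distribution_fun g v.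
Proof.
apply: (@le_trans _ _ (cm (superlevel gamma (Defs.repr_of f) u `|`
    superlevel gamma (Defs.repr_of g) v))).
  apply: (distribution_le_ae _ (repr_ofD f g)).
    by apply: measurableU; exact: measurable_superlevel.
  move=> t It -> h.
  have [fu|fu] := ltP u `|Defs.repr_of f t|%R; first by left; split.
  right; split=> //; rewrite ltNge; apply/negP => gv; move: h.
  by rewrite ltNge (le_trans (ler_normD _ _))// lerD.
by apply: (measureU2 cm); exact: measurable_superlevel.
Qed.

Variable phi : R -> R.
Hypothesis phi_orlicz : orlicz_function phi.

Section one_weight.
Variable w : R -> R.
Hypothesis ww : weight gamma w.
Let rho := @modular R gamma phi w.
Let W := cumul gamma w.

Lemma modularZ_le (l : R) f : (0 < l <= 1)%R -> rho (l *: f) <= l%:E * rho f.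
Proof.
move=> /andP[l0 l1].
have := @modular_scale_le R gamma phi phi_orlicz w ww f (l *: f) l l 0 l0 (lexx _) l0.
rewrite mul0e adde0; apply.
  by move=> u u0; rewrite addr0 orlicz_scale// (ltW l0).
by move=> u u0; exact: distributionZ.
Qed.

Lemma modular_mono (a b : R) f : (0 < a <= b)%R -> rho (a *: f) <= rho (b *: f).
Proof.
move=> /andP[a0 ab]; have b0 := lt_le_trans a0 ab.
have -> : (a *: f = (a / b) *: (b *: f))%R by rewrite scalerA divfK// gt_eqF.
have ab1 : (0 < a / b <= 1)%R by rewrite divr_gt0//= ler_pdivrMr// mul1r.
apply: le_trans (modularZ_le _ ab1) _.
rewrite -[leRHS]mul1e; apply: lee_wpmul2r; first exact: (modular_ge0 phi_orlicz ww).
by rewrite lee_fin; case/andP: ab1.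
Qed.

Lemma modularN f : rho (- f)%R <= rho f.
Proof.
apply: (modular_le phi_orlicz ww) => u u0; rewrite distribution_funE.
rewrite -scaleN1r; apply: (distribution_le_ae (measurable_superlevel _ _ _) (repr_ofZ (-1) f)).
by move=> t It ->; rewrite mulN1r normrN => ut; split.
Qed.

(** If |f + g| > 2 u then |f| > u or |g| > u. This weak form of convexity needs
    only the subadditivity of the primitive of w. *)
Lemma modular_half f g : rho (2^-1 *: (f + g))%R <= rho f + rho g.
Proof.
apply: (modular_leD phi_orlicz ww) => u u0.
apply: (@le_trans _ _ (distribution_fun (f + g)%R (u + u)%R)).
  have := @distributionZ 2^-1%R (f + g)%R (u + u)%R _; rewrite invr_gt0 ltr0n => /(_ isT).
  by rewrite (_ : (2^-1 * (u + u))%R = u); last by field.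
exact: distributionD.
Qed.

Lemma modular0 : rho (0%R : L0 m) = 0.
Proof.
apply/eqP; rewrite eq_le (modular_ge0 phi_orlicz ww) andbT /rho.
rewrite (modular_layer_cake phi_orlicz ww) integral0_eq// => s.
rewrite /= in_itv/= andbT => s0.
apply: cumul0; rewrite -[X in distribution_fun X _](@scale0r _ _ (0%R : L0 m)).
apply: (@le_trans _ _ (cm set0)); last by rewrite measure0.
apply: (distribution_le_ae _ (repr_ofZ 0%R 0%R)) => // t It ->.
by rewrite mul0r normr0 ltNge ltW// orlicz_inv_gt0.
Qed.

Lemma modular_quarter f g : rho (4^-1 *: (f + g))%R <= 2^-1%R%:E * (rho f + rho g).
Proof.
have -> : ((4^-1 : R) *: (f + g) = (2^-1 : R) *: ((2^-1 : R) *: (f + g)))%R.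
  by rewrite scalerA; congr (_ *: _); field.
have half01 : (0 < (2^-1 : R) <= 1)%R by rewrite invr_gt0 ltr0n invf_le1// ler1n.
apply: le_trans (modularZ_le _ half01) _.
by apply: lee_wpmul2l; [rewrite lee_fin invr_ge0|exact: modular_half].
Qed.

(** If rho(4 f / e) and rho(4 g / e) are at most 1, so is rho((f + g) / e): a
    triangle inequality with a constant, which does the work of that of the
    Luxemburg norm. *)
Lemma modular_quarter1 f g : rho f <= 1 -> rho g <= 1 -> rho (4^-1 *: (f + g))%R <= 1.
Proof.
move=> f1 g1.
have h : rho f + rho g <= 1%:E + 1%:E by exact: leeD f1 g1.
have half0 : 0 <= (2^-1)%R%:E :> \bar R by rewrite lee_fin invr_ge0 ler0n.
apply: le_trans (modular_quarter f g) _.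
apply: le_trans (lee_wpmul2l half0 h) _.
have e1 : (2^-1 * (1 + 1) = 1 :> R)%R by field.
by rewrite -EFinD -EFinM lee_fin e1.
Qed.

(** The scales that make f and c g modular-finite are reduced to a common one
    and halved. *)
Lemma orlicz_lorentz_subspace : vector_subspace (orlicz_lorentz (gamma := gamma) phi w).
Proof.
have L0mem : orlicz_lorentz phi w (0%R : L0 m).
  by exists 1%R => //; rewrite scaler0 -/(rho _) modular0 ltry.
split; first exact: L0mem.
move=> c f g [k k0 kf] [l l0 lg].
have [->|c0] := eqVneq c 0%R; first by rewrite scale0r add0r; exists l.
have c'0 : (0 < `|c|)%R by rewrite normr_gt0.
pose r : R := Num.min (k / `|c|)%R l; have r0 : (0 < r)%R by rewrite lt_min l0 divr_gt0.
exists (2^-1 * r)%R; first by rewrite mulr_gt0.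
rewrite -scalerA scalerDr; apply: le_lt_trans (modular_half _ _) _.
apply: lte_add_pinfty; last first.
  by apply: le_lt_trans lg; apply: modular_mono; rewrite r0 ge_min lexx orbT.
apply: le_lt_trans kf.
have sg : rho (r *: (c *: f)) <= rho ((r * `|c|) *: f)%R.
  have [cp|cn] := leP 0%R c.
    have -> : (r *: (c *: f) = (r * `|c|) *: f)%R by rewrite scalerA ger0_norm.
    exact: lexx.
  have -> : (r *: (c *: f) = - ((r * `|c|) *: f))%R.
    by rewrite scalerA ltr0_norm// mulrN scaleNr opprK.
  exact: modularN.
apply: le_trans sg _; apply: modular_mono; rewrite mulr_gt0//=.
by rewrite -ler_pdivlMr// ge_min lexx.
Qed.

Lemma modular_scale_small f (e : R) : orlicz_lorentz phi w f -> (0 < e)%R ->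
  exists2 c : R, (0 < c)%R & rho ((e * c) *: f)%R <= 1.
Proof.
move=> [k k0 kf] e0; have rf : rho (k *: f) \is a fin_num.
  by rewrite ge0_fin_numE// (modular_ge0 phi_orlicz ww).
pose M := fine (rho (k *: f)).
have ME : rho (k *: f) = M%:E by rewrite fineK.
have M0 : (0 <= M)%R by rewrite -lee_fin -ME (modular_ge0 phi_orlicz ww).
have l0 : (0 < (1 + M)^-1)%R by rewrite invr_gt0 ltr_pwDl.
have l1 : ((1 + M)^-1 <= 1)%R by rewrite invf_le1 ?lerDl// ltr_pwDl.
exists ((1 + M)^-1 * k / e)%R; first by rewrite divr_gt0// mulr_gt0.
rewrite mulrC divfK ?gt_eqF// -scalerA.
apply: le_trans (modularZ_le _ _) _; first by rewrite l0.
by rewrite ME -EFinM lee_fin ler_pdivrMl ?ltr_pwDl// mulr1 lerDr.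
Qed.

Lemma luxemburg_lt f (e d : R) : (0 < d)%R -> (d < e)%R -> rho (d^-1 *: f) <= 1 ->
  (luxemburg_norm phi w f < e)%R.
Proof.
move=> d0 de df; apply: le_lt_trans de; apply: ge_inf.
  by exists 0%R => x [/ltW].
by split.
Qed.

(** If f took absolute values above u on a set of positive measure d, the
    modular of k f would be at least W(d) phi(k u), which is unbounded in k. *)
Lemma modular_le1_eq0 f : (forall k : R, (0 < k)%R -> rho (k *: f) <= 1) -> f = 0%R.
Proof.
move=> fk.
have D0 u : (0 < u)%R -> distribution_fun f u = 0.
  move=> u0; apply/eqP; rewrite eq_le distr_ge0 andbT leNgt; apply/negP => Du.
  have Wu := cumul_gt0 gamma_gt0 ww Du.
  have [d Wd du] : exists2 d : R, (0 < d)%R & d%:E <= W (distribution_fun f u).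
    rewrite /W; move: Wu; case: cumul => [x x0|_|//]; first by exists x.
    by exists 1%R => //; rewrite leey.
  have [a a1 da] := orlicz_unbounded phi_orlicz d^-1%R.
  have a0 : (0 < a)%R by exact: lt_le_trans a1.
  have k0 : (0 < a / u)%R by rewrite divr_gt0.
  have := fk _ k0; apply/negP; rewrite -ltNge.
  apply: lt_le_trans (modular_ge phi_orlicz ww (ltW a0) (d := distribution_fun f u) _).
    apply: (@lt_le_trans _ _ (d%:E * (phi a)%:E)).
      by rewrite -EFinM lte_fin -ltr_pdivrMl// mulr1.
    by apply: lee_wpmul2r => //; rewrite lee_fin (orlicz_ge0 phi_orlicz)// ltW.
  move=> v v0 va.
  have k0' : (a / u != 0)%R by rewrite gt_eqF.
  rewrite -[X in distribution_fun X u](scale1r f) -(mulVf k0') -scalerA.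
  rewrite -[X in distribution_fun _ X](mulKf k0' u).
  apply: le_trans (distributionZ _ _ _) _; first by rewrite invr_gt0.
  by apply: distr_ni; rewrite divfK ?gt_eqF// ltW.
have N0 : m.-negligible (\bigcup_n superlevel gamma (Defs.repr_of f) n.+1%:R^-1).
  apply: negligible_bigcup => n; apply/negligibleP; first exact: measurable_superlevel.
  rewrite -[LHS]/(cm (superlevel gamma (Defs.repr_of f) n.+1%:R^-1 `&` I_gamma gamma)).
  rewrite setIidl; last exact: superlevel_sub.
  by apply: D0; rewrite invr_gt0.
have NI : m.-negligible (~` I_gamma gamma).
  apply/negligibleP; first by apply: measurableC; exact: measurable_I_gamma.
  by rewrite -[LHS]/(cm (~` I_gamma gamma `&` I_gamma gamma)) setICl measure0.
rewrite -(Defs.repr_ofK f); apply: class_ofP.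
apply: negligibleS (negligibleU N0 NI) => t /= /not_implyP[_ /eqP ft].
have [It|] := pselect (I_gamma gamma t); last by right.
left; have ft0 : (0 < `|Defs.repr_of f t|)%R by rewrite normr_gt0.
exists (Num.truncn `|Defs.repr_of f t|^-1) => //; split => //.
by rewrite invf_plt ?posrE// truncnS_gt.
Qed.

End one_weight.
End orlicz_lorentz_space.

(** * Blocks of prescribed length and height *)

(** Passes from families to sets: independence of the family z, tested on
    duplicate-free lists of indices, gives injectivity and independence of the
    range. *)
Lemma indep_mod_range (R : realType) (V : lmodType R) (Y : set V) (I : eqType) (z : I -> V) :
  vector_subspace Y ->
  (forall (s : seq I) (c : I -> R), uniq s -> Y (\sum_(i <- s) c i *: z i) ->
     forall i, i \in s -> c i = 0) ->
  injective z /\ indep_mod Y (range z).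
Proof.
move=> sY H; split.
  move=> i j zij; apply: contrapT => /eqP ij.
  have uij : uniq [:: i; j] by rewrite /= inE ij.
  have Yij : Y (\sum_(k <- [:: i; j]) (if k == i then 1 else -1) *: z k).
    rewrite !big_cons big_nil addr0 eqxx eq_sym (negbTE ij) scale1r scaleN1r zij subrr.
    exact: subspace0.
  have := H _ (fun k => if k == i then 1 else -1) uij Yij i (mem_head _ _).
  by rewrite eqxx => /eqP; rewrite oner_eq0.
move=> s c us sz Ys.
have [rs [srs urs]] : exists rs, s = map z rs /\ uniq rs.
  elim: s us sz {Ys} => [|v s IH] /= us sz; first by exists [::].
  have /andP[vs us'] := us.
  have [|rs [srs urs]] := IH us'; first by move=> w ws; apply: sz; rewrite /= inE ws orbT.
  have [i _ zi] : range z v by apply: sz; rewrite /= mem_head.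
  exists (i :: rs); rewrite srs /= zi; split=> //; rewrite urs andbT.
  by apply: contra vs => irs; rewrite srs -zi map_f.
subst s; move: Ys; rewrite big_map => Ys v /mapP[i irs ->].
exact: (H rs (c \o z) urs Ys i irs).
Qed.

Section Delta2_growth.
Variables (R : realType) (phi : R -> R) (K u0 : R).
Hypothesis phi_orlicz : orlicz_function phi.
Hypotheses (K0 : 0 < K) (u0_ge0 : 0 <= u0).
Hypothesis D2 : forall u, u0 <= u -> phi (2 * u) <= K * phi u.

Lemma Delta2_iter i u : u0 <= u -> phi (2 ^+ i * u) <= K ^+ i * phi u.
Proof.
move=> uu; elim: i => [|i IH]; first by rewrite !expr0 !mul1r.
rewrite !exprS -!mulrA; apply: le_trans (D2 _) _; last by rewrite ler_pM2l.
apply: (le_trans uu); apply: ler_peMl; first exact: le_trans uu.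
by rewrite exprn_ege1// ler1n.
Qed.

(** Delta_2 iterated until 2^i k >= 2. *)
Lemma Delta2_shrink (k : R) : 0 < k ->
  exists2 C : R, 0 < C & forall u, u0 <= k * u -> phi (2 * u) <= C * phi (k * u).
Proof.
move=> k0.
have [i ki] : exists i : nat, 2 <= 2 ^+ i * k.
  exists (Num.truncn (2 / k)).+1; rewrite -ler_pdivrMr//.
  apply: (le_trans (ltW (truncnS_gt _))).
  by rewrite -natrX ler_nat ltnW// ltn_expl.
exists (K ^+ i); first by rewrite exprn_gt0.
move=> u uu; have u_ge0 : 0 <= u by rewrite -(pmulr_rge0 _ k0) (le_trans u0_ge0).
apply: le_trans (Delta2_iter i uu).
apply: (orlicz_le phi_orlicz); first by rewrite mulr_ge0.
by rewrite mulrA ler_wpM2r.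
Qed.

(** The constant absorbs the u below the threshold u0. *)
Lemma Delta2_double u : 0 <= u -> phi (2 * u) <= K * phi u + phi (2 * u0).
Proof.
move=> u_ge0; have [uu|uu] := leP u0 u.
  by rewrite (le_trans (D2 uu))// lerDl (orlicz_ge0 phi_orlicz)// mulr_ge0.
apply: (@le_trans _ _ (phi (2 * u0))).
  by apply: (orlicz_le phi_orlicz); rewrite ?mulr_ge0// ler_pM2l// ltW.
by rewrite lerDr mulr_ge0 ?(ltW K0)// (orlicz_ge0 phi_orlicz).
Qed.

End Delta2_growth.

Section choice_of_blocks.
Local Open Scope ereal_scope.
Variables (R : realType) (gamma : \bar R).
Hypothesis gamma_gt0 : 0 < gamma.
Variables (phi : R -> R) (u0 : R).
Hypothesis phi_orlicz : orlicz_function phi.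
Hypotheses (u0_ge0 : (0 <= u0)%R) (u0_eq0 : gamma = +oo -> u0 = 0%R).
Variables (w v : R -> R).
Hypotheses (ww : weight gamma w) (wv : weight gamma v).
Hypothesis unb : forall C : R, (0 <= C)%R ->
  exists2 t, I_gamma_pos gamma t & C%:E * cumul gamma w t%:E < cumul gamma v t%:E.

Let W t := fine (cumul gamma w t%:E).
Let V t := fine (cumul gamma v t%:E).

Let WE t : cumul gamma w t%:E = (W t)%:E.
Proof. by rewrite fineK// cumul_fin_num// ltry. Qed.

Let VE t : cumul gamma v t%:E = (V t)%:E.
Proof. by rewrite fineK// cumul_fin_num// ltry. Qed.

Let W_gt0 t : (0 < t)%R -> (0 < W t)%R.
Proof. by move=> t0; rewrite -lte_fin -WE cumul_gt0. Qed.

(** For t >= d and finite gamma the ratio of v- and w-primitives is at most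
    V(gamma) / W(d), so it can only be large at small t. *)
Lemma unbounded_near0 (C d : R) : (0 <= C)%R -> (0 < d)%R -> gamma < +oo ->
  exists2 t, I_gamma_pos gamma t & (t < d)%R /\ (C * W t < V t)%R.
Proof.
move=> C0 d0 goo.
pose B := fine (cumul gamma v gamma).
have BE : cumul gamma v gamma = B%:E by rewrite fineK// cumul_fin_num.
have B0 : (0 <= B)%R by rewrite -lee_fin -BE cumul_ge0.
(* With this constant a t >= d would have B <= (B / W d) W t < V t <= B. *)
have [|t It] := unb (C := Num.max C (B / W d)%R); first by rewrite le_max C0.
have [t0 tg] := It.
rewrite WE VE -EFinM lte_fin => Ht; exists t => //.
have h x : (x <= Num.max C (B / W d))%R -> (x * W t < V t)%R.
  by move=> xC; apply: le_lt_trans Ht; rewrite ler_pM2r// W_gt0.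
split; last by apply: h; rewrite le_max lexx.
rewrite ltNge; apply/negP => dt; have := h (B / W d)%R.
rewrite le_max lexx orbT => /(_ isT); apply/negP; rewrite -leNgt.
apply: (@le_trans _ _ B).
  by rewrite -lee_fin -VE -BE (cumul_le wv)// ltW.
rewrite -mulrA ler_peMr//.
rewrite mulrC ler_pdivlMr ?W_gt0// mul1r -lee_fin -!WE (cumul_le ww)//.
Qed.

(** The height is a = phi^-1(2^-j / W(t)). Then W(t) phi(a) <= 2^-j, whereas
    2 a > a gives phi(2 a) > 2^-j / W(t), and V(t) > 4^j W(t) yields the lower
    bound. If gamma is finite, t is also taken so small that the blocks fit into
    [0, gamma[ and that a exceeds the threshold of Delta_2. *)
Lemma exists_block (j : nat) : exists t a : R,
  [/\ I_gamma_pos gamma t, t%:E <= (2^-1 ^+ j.+1)%:E * gamma, (0 < a)%R &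
   [/\ (2 ^+ j * u0 <= a)%R,
      cumul gamma w t%:E * (phi a)%:E <= (2^-1 ^+ j)%:E &
      (2 ^+ j)%:E <= cumul gamma v t%:E * (phi (2 * a))%:E]].
Proof.
pose C : R := (4 ^+ j)%R.
have C0 : (0 <= C)%R by rewrite exprn_ge0.
have p0 : (0 < 2^-1 ^+ j :> R)%R by rewrite exprn_gt0// invr_gt0.
have q0 i : (0 < 2 ^+ i :> R)%R by rewrite exprn_gt0.
have [t It [tg CV Wa]] : exists2 t, I_gamma_pos gamma t &
    [/\ t%:E <= (2^-1 ^+ j.+1)%:E * gamma, (C * W t < V t)%R &
    (2 ^+ j * u0 <= orlicz_inv phi (2^-1 ^+ j / W t))%R].
  have [goo|gfin] := eqVneq gamma +oo.
    have [t It] := unb C0; rewrite WE VE -EFinM lte_fin => CV.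
    exists t => //; split => //.
      by rewrite goo gt0_muley ?lte_fin ?leey// exprn_gt0// invr_gt0.
    rewrite u0_eq0// mulr0 ltW// orlicz_inv_gt0// divr_gt0// W_gt0//.
    by case: It.
  have {gfin} goo : gamma < +oo by rewrite ltey.
  (* Smallness of t makes 2^-j / W(t) at least phi b, so that the height
     phi^-1(2^-j / W(t)) is at least b. *)
  pose b : R := Num.max 1%R (2 ^+ j * u0)%R.
  have b0 : (0 < b)%R by rewrite lt_max ltr01.
  have pb : (0 < phi b)%R by exact: orlicz_gt0.
  have [|d2 d20 Wd2] := cumul_small gamma_gt0 ww (eps := (2^-1 ^+ j / phi b)%R).
    by rewrite divr_gt0.
  move: (gamma_gt0) goo; case E : gamma => [g| |//]; last by rewrite ltxx.
  rewrite lte_fin => g0 goo.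
  pose d := Num.min d2 (2^-1 ^+ j.+1 * g)%R.
  have d0 : (0 < d)%R by rewrite lt_min d20 mulr_gt0// exprn_gt0// invr_gt0.
  have [|t It [td CV]] := @unbounded_near0 C d C0 d0; first by rewrite E ltry.
  have t0 : (0 < t)%R by case: It.
  exists t => //; first by rewrite -E.
  split=> //.
    by rewrite -EFinM lee_fin (le_trans (ltW td))// ge_min lexx orbT.
  apply: (@le_trans _ _ b); first by rewrite le_max lexx orbT.
  rewrite orlicz_le_inv ?(ltW b0)// ?divr_gt0 ?W_gt0//.
  rewrite ler_pdivlMr ?W_gt0// mulrC -ler_pdivlMr// -lee_fin -WE.
  apply: le_trans Wd2; apply: (cumul_le ww); rewrite lee_fin (le_trans (ltW td))//.
  by rewrite ge_min lexx.
have t0 : (0 < t)%R by case: It.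
have Wt := W_gt0 t0.
have s0 : (0 < 2^-1 ^+ j / W t)%R by rewrite divr_gt0.
pose a := orlicz_inv phi (2^-1 ^+ j / W t); have a0 : (0 < a)%R by exact: orlicz_inv_gt0.
exists t, a; split=> //; split=> //.
  rewrite WE -EFinM lee_fin mulrC -ler_pdivlMr//.
  by rewrite -(orlicz_le_inv phi_orlicz) ?(ltW a0).
rewrite VE -EFinM lee_fin.
have : (2^-1 ^+ j / W t < phi (2 * a))%R.
  rewrite -(orlicz_inv_lt phi_orlicz) ?mulr_ge0 ?(ltW a0)//.
  by rewrite -/a ltr_pMl// ltr1n.
rewrite ltr_pdivrMr// => h.
apply: (@le_trans _ _ (C * W t * phi (2 * a)))%R; last first.
  by rewrite ler_wpM2r ?(ltW CV)// (orlicz_ge0 phi_orlicz)// mulr_ge0// ltW.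
rewrite -mulrA (mulrC (W t)).
apply: le_trans (ler_wpM2l C0 (ltW h)).
by rewrite /C -exprMn_comm; [rewrite (_ : 4 / 2 = 2 :> R)%R//; field|exact: mulrC].
Qed.

End choice_of_blocks.

(** * Functions constant on disjoint blocks *)

(** Countable subadditivity follows from the finite one by left continuity. *)
Lemma cumul_nneseries (R : realType) (gamma : \bar R) (w : R -> R) (d : nat -> \bar R) :
  weight gamma w -> (forall j, 0 <= d j)%E ->
  (cumul gamma w (\sum_(0 <= j <oo) d j) <= \sum_(0 <= j <oo) cumul gamma w (d j))%E.
Proof.
move=> ww d0; apply: (cumul_le_sup ww).
  by apply: nneseries_ge0 => j _ _; exact: (cumul_ge0 ww).
move=> r Ir rd.
have [N rN] : exists N, (r%:E < \sum_(0 <= j < N) d j)%E.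
  apply: contrapT => /forallNP h; move: rd; apply/negP; rewrite -leNgt.
  apply: lime_le; first exact: is_cvg_nneseries.
  by apply: nearW => N; rewrite leNgt; apply/negP/h.
apply: (@le_trans _ _ (\sum_(0 <= j < N) cumul gamma w (d j))%E); last first.
  by apply: nneseries_lim_ge => j _ _; exact: (cumul_ge0 ww).
apply: le_trans (cumul_le ww (ltW rN)) _.
elim: N {rN} => [|N IH]; first by rewrite !big_geq// (cumul0 gamma w (lexx _)).
rewrite !big_nat_recr//=; apply: (le_trans (cumulD ww _ _)) => //.
  by apply: sume_ge0.
exact: leeD.
Qed.

Section blocks.
Variables (R : realType) (t : nat -> R).
Hypothesis t_gt0 : forall j, 0 < t j.
Local Notation lebT := (caratheodory_type ((wlength (@idfun R))^*)%mu).
Local Notation lmeasurable := (((wlength (@idfun R))^*)%mu.-cara.-measurable).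

Definition knot n : R := \sum_(i < n) t i.
Definition block j : set R := `[knot j, knot j.+1[%classic.

Lemma knot_le : {homo knot : n m / (n <= m)%N >-> n <= m}.
Proof.
apply: homo_leq => //; first exact: le_trans.
by move=> n; rewrite /knot big_ord_recr/= lerDl ltW.
Qed.

Lemma knot_ge0 n : 0 <= knot n.
Proof. by apply: sumr_ge0 => i _; rewrite ltW. Qed.

Lemma block_inj i j s : block i s -> block j s -> i = j.
Proof.
rewrite /block/= !in_itv/= => /andP[i1 i2] /andP[j1 j2].
apply/eqP; rewrite eqn_leq; apply/andP; split; rewrite leqNgt; apply/negP => h.
- by have := lt_le_trans j2 (le_trans (knot_le h) i1); rewrite ltxx.
- by have := lt_le_trans i2 (le_trans (knot_le h) j1); rewrite ltxx.
Qed.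

Lemma measurable_block j : lmeasurable (block j).
Proof. exact: lebmeasurable_itv. Qed.

Lemma measure_block j : completed_lebesgue_measure (block j) = (t j)%:E.
Proof.
rewrite -[LHS]/(lebesgue_measure ([set` `[knot j, knot j.+1[] : set R)).
rewrite lebesgue_measure_itv/= lte_fin /knot big_ord_recr/= ltrDl t_gt0.
by rewrite -EFinB addrAC subrr add0r.
Qed.

Definition blockfun (y : nat -> R) (s : R) : R :=
  if pselect (exists j, block j s) is left e then y (projT1 (cid e)) else 0.

Lemma blockfunE y j s : block j s -> blockfun y s = y j.
Proof.
move=> js; rewrite /blockfun; case: pselect => [e|]; last by case; exists j.
by case: cid => i is_ /=; rewrite (block_inj is_ js).
Qed.

Lemma blockfun_out y s : (forall j, ~ block j s) -> blockfun y s = 0.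
Proof. by move=> h; rewrite /blockfun; case: pselect => [e|//]; by have [j] := e; move=> /h. Qed.

Lemma blockfun_linear c y z s :
  blockfun (fun j => c * y j + z j) s = c * blockfun y s + blockfun z s.
Proof.
have [[j js]|h] := pselect (exists j, block j s); first by rewrite !(blockfunE _ js).
by rewrite !blockfun_out ?mulr0 ?addr0// => j js; apply: h; exists j.
Qed.

Lemma measurable_blockfun y : measurable_fun [set: lebT] (blockfun y).
Proof.
move=> _ B mB; rewrite setTI.
have -> : blockfun y @^-1` B = (\bigcup_(j in [set j | B (y j)]) block j) `|`
    (if `[< B 0 >] then ~` (\bigcup_j block j) else set0).
  apply/seteqP; split => s /=.
    have [[j js]|h] := pselect (exists j, block j s).
      by rewrite (blockfunE _ js) => Bj; left; exists j.
    rewrite blockfun_out; last by move=> j js; apply: h; exists j.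
    by move=> B0; right; rewrite asboolT// => -[j _ js]; apply: h; exists j.
  move=> [[j Bj js]|]; first by rewrite (blockfunE _ js).
  case: asboolP => // B0 nj; rewrite blockfun_out// => j js.
  by apply: nj; exists j.
apply: measurableU; first by apply: bigcup_measurable => j _; exact: measurable_block.
case: asboolP => _; last exact: measurable0.
by apply: measurableC; apply: bigcup_measurable => j _; exact: measurable_block.
Qed.

End blocks.

Definition mk_mfun d (T : measurableType d) (R : realType) (f : T -> R)
  (mf : measurable_fun [set: T] f) : {mfun T >-> R} := mfun_Sub (mem_set mf).

Lemma mk_mfunE d (T : measurableType d) (R : realType) (f : T -> R)
  (mf : measurable_fun [set: T] f) : mk_mfun mf = f :> (T -> R).
Proof. by []. Qed.

Section independent_family.
Variables (R : realType) (gamma : \bar R).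
Hypothesis gamma_gt0 : (0 < gamma)%E.
Variables (phi : R -> R) (K u0 : R).
Hypothesis phi_orlicz : orlicz_function phi.
Hypotheses (K_gt0 : 0 < K) (u0_ge0 : 0 <= u0).
Hypothesis D2 : forall u, u0 <= u -> phi (2 * u) <= K * phi u.
Variables (w : R -> R) (t a : nat -> R).
Hypothesis ww : weight gamma w.
Hypothesis t_gt0 : forall j, 0 < t j.
Hypothesis t_le : forall j, ((t j)%:E <= (2^-1 ^+ j.+1)%:E * gamma)%E.
Hypothesis a_gt0 : forall j, 0 < a j.
Hypothesis a_ge : forall j, 2 ^+ j * u0 <= a j.
Hypothesis wa : forall j,
  (cumul gamma w (t j)%:E * (phi (a j))%:E <= (2^-1 ^+ j)%:E)%E.
Local Notation lebT := (caratheodory_type ((wlength (@idfun R))^*)%mu).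
Let cm : {measure set lebT -> \bar R} := @completed_lebesgue_measure R.
Let m := m_gamma gamma.

Let cm_block j : cm (block t j) = (t j)%:E. Proof. exact: measure_block. Qed.

Lemma knot_lt_gamma j s : s < knot t j -> (s%:E < gamma)%E.
Proof.
move=> sj; move: gamma_gt0 t_le; case: gamma => [g| |//]; last by move=> *; rewrite ltry.
rewrite !lte_fin => g0 tg; apply: lt_le_trans sj _.
(* The lengths t_i are at most 2^-(i+1) gamma. *)
suff : knot t j <= (1 - 2^-1 ^+ j) * g.
  move=> /le_trans; apply; rewrite ler_piMl ?(ltW g0)// gerBl exprn_ge0// invr_ge0//.
elim: j => [|j IH]; first by rewrite /knot big_ord0 expr0 subrr mul0r.
rewrite /knot big_ord_recr/= -/(knot t j).
have := tg j; rewrite -EFinM lee_fin exprS => h.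
have -> : (1 - 2^-1 * 2^-1 ^+ j) * g = (1 - 2^-1 ^+ j) * g + 2^-1 * 2^-1 ^+ j * g.
  by set p := 2^-1 ^+ j; field.
exact: lerD.
Qed.

Lemma block_sub_I j : block t j `<=` I_gamma gamma.
Proof.
move=> s; rewrite /block/= in_itv/= => /andP[s1 s2]; split; last exact: knot_lt_gamma s2.
exact: le_trans (knot_ge0 t_gt0 j) s1.
Qed.

Definition block_mfun (y : nat -> R) : {mfun lebT >-> R} :=
  mk_mfun (measurable_blockfun t_gt0 (fun j => y j * a j)).

Definition blockL0 (y : nat -> R) : L0 m := class_of m (block_mfun y).

Lemma blockL0_linear (c : R) (y z : nat -> R) :
  blockL0 (fun j => c * y j + z j) = c *: blockL0 y + blockL0 z.
Proof.
rewrite -[c *: _]/(scaleL0 c (blockL0 y)) -[RHS]/(addL0 _ (blockL0 z)).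
rewrite class_ofZ class_ofD; apply: class_ofP; apply: aeW => s _ /=.
rewrite -[RHS]/(c * blockfun t (fun j => y j * a j) s + blockfun t (fun j => z j * a j) s).
rewrite -blockfun_linear//; congr (blockfun t _ s).
by apply/funext => j; rewrite mulrDl mulrA.
Qed.

Lemma blockL0_0 : blockL0 (fun=> 0) = 0.
Proof.
apply: class_ofP; apply: aeW => s _ /=.
have [[j js]|h] := pselect (exists j, block t j s).
  by rewrite (blockfunE t_gt0 _ js) mul0r.
by rewrite blockfun_out// => j js; apply: h; exists j.
Qed.

Lemma blockL0_sum (I : Type) (r : seq I) (c : I -> R) (x : I -> nat -> R) :
  blockL0 (fun j => \sum_(i <- r) c i * x i j) = \sum_(i <- r) c i *: blockL0 (x i).
Proof.
elim: r => [|i r IH].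
  rewrite big_nil -blockL0_0; congr blockL0; apply/funext => j; exact: big_nil.
rewrite big_cons -IH -blockL0_linear; congr blockL0; apply/funext => j; exact: big_cons.
Qed.

(** By countable subadditivity W(d_f(phi^-1(s))) is at most the sum of the
    W(t_j) over those j with phi^-1(s) < a_j, that is, s < phi(a_j); integration
    in s gives the sum of the W(t_j) phi(a_j). *)
Lemma modular_blockL0 (y : nat -> R) : (forall j, `|y j| <= 1) ->
  (modular phi w (blockL0 y) <= 2%:E)%E.
Proof.
move=> y1; rewrite (modular_layer_cake phi_orlicz ww).
pose W := cumul gamma w; have W0 d : (0 <= W d)%E by exact: (cumul_ge0 ww).
pose ind j (s : R) : R := \1_(`]0, (phi (a j))[%classic : set R) s.
have ind0 j s : 0 <= ind j s by rewrite /ind.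
pose P : set R := `]0%R, +oo[%classic.
have dist_le s : P s -> (distribution_fun (blockL0 y) (orlicz_inv phi s) <=
    \sum_(0 <= j <oo) ((ind j s * t j)%:E))%E.
  rewrite /P/= in_itv/= andbT => s0; rewrite distribution_class.
  (* Above the level phi^-1(s) the function lives on the blocks with s < phi(a_j). *)
  pose F j : set lebT := if `[< ind j s == 1 >] then block t j else set0.
  have mF j : ((wlength (@idfun R))^*)%mu.-cara.-measurable (F j).
    by rewrite /F; case: asboolP => _; [exact: measurable_block|exact: measurable0].
  apply: (@le_trans _ _ (\sum_(0 <= j <oo) cm (F j))%E); last first.
    apply: lee_nneseries => // j _; rewrite /F.
    case: asboolP => [/eqP ->|_]; first by rewrite cm_block mul1r.
    by rewrite measure0 lee_fin mulr_ge0// ltW.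
  apply: (measure_sigma_subadditive cm) => //; first exact: measurable_superlevel.
  move=> r [Ir]; rewrite mk_mfunE.
  have [[j jr]|h] := pselect (exists j, block t j r); last first.
    rewrite blockfun_out ?normr0; last by move=> j jr; apply: h; exists j.
    by rewrite ltNge ltW// orlicz_inv_gt0.
  rewrite (blockfunE t_gt0 _ jr) normrM (gtr0_norm (a_gt0 j)) => h.
  exists j => //; rewrite /F asboolT// /ind indicE mem_set//=.
  rewrite in_itv/= s0/= -(orlicz_inv_lt phi_orlicz) ?(ltW (a_gt0 j))//.
  by apply: (lt_le_trans h); rewrite ler_piMl// ltW.
have Wdist s : P s -> (W (distribution_fun (blockL0 y) (orlicz_inv phi s)) <=
    \sum_(0 <= j <oo) ((ind j s)%:E * W (t j)%:E))%E.
  move=> Ps; apply: le_trans (cumul_le ww (dist_le s Ps)) _.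
  apply: le_trans (cumul_nneseries ww _) _.
    by move=> j; rewrite lee_fin mulr_ge0// ltW.
  apply: lee_nneseries => [j _ _|j _]; first exact: W0.
  rewrite /ind indicE; case: (_ \in _); rewrite /= ?mul1r ?mul1e ?mul0r ?mul0e//.
  by rewrite cumul0.
apply: (@le_trans _ _ (\int[lebesgue_measure]_(s in P)
    (\sum_(0 <= j <oo) ((ind j s)%:E * W (t j)%:E)))%E).
  apply: ge0_le_integral => //.
  - exact: (measurable_cumul_distr phi_orlicz ww).
  - apply: ge0_emeasurable_sum => j.
      by move=> s _ _; rewrite mule_ge0// lee_fin.
    move=> _; apply: emeasurable_funM => //.
    by apply/measurable_EFinP; apply: measurable_indic; exact: measurable_itv.
rewrite integral_nneseries//; first last.
- by move=> j s _; rewrite mule_ge0// lee_fin.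
- move=> j; apply: emeasurable_funM => //.
  by apply/measurable_EFinP; apply: measurable_indic; exact: measurable_itv.
- exact: measurable_itv.
apply: (@le_trans _ _ (\sum_(0 <= j <oo) (2^-1 ^+ j)%:E)%E).
  apply: lee_nneseries => [j _ _|j _].
    by apply: integral_ge0 => s _; rewrite mule_ge0// lee_fin.
  rewrite ge0_integralZr//; last 3 first.
  - exact: measurable_itv.
  - by apply/measurable_EFinP; apply: measurable_indic; exact: measurable_itv.
  - by move=> s _; rewrite lee_fin.
  rewrite integral_indic; [|exact: measurable_itv|exact: measurable_itv].
  apply: le_trans (wa j); rewrite muleC; apply: lee_wpmul2l => //.
  apply: (@le_trans _ _ (lebesgue_measure ([set` `]0, (phi (a j))[] : set R))).
    apply: le_measure; rewrite ?inE; last exact: subIsetl.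
      by apply: measurableI; exact: measurable_itv.
    exact: measurable_itv.
  rewrite lebesgue_measure_itv/= lte_fin; case: ifPn => _; first by rewrite sube0.
  by rewrite lee_fin (orlicz_ge0 phi_orlicz)// ltW.
apply: lime_le.
  by apply: is_cvg_nneseries => j _ _; rewrite lee_fin exprn_ge0// invr_ge0.
apply: nearW => n; rewrite sumEFin lee_fin.
suff -> : \sum_(0 <= j < n) (2^-1 ^+ j : R) = 2 - 2 * 2^-1 ^+ n.
  by rewrite gerBl mulr_ge0// exprn_ge0// invr_ge0.
elim: n => [|n IH]; first by rewrite big_geq// expr0 mulr1 subrr.
by rewrite big_nat_recr//= IH exprS; set p := 2^-1 ^+ n; field.
Qed.

Lemma blockL0_in (y : nat -> R) : (forall j, `|y j| <= 1) ->
  orlicz_lorentz phi w (blockL0 y).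
Proof.
move=> y1; exists 1; first exact: ltr01.
by rewrite scale1r; apply: le_lt_trans (modular_blockL0 y1) _; exact: ltry.
Qed.

(** If k f had finite modular M, block j would give V(t_j) phi(k c a_j) <= M,
    and by Delta_2 V(t_j) phi(2 a_j) <= C M, against the lower bound 2^j. The
    growth of a_j puts k c a_j above the threshold of Delta_2 for large j. *)
Lemma blockL0_notin (v : R -> R) (y : nat -> R) (c : R) : weight gamma v -> 0 < c ->
  (forall N, exists j, [/\ (N <= j)%N, c <= `|y j| &
    ((2 ^+ j)%:E <= cumul gamma v (t j)%:E * (phi (2 * a j))%:E)%E]) ->
  ~ orlicz_lorentz phi v (blockL0 y).
Proof.
move=> wv c0 Hy [k k0 kf].
have kc0 : 0 < k * c by exact: mulr_gt0.
have [C C0 HC] := Delta2_shrink phi_orlicz K_gt0 u0_ge0 D2 kc0.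
have rf : modular phi v (k *: blockL0 y) \is a fin_num.
  by rewrite ge0_fin_numE// (modular_ge0 phi_orlicz wv).
pose M := fine (modular phi v (k *: blockL0 y)).
have ME : modular phi v (k *: blockL0 y) = M%:E by rewrite fineK.
have [j [Nj cy vj]] := Hy (Num.truncn (Num.max (k * c)^-1 (C * M))).+1.
have hj : Num.max (k * c)^-1 (C * M) < 2 ^+ j.
  apply: (lt_le_trans (truncnS_gt _)); rewrite -natrX ler_nat.
  by apply: (leq_trans Nj); rewrite ltnW// ltn_expl.
have [j1 j2] : (k * c)^-1 < 2 ^+ j /\ C * M < 2 ^+ j.
  by move: hj; rewrite gt_max => /andP[].
have uj : u0 <= k * c * a j.
  apply: (@le_trans _ _ (k * c * (2 ^+ j * u0))); last by rewrite ler_pM2l.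
  rewrite mulrA ler_peMl// mulrC -ler_pdivrMr// mul1r ltW//.
have V0 : (0 <= cumul gamma v (t j)%:E)%E by exact: (cumul_ge0 wv).
have lb : (cumul gamma v (t j)%:E * (phi (k * c * a j))%:E <= M%:E)%E.
  rewrite -ME; apply: (modular_ge phi_orlicz wv).
    by rewrite mulr_ge0 ?(ltW kc0)// ltW.
  move=> x x0 xa.
  have k0' : k != 0 by rewrite gt_eqF.
  have -> : ((t j)%:E = cm (block t j))%E by rewrite cm_block.
  apply: (@le_trans _ _ (distribution_fun (blockL0 y) (k^-1 * x))).
    rewrite distribution_class; apply: le_measure; rewrite ?inE.
    - exact: measurable_block.
    - exact: measurable_superlevel.
    - move=> s js; split; first exact: block_sub_I js.
      rewrite mk_mfunE (blockfunE t_gt0 _ js) normrM (gtr0_norm (a_gt0 j)).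
      rewrite ltr_pdivrMl//; apply: (lt_le_trans xa).
      by rewrite -mulrA ler_pM2l// ler_pM2r.
  have := @distributionZ R gamma k^-1 (k *: blockL0 y) x.
  by rewrite scalerA mulVf// scale1r invr_gt0; exact.
have : (cumul gamma v (t j)%:E * (phi (2 * a j))%:E <= (C * M)%:E)%E.
  apply: (@le_trans _ _ (cumul gamma v (t j)%:E * (C * phi (k * c * a j))%:E))%E.
    by apply: lee_wpmul2l => //; rewrite lee_fin; exact: HC.
  by rewrite EFinM muleCA EFinM; apply: lee_wpmul2l => //; rewrite lee_fin ltW.
move=> /(le_trans vj); rewrite lee_fin; apply/negP.
by rewrite -ltNge.
Qed.

End independent_family.

(** * Continuum many functions independent modulo the union *)

(** The numbers m r and m r0 are more than 1 apart once m > 1 / |r - r0|. *)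
Lemma floor_separation (R : realType) (r0 : R) (rs : seq R) :
  exists N : nat, forall m r, (N <= m)%N -> r \in rs -> r != r0 ->
    Num.floor (m%:R * r) != Num.floor (m%:R * r0).
Proof.
elim: rs => [|r rs [N IH]]; first by exists 0%N.
pose B := (Num.truncn `|r - r0|^-1).+1.
exists (maxn N B) => m x; rewrite geq_max => /andP[Nm Bm].
rewrite inE => /orP[/eqP ->|]; last exact: IH.
move=> rr; have d0 : 0 < `|r - r0| by rewrite normr_gt0 subr_eq0.
have md : 1 < m%:R * `|r - r0|.
  rewrite -ltr_pdivrMr// mul1r; apply: (lt_le_trans (truncnS_gt _)).
  by rewrite ler_nat.
apply/eqP => E; move: md; rewrite -{1}(ger0_norm (ler0n R m)) -normrM mulrBr.
apply/negP; rewrite -leNgt ler_norml.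
have := floor_itv (m%:R * r); have := floor_itv (m%:R * r0); rewrite E.
by move=> /andP[? ?] /andP[? ?]; apply/andP; split; lra.
Qed.

(** Blocks are indexed by triples (n, m, k) through a coding of nat. In a
    linear combination of the z_r, the value on the block (n, m, floor(m r0)) is
    c r0 alone, for every large m, because the floors of the other m r differ.
    The combination therefore lies outside X_n unless c r0 = 0. *)
Lemma exists_independent_family (R : realType) (gamma : \bar R) (phi w : R -> R)
    (wn : nat -> R -> R) (K u0 : R) :
  (0 < gamma)%E -> orlicz_function phi -> 0 < K -> 0 <= u0 ->
  (gamma = +oo%E -> u0 = 0) ->
  (forall u, u0 <= u -> phi (2 * u) <= K * phi u) ->
  weight gamma w -> (forall n, weight gamma (wn n)) ->
  (forall n (C : R), 0 <= C -> exists2 t, I_gamma_pos gamma t &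
     (C%:E * cumul gamma w t%:E < cumul gamma (wn n) t%:E)%E) ->
  exists2 z : R -> L0 (m_gamma gamma), (forall r, orlicz_lorentz phi w (z r)) &
    forall (rs : seq R) (c : R -> R), uniq rs ->
      (exists n, orlicz_lorentz phi (wn n) (\sum_(r <- rs) c r *: z r)) ->
      forall r, r \in rs -> c r = 0.
Proof.
move=> gamma_gt0 phi_orlicz K0 u0_ge0 u0_eq0 D2 ww wwn unb.
pose decode j : option (nat * nat * int) := unpickle j.
pose nn j := if decode j is Some p then p.1.1 else 0%N.
have /choice[t /choice[a taP]] := fun j =>
  exists_block gamma_gt0 phi_orlicz u0_eq0 ww (wwn (nn j)) (unb (nn j)) j.
have t_gt0 j : 0 < t j by have [[]] := taP j.
have t_le j : ((t j)%:E <= (2^-1 ^+ j.+1)%:E * gamma)%E by have [] := taP j.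
have a_gt0 j : 0 < a j by have [] := taP j.
have a_ge j : 2 ^+ j * u0 <= a j by have [_ _ _ []] := taP j.
have wa j : (cumul gamma w (t j)%:E * (phi (a j))%:E <= (2^-1 ^+ j)%:E)%E.
  by have [_ _ _ []] := taP j.
have va j : ((2 ^+ j)%:E <= cumul gamma (wn (nn j)) (t j)%:E * (phi (2 * a j))%:E)%E.
  by have [_ _ _ []] := taP j.
pose x (r : R) (j : nat) : R :=
  if decode j is Some p then (p.2 == Num.floor (p.1.2%:R * r))%:R else 0.
exists (fun r => blockL0 gamma a t_gt0 (x r)).
  move=> r; apply: (blockL0_in phi_orlicz ww t_gt0 a_gt0 wa) => j.
  rewrite /x; case: (decode j) => [p|]; last by rewrite normr0.
  by case: eqP => _; rewrite ?normr1 ?normr0.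
move=> rs c urs [n]; rewrite -blockL0_sum => Xn r0 r0rs; apply: contrapT => /eqP cr0.
apply: (blockL0_notin gamma_gt0 phi_orlicz K0 u0_ge0 D2 t_le a_gt0 a_ge (wwn n) (c := `|c r0|)) Xn.
  by rewrite normr_gt0.
have [M MP] := floor_separation r0 rs.
(* m = k + M ranges over the integers beyond which all floors are separated. *)
pose f k := pickle (n, (k + M)%N, Num.floor ((k + M)%:R * r0)).
have fi : injective f.
  by move=> k l /(pcan_inj pickleK) [] /addIn.
move=> N; have [k Nk] := injective_gtn fi N.
have dec : decode (f k) = Some (n, (k + M)%N, Num.floor ((k + M)%:R * r0)).
  by rewrite /decode /f pickleK.
exists (f k); split; first exact: ltnW.
  rewrite (bigD1_seq r0)//= big_seq_cond big1 ?addr0; last first.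
    move=> r /andP[rrs rr0]; rewrite /x dec/= eq_sym (negbTE (MP _ _ _ rrs rr0)) ?mulr0//.
    exact: leq_addl.
  by rewrite /x dec/= eqxx mulr1.
by have := va (f k); rewrite /nn dec.
Qed.

(** * Convergence of truncations *)

Section order_continuity.
Local Open Scope ereal_scope.
Variables (R : realType) (gamma : \bar R).
Hypothesis gamma_gt0 : 0 < gamma.
Variables (phi : R -> R) (K u0 : R).
Hypothesis phi_orlicz : orlicz_function phi.
Hypotheses (K_gt0 : (0 < K)%R) (u0_ge0 : (0 <= u0)%R) (u0_eq0 : gamma = +oo -> u0 = 0%R).
Hypothesis D2 : forall u, (u0 <= u)%R -> (phi (2 * u) <= K * phi u)%R.
Variable w : R -> R.
Hypothesis ww : weight gamma w.
Local Notation lebT := (caratheodory_type ((wlength (@idfun R))^*)%mu).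
Local Notation lmeasurable := (((wlength (@idfun R))^*)%mu.-cara.-measurable).
Let cm : {measure set lebT -> \bar R} := @completed_lebesgue_measure R.
Let m := m_gamma gamma.
Let rho := @modular R gamma phi w.
Let W := cumul gamma w.
Implicit Types f : L0 m.

(** The layers are bounded by A below level a, by B between a and b, and vanish
    above b. *)
Lemma modular_two_level f (a b : R) (A B : \bar R) : (0 <= a)%R -> (0 <= b)%R ->
  (forall u, (0 < u)%R -> distribution_fun f u <= A) ->
  (forall u, (0 < u)%R -> (a <= u)%R -> distribution_fun f u <= B) ->
  (forall u, (0 < u)%R -> (b <= u)%R -> distribution_fun f u <= 0) ->
  rho f <= W A * (phi a)%:E + W B * (phi b)%:E.
Proof.
move=> a0 b0 fA fB f0; rewrite /rho (modular_layer_cake phi_orlicz ww).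
pose ind (x : R) (s : R) : R := \1_(`]0%R, (phi x)[%classic : set R) s.
have W0 d : 0 <= W d by exact: (cumul_ge0 ww).
have mind x (c : \bar R) : measurable_fun (`]0%R, +oo[%classic : set R) (fun s => c * (ind x s)%:E).
  apply: emeasurable_funM => //.
  by apply/measurable_EFinP; apply: measurable_indic; exact: measurable_itv.
have ind0 x (c : \bar R) s : 0 <= c -> 0 <= c * (ind x s)%:E.
  by move=> c0; rewrite mule_ge0// lee_fin /ind.
have intE x c : (0 <= x)%R -> 0 <= c ->
    \int[lebesgue_measure]_(s in `]0%R, +oo[) (c * (ind x s)%:E) = c * (phi x)%:E.
  move=> x0 c0; rewrite ge0_integralZl//; last 2 first.
  - by apply/measurable_EFinP; apply: measurable_indic; exact: measurable_itv.
  - by move=> s _; rewrite lee_fin.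
  congr (_ * _); rewrite integral_indic; [|exact: measurable_itv|exact: measurable_itv].
  rewrite setIidl; last by move=> s /=; rewrite !in_itv/= andbT => /andP[].
  rewrite -[LHS]/(lebesgue_measure ([set` `]0%R, (phi x)[] : set R)).
  rewrite lebesgue_measure_itv/= lte_fin.
  have := orlicz_ge0 phi_orlicz x0; rewrite le_eqVlt => /predU1P[<-|->].
    by rewrite ltxx.
  by rewrite sube0.
rewrite -!intE//.
rewrite -ge0_integralD; [|exact: measurable_itv|by move=> *; exact: ind0|
  exact: mind|by move=> *; exact: ind0|exact: mind].
apply: ge0_le_integral => //.
- exact: (measurable_cumul_distr phi_orlicz ww).
- by apply: emeasurable_funD; exact: mind.
move=> s /=; rewrite in_itv/= andbT => s0.
have p0 : (0 < orlicz_inv phi s)%R by exact: orlicz_inv_gt0.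
have indE x : (0 <= x)%R -> ind x s = (orlicz_inv phi s < x)%R%:R.
  move=> x0; rewrite /ind indicE (orlicz_inv_lt phi_orlicz)//.
  by congr (nat_of_bool _)%:R; rewrite mem_setE in_itv/= s0.
rewrite !indE//; have [pa|ap] := ltP (orlicz_inv phi s) a.
  rewrite mule1; apply: (@le_trans _ _ (W A)); first by apply: (cumul_le ww); exact: fA.
  by rewrite leeDl// mule_ge0.
rewrite mule0 add0e; have [pb|bp] := ltP (orlicz_inv phi s) b.
  by rewrite mule1; apply: (cumul_le ww); exact: fB.
by rewrite mule0 (cumul0 _ _ (f0 _ p0 bp)).
Qed.

(** In the case of infinite gamma the additive constant of Delta_2 must vanish,
    and it does, since then the threshold u0 is 0. *)
Lemma modular_double_lty f : rho f < +oo -> rho (2%R *: f) < +oo.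
Proof.
move=> rf; have two0 : (0 < 2 :> R)%R by [].
have := modular_scale_le phi_orlicz ww (f := f) (g := (2 *: f)%R) K_gt0 _ two0
  (Delta2_double phi_orlicz K_gt0 u0_ge0 D2) _.
move=> /(_ _ _)/le_lt_trans; apply.
- by apply: (orlicz_ge0 phi_orlicz); rewrite mulr_ge0.
- by move=> u u_gt0; exact: distributionZ.
apply: lte_add_pinfty.
  have rfin : modular phi w f \is a fin_num.
    by rewrite ge0_fin_numE// (modular_ge0 phi_orlicz ww).
  by rewrite -(fineK rfin) -EFinM ltry.
have [goo|gfin] := eqVneq gamma +oo.
  by rewrite u0_eq0// mulr0 (orlicz0 phi_orlicz) mul0e ltry.
have Wg : cumul gamma w gamma \is a fin_num.
  by apply: (cumul_fin_num gamma_gt0 ww); rewrite ltey.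
by rewrite -(fineK Wg) -EFinM ltry.
Qed.

Lemma modular_lty f (k : R) : orlicz_lorentz phi w f -> (0 < k)%R -> rho (k *: f) < +oo.
Proof.
move=> [l l0 lf] k0.
have iter i : rho ((2 ^+ i * l)%R *: f) < +oo.
  elim: i => [|i IH]; first by rewrite expr0 mul1r.
  by rewrite exprS -mulrA -scalerA; exact: modular_double_lty.
have [i ki] : exists i : nat, (k <= 2 ^+ i * l)%R.
  exists (Num.truncn (k / l)).+1; rewrite -ler_pdivrMr//.
  apply: (le_trans (ltW (truncnS_gt _))).
  by rewrite -natrX ler_nat ltnW// ltn_expl.
apply: le_lt_trans (iter i); apply: (modular_mono phi_orlicz ww).
by rewrite k0.
Qed.

(** Here the divergence of the integral of w is used when gamma is infinite. *)
Lemma distribution_lty f u : rho f < +oo -> (0 < u)%R -> distribution_fun f u < +oo.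
Proof.
move=> rf u_gt0; have [goo|gfin] := eqVneq gamma +oo; last first.
  by rewrite distribution_funE; apply: distr_fin_gamma; rewrite ltey.
rewrite ltey; apply/eqP => Doo; move: rf; apply/negP; rewrite -leNgt.
have := modular_ge phi_orlicz ww (f := f) (ltW u_gt0) (d := +oo).
rewrite (cumul_infty ww goo) gt0_mulye ?lte_fin ?(orlicz_gt0 phi_orlicz)//; apply.
move=> v v0 vu; rewrite -Doo !distribution_funE; apply: distr_ni; exact: ltW.
Qed.

(** Cuts off both the domain and the large values; setting large values to 0
    instead of M makes the remainder vanish where the truncation is not 0. *)
Definition truncate (h : R -> R) (M : nat) (t : R) : R :=
  if ((0 <= t) && (t < M%:R) && (`|h t| <= M%:R))%R then h t else 0%R.

Let core (h : {mfun lebT >-> R}) (M : nat) : set lebT :=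
  `[0%R, M%:R[%classic `&` [set t | `|h t| <= M%:R]%R.

Let measurable_core (h : {mfun lebT >-> R}) (M : nat) : lmeasurable (core h M).
Proof.
apply: measurableI; first exact: lebmeasurable_itv.
have mh : measurable_fun [set: lebT] (fun t => `|h t|%R) by exact: measurableT_comp.
have := mh measurableT _ (measurable_itv `]-oo, M%:R]); rewrite setTI.
by congr (lmeasurable _); apply/seteqP; split=> t; rewrite /= in_itv.
Qed.

Lemma measurable_truncate (h : {mfun lebT >-> R}) M :
  measurable_fun [set: lebT] (truncate h M).
Proof.
rewrite (_ : truncate h M = (h \_ (core h M))).
  have mh : measurable_fun [set: lebT] h by exact: measurable_funPT.
  exact: (measurable_restrictT h (measurable_core h M)).1 (measurable_funTS mh).
apply/funext => t; rewrite /truncate patchE; congr (if _ then _ else _).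
apply/idP/idP => [/andP[H1 H2]|/set_mem[/=]]; last by rewrite in_itv/= => -> ->.
by apply/mem_set; split => //=; rewrite in_itv.
Qed.

Definition truncateL0 f M : L0 m := class_of m (mk_mfun (measurable_truncate (Defs.repr_of f) M)).

Lemma repr_truncate f M : {ae m, forall t,
  Defs.repr_of (truncateL0 f M) t = truncate (Defs.repr_of f) M t}.
Proof.
have := repr_class_of m (mk_mfun (measurable_truncate (Defs.repr_of f) M)).
by apply: filterS => t /(_ I).
Qed.

(** The sets where k |f| > u and f is cut off have finite measure and decrease
    to the empty set, so the integrands of the layer cake formula tend to 0;
    they are dominated by those of k f, whose integral is finite by Delta_2.
    Dominated convergence concludes. *)
Lemma modular_truncate f (k : R) : orlicz_lorentz phi w f -> (0 < k)%R ->
  exists M : nat, rho (k *: (truncateL0 f M - f)%R) <= 1.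
Proof.
move=> Xf k0; set h := Defs.repr_of f.
pose T := core h; have mT := measurable_core h.
(* The set where k |f - truncation| can exceed u. *)
pose S u M : set lebT := superlevel gamma h (k^-1 * u) `\` T M.
have mS u M : lmeasurable (S u M) by apply: measurableD => //; exact: measurable_superlevel.
have DS M u : (0 < u)%R -> distribution_fun (k *: (truncateL0 f M - f)%R) u <= cm (S u M).
  move=> u_gt0; have ae1 := repr_ofZ k (truncateL0 f M - f)%R.
  have ae2 := repr_ofD (truncateL0 f M) (- f)%R.
  have ae3 := repr_ofZ (-1)%R f; rewrite scaleN1r in ae3.
  have ae4 := repr_truncate f M.
  apply: (distribution_le_ae (mS u M) (filterI (filterI ae1 ae2) (filterI ae3 ae4))).
  move=> t It [[/= -> ->] [-> ->]]; rewrite mulN1r /truncate -/h normrM (gtr0_norm k0).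
  case: ifPn => [_|nT]; first by rewrite subrr normr0 mulr0 ltNge ltW.
  rewrite sub0r normrN -ltr_pdivrMl// => ut; split; first by split.
  move=> [/=]; rewrite in_itv/= => H1 H2; move: nT; by rewrite H1 H2.
have Dfin u : (0 < u)%R -> distr gamma h (k^-1 * u) < +oo.
  move=> u_gt0; have rf := modular_lty Xf k0.
  rewrite -distribution_funE; apply: le_lt_trans (distribution_lty rf u_gt0).
  have := @distributionZ R gamma k^-1 (k *: f) u.
  by rewrite scalerA mulVf ?gt_eqF// scale1r invr_gt0; exact.
have S0 u : (0 < u)%R -> cm (S u M) @[M --> \oo] --> 0.
  move=> u_gt0.
  have -> : 0 = cm (\bigcap_M S u M).
    rewrite (_ : \bigcap_M S u M = set0) ?measure0// -subset0 => t tS.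
    have [[[t0 _] _] _] := tS 0%N I.
    have [_] := tS (Num.truncn (Num.max t `|h t|)%R).+1 I; apply; split => /=.
      by rewrite in_itv/= t0/= (le_lt_trans _ (truncnS_gt _))// le_max lexx.
    by rewrite (le_trans _ (ltW (truncnS_gt _)))// le_max lexx orbT.
  apply: nonincreasing_cvg_mu.
  - apply: le_lt_trans (Dfin u u_gt0); apply: le_measure; rewrite ?inE => //.
      exact: measurable_superlevel.
    by move=> t [].
  - by move=> M; exact: mS.
  - by apply: bigcapT_measurable => M; exact: mS.
  - move=> M N MN; apply/subsetPset => t [lt nT]; split=> // -[/=].
    rewrite in_itv/= => /andP[t0 tM] hM; apply: nT; split => /=.
      by rewrite in_itv/= t0 (lt_le_trans tM)// ler_nat.
    by rewrite (le_trans hM)// ler_nat.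
pose P : set R := `]0%R, +oo[%classic.
pose F M s := W (distribution_fun (k *: (truncateL0 f M - f)%R) (orlicz_inv phi s)).
pose G s := W (distribution_fun (k *: f) (orlicz_inv phi s)).
have W0 d : 0 <= W d by exact: (cumul_ge0 ww).
have mG : measurable_fun P G by exact: (measurable_cumul_distr phi_orlicz ww).
have psi0 s : P s -> (0 < orlicz_inv phi s)%R.
  by rewrite /P/= in_itv/= andbT => s0; exact: orlicz_inv_gt0.
have iG : (@lebesgue_measure R).-integrable P G.
  apply/integrableP; split => //.
  rewrite (_ : (fun x => `|G x|) = G); last by apply/funext => s; rewrite gee0_abs//; exact: W0.
  by rewrite -(modular_layer_cake phi_orlicz ww); exact: modular_lty.
have FG M s : P s -> F M s <= G s.
  move=> /psi0 ps; apply: (cumul_le ww); apply: le_trans (DS M _ ps) _.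
  apply: (@le_trans _ _ (distribution_fun f (k^-1 * orlicz_inv phi s))).
    apply: le_measure; rewrite ?inE => //; first exact: measurable_superlevel.
    by move=> t [].
  have := @distributionZ R gamma k^-1 (k *: f) (orlicz_inv phi s).
  by rewrite scalerA mulVf ?gt_eqF// scale1r invr_gt0; exact.
have F0 s : P s -> F M s @[M --> \oo] --> 0.
  move=> /psi0 ps.
  have Fe (e : R) : (0 < e)%R -> \forall M \near \oo, F M s <= e%:E.
    move=> e0; have [d d0 Wd] := cumul_small gamma_gt0 ww e0.
    have d0' : 0 < d%:E by rewrite lte_fin.
    have near_d : \forall M \near \oo, cm (S (orlicz_inv phi s) M) < d%:E.
      exact: S0 _ ps _ (open_ereal_lt' d0').
    apply: filterS near_d => M Sd; apply: le_trans Wd; apply: (cumul_le ww).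
    by apply: (le_trans (DS M (orlicz_inv phi s) ps)); exact: ltW.
  apply/fine_cvgP; split.
    have := Fe 1%R ltr01; apply: filterS => M F1.
    by rewrite ge0_fin_numE ?W0// (le_lt_trans F1)// ltry.
  apply/cvgr0Pnorm_le => e e0; have := Fe e e0; apply: filterS => M Fe'.
  have Ff : F M s \is a fin_num by rewrite ge0_fin_numE ?W0// (le_lt_trans Fe')// ltry.
  by rewrite /= ger0_norm ?fine_ge0 ?W0// -lee_fin fineK.
have mP : measurable (P : set (measurableTypeR R)) by exact: measurable_itv.
have mF M : measurable_fun P (F M) by exact: (measurable_cumul_distr phi_orlicz ww).
have FG' M s : P s -> `|F M s| <= G s.
  have -> : `|F M s| = F M s by exact: (gee0_abs (W0 _)).
  exact: FG.
have m0 : measurable_fun P (cst 0 : R -> \bar R) by exact: measurable_cst.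
have aeF0 : {ae (@lebesgue_measure R), forall s, P s -> F M s @[M --> \oo] --> (cst 0 s : \bar R)}.
  by apply: aeW => s Ps; exact: F0.
have aeFG : {ae (@lebesgue_measure R), forall s, forall M, P s -> `|F M s| <= G s}.
  by apply: aeW => s M Ps; exact: FG'.
have [_ _ C] := dominated_convergence mP mF m0 aeF0 iG aeFG.
have z01 : \int[lebesgue_measure]_(x in P) (cst 0 x) < 1 :> \bar R by rewrite integral0.
have [M _ /(_ M (leqnn M)) /= HM] := C _ (open_ereal_lt' z01).
by exists M; rewrite /rho (modular_layer_cake phi_orlicz ww); exact: ltW.
Qed.

End order_continuity.

(** * Approximation of measurable sets by rational intervals *)

Section rational_approximation.
Local Open Scope ereal_scope.
Variable R : realType.
Local Notation lebT := (caratheodory_type ((wlength (@idfun R))^*)%mu).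
Local Notation lmeasurable := (((wlength (@idfun R))^*)%mu.-cara.-measurable).
Let cm : {measure set lebT -> \bar R} := @completed_lebesgue_measure R.
Implicit Types (E : set lebT) (l : seq (rat * rat)).

Definition rat_union l : set lebT :=
  [set t | has (fun p => (ratr p.1 < t :> R) && (t <= ratr p.2 :> R))%R l].

Definition sym_diff E (F : set lebT) : set lebT := (E `\` F) `|` (F `\` E).

Definition approximable E := forall e : R, (0 < e)%R ->
  exists l, cm (sym_diff E (rat_union l)) <= e%:E.

Lemma measurable_rat_union l : lmeasurable (rat_union l).
Proof.
elim: l => [|p l IH].
  by rewrite (_ : rat_union [::] = set0); [exact: measurable0|apply/seteqP; split].
rewrite (_ : rat_union (p :: l) = `]ratr p.1, ratr p.2]%classic `|` rat_union l).
  by apply: measurableU => //; exact: lebmeasurable_itv.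
apply/seteqP; split => t; rewrite /rat_union/= in_itv/= => /orP; exact.
Qed.

Lemma measurable_sym_diff E F : lmeasurable E -> lmeasurable F -> lmeasurable (sym_diff E F).
Proof. by move=> mE mF; apply: measurableU; apply: measurableD. Qed.

Lemma sym_diff_sub E F G : sym_diff E G `<=` sym_diff E F `|` sym_diff F G.
Proof.
move=> t [[Et Gt]|[Gt Et]]; have [Ft|Ft] := pselect (F t).
- by right; left.
- by left; left.
- by left; right.
- by right; right.
Qed.

Lemma measure_oc (a b : R) : (a <= b)%R -> cm `]a, b]%classic = (b - a)%:E.
Proof.
move=> ab; rewrite -[LHS]/(lebesgue_measure ([set` `]a, b]] : set R)).
rewrite lebesgue_measure_itv/= lte_fin; move: ab; rewrite le_eqVlt.
by move=> /predU1P[->|->]; rewrite ?ltxx ?subrr.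
Qed.

Lemma approximable_oc (a b : R) : approximable `]a, b]%classic.
Proof.
move=> e e0.
have e2 : (0 < e / 2)%R by rewrite divr_gt0.
have [p /[!in_itv]/= /andP[ap pa]] : exists q, ratr q \in `]a, (a + e / 2)%R[.
  by apply: rat_in_itvoo; rewrite ltrDl.
have [q /[!in_itv]/= /andP[bq qb]] : exists q, ratr q \in `]b, (b + e / 2)%R[.
  by apply: rat_in_itvoo; rewrite ltrDl.
exists [:: (p, q)].
apply: (@le_trans _ _ (cm (`]a, (ratr p)]%classic `|` `]b, (ratr q)]%classic))).
  apply: le_measure; rewrite ?inE.
  - apply: measurable_sym_diff; first exact: lebmeasurable_itv.
    exact: measurable_rat_union.
  - by apply: measurableU; exact: lebmeasurable_itv.
  move=> t; rewrite /sym_diff /rat_union /= orbF !in_itv/=.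
  move=> [[/andP[at_ tb] /negP]|[/andP[pt tq] /negP]].
    rewrite negb_and -!leNgt => /orP[tp|]; first by left; rewrite at_ tp.
    by rewrite -ltNge => qt; have := lt_trans (le_lt_trans tb bq) qt; rewrite ltxx.
  rewrite negb_and -!leNgt -ltNge => /orP[ta|bt]; last by right; rewrite bt tq.
  by have := lt_le_trans (lt_trans ap pt) ta; rewrite ltxx.
apply: (@le_trans _ _ (cm `]a, (ratr p)]%classic + cm `]b, (ratr q)]%classic)).
  by apply: (measureU2 cm); exact: lebmeasurable_itv.
rewrite !measure_oc ?(ltW ap) ?(ltW bq)// -EFinD lee_fin.
by rewrite [leRHS](splitr e) lerD// lerBlDl ltW.
Qed.

Lemma approximableU E F : lmeasurable E -> lmeasurable F ->
  approximable E -> approximable F -> approximable (E `|` F).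
Proof.
move=> mE mF aE aF e e0; have e2 : (0 < e / 2)%R by rewrite divr_gt0.
have [l1 h1] := aE _ e2; have [l2 h2] := aF _ e2; exists (l1 ++ l2).
have m1 := measurable_sym_diff mE (measurable_rat_union l1).
have m2 := measurable_sym_diff mF (measurable_rat_union l2).
apply: (@le_trans _ _ (cm (sym_diff E (rat_union l1) `|` sym_diff F (rat_union l2)))).
  apply: le_measure; rewrite ?inE.
  - by apply: measurable_sym_diff; [exact: measurableU|exact: measurable_rat_union].
  - exact: measurableU.
  move=> t; rewrite /sym_diff /rat_union/= has_cat.
  by move=> [[[Et|Ft] /negP /norP[/negP n1 /negP n2]]|[/orP[n1|n2] /not_orP[nE nF]]];
    [left; left|right; left|left; right|right; right].
apply: (le_trans (measureU2 cm m1 m2)).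
by rewrite (splitr e) EFinD leeD.
Qed.

Lemma approximable_lim E : lmeasurable E ->
  (forall e : R, (0 < e)%R -> exists F, [/\ lmeasurable F, approximable F &
     cm (sym_diff E F) <= e%:E]) -> approximable E.
Proof.
move=> mE h e e0; have e2 : (0 < e / 2)%R by rewrite divr_gt0.
have [F [mF aF EF]] := h _ e2; have [l Fl] := aF _ e2; exists l.
have m1 := measurable_sym_diff mE mF.
have m2 := measurable_sym_diff mF (measurable_rat_union l).
apply: (@le_trans _ _ (cm (sym_diff E F `|` sym_diff F (rat_union l)))).
  apply: le_measure; rewrite ?inE; last exact: sym_diff_sub.
    by apply: measurable_sym_diff => //; exact: measurable_rat_union.
  exact: measurableU.
apply: (le_trans (measureU2 cm m1 m2)).
by rewrite (splitr e) EFinD leeD.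
Qed.

(** A set of finite outer measure is covered, up to e/2, by countably many
    half-open intervals; all but finitely many of them can be dropped, and the
    end points of the others can be made rational. *)
Lemma approximable_fin E : lmeasurable E -> cm E < +oo -> approximable E.
Proof.
move=> mE Eoo; apply: approximable_lim => // e e0.
have e2 : (0 < e / 2)%R by rewrite divr_gt0.
have cEfin : cm E \is a fin_num by rewrite ge0_fin_numE.
have [A EA Acov] : exists2 A, @measurable_cover _ (ocitv_type R) E A &
    \sum_(0 <= k <oo) (wlength (@idfun R) (A k)) < cm E + (e / 2)%R%:E.
  have := cEfin; move/lb_ereal_inf_adherent => /(_ _ e2)[_/= [A EA] <-] ?.
  by exists A.
have [mA EsubA] := EA.
have oc k : exists ab : R * R, A k = `]ab.1, ab.2]%classic.
  by have := mA k; move=> [ab _ <-]; exists ab.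
have lmA k : lmeasurable (A k).
  by have [ab ->] := oc k; exact: lebmeasurable_itv.
have cmA k : cm (A k) = wlength (@idfun R) (A k).
  by rewrite -((measurable_mu_extE (wlength (@idfun R))) (A k)).
pose T : set lebT := \bigcup_k A k.
have mT : lmeasurable T by apply: bigcupT_measurable.
have cmT : cm T < cm E + (e / 2)%R%:E.
  apply: le_lt_trans Acov.
  under eq_eseriesr do rewrite -cmA.
  by apply: (measure_sigma_subadditive cm).
have Tfin : cm T < +oo.
  by apply: (lt_trans cmT); rewrite -(fineK cEfin) -EFinD ltry.
pose F N : set lebT := \big[setU/set0]_(k < N) A k.
have mF N : lmeasurable (F N) by apply: bigsetU_measurable.
have FE N t : F N t <-> exists2 k, (k < N)%N & A k t.
  rewrite /F -bigcup_mkord; split => [[k kN Akt]|[k kN Akt]]; by exists k.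
have C : cm (T `\` F N) @[N --> \oo] --> 0.
  have -> : 0 = cm (\bigcap_N (T `\` F N)).
    rewrite (_ : \bigcap_N _ = set0) ?measure0// -subset0 => t tT.
    have [[k _ Akt] _] := tT 0%N I.
    by have [_] := tT k.+1 I; apply; apply/FE; exists k.
  apply: nonincreasing_cvg_mu.
  - apply: le_lt_trans Tfin; apply: le_measure; rewrite ?inE//; first exact: measurableD.
  - by move=> N; exact: (measurableD mT (mF N)).
  - by apply: bigcapT_measurable => N; exact: (measurableD mT (mF N)).
  - move=> N M NM; apply/subsetPset => t [Tt nF]; split=> // /FE[k kN Akt].
    by apply: nF; apply/FE; exists k => //; exact: leq_trans kN NM.
have e2' : 0 < (e / 2)%R%:E by rewrite lte_fin.
have [N _ /(_ N (leqnn N)) /= HN] := C _ (open_ereal_lt' e2').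
exists (F N); split => //.
  elim: N {HN} => [|N IH].
    rewrite /F big_ord0 => e' e'0; exists [::].
    rewrite (_ : sym_diff _ _ = set0) ?measure0 ?lee_fin ?ltW//.
    by rewrite -subset0 => t [[]|[]].
  rewrite /F big_ord_recr/=; apply: approximableU => //; first exact: mF.
  by have [ab ->] := oc N; exact: approximable_oc.
have cmTE : cm (T `\` E) <= (e / 2)%R%:E.
  have -> : cm (T `\` E) = cm T - cm (T `&` E) by exact: measureD.
  have -> : T `&` E = E by apply: setIidr.
  by rewrite leeBlDl// ltW.
apply: (@le_trans _ _ (cm ((T `\` F N) `|` (T `\` E)))).
  apply: le_measure; rewrite ?inE.
  - exact: measurable_sym_diff.
  - by apply: measurableU; exact: measurableD.
  move=> t [[Et nF]|[Ft nE]]; first by left; split=> //; exact: EsubA.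
  by right; split=> //; move/FE : Ft => [k _ Akt]; exists k.
apply: (le_trans (measureU2 cm _ _)); [exact: measurableD|exact: measurableD|].
by rewrite (splitr e) EFinD leeD// ltW.
Qed.

End rational_approximation.

(** * Step functions with rational data *)

Section step_functions.
Local Open Scope ereal_scope.
Variable R : realType.
Local Notation lebT := (caratheodory_type ((wlength (@idfun R))^*)%mu).
Local Notation lmeasurable := (((wlength (@idfun R))^*)%mu.-cara.-measurable).
Let cm : {measure set lebT -> \bar R} := @completed_lebesgue_measure R.

Definition rat_step (L : seq (rat * seq (rat * rat))) (t : lebT) : R :=
  (\sum_(p <- L) ratr p.1 * \1_(@rat_union R p.2) t)%R.

Lemma measurable_rat_step L : measurable_fun [set: lebT] (rat_step L).
Proof.
apply: measurable_sum => p; apply: measurable_funM => //.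
by apply: measurable_indic; exact: measurable_rat_union.
Qed.

Lemma rat_step_cons p L t :
  rat_step (p :: L) t = (ratr p.1 * \1_(@rat_union R p.2) t + rat_step L t)%R.
Proof. by rewrite /rat_step big_cons. Qed.

Definition far_set (M : nat) (g h : lebT -> R) (d : R) : set lebT :=
  `[0%R, M%:R[%classic `&` [set t | d < `|g t - h t|]%R.

Lemma measurable_far_set M (g h : lebT -> R) d : measurable_fun [set: lebT] g ->
  measurable_fun [set: lebT] h -> lmeasurable (far_set M g h d).
Proof.
move=> mg mh; apply: measurableI; first exact: lebmeasurable_itv.
have mgh : measurable_fun [set: lebT] (fun t => `|g t - h t|%R).
  apply: (measurableT_comp (@normr_measurable R setT)); exact: measurable_funB.
have := mgh measurableT _ (measurable_itv `]d, +oo[); rewrite setTI.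
by congr (lmeasurable _); apply/seteqP; split=> t; rewrite /= in_itv/= andbT.
Qed.

(** Induction on the binary digits of g / B: with S the set where g >= B / 2, the
    function g - (B/2) 1_S takes values in [0, B/2], and 1_S is approximated by a
    finite union of rational intervals off a small set. *)
Lemma rat_step_approx M j : forall (B : rat) (g : lebT -> R),
  measurable_fun [set: lebT] g ->
  (forall t, t \in `[0%R, M%:R[ -> 0 <= g t <= ratr B)%R ->
  forall e : R, (0 < e)%R ->
  exists L, cm (far_set M g (rat_step L) (ratr B / 2 ^+ j)%R) <= e%:E.
Proof.
elim: j => [|j IH] B g mg gB e e0.
  exists [::]; rewrite (_ : far_set _ _ _ _ = set0) ?measure0 ?lee_fin ?ltW//.
  rewrite -subset0 => t [/gB/andP[g0 gb]]/=.
  by rewrite expr0 divr1 /rat_step big_nil subr0 ger0_norm// ltNge gb.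
have e2 : (0 < e / 2)%R by rewrite divr_gt0.
pose bh : rat := (B / 2)%R; pose b : R := ratr bh; have bE : b = (ratr B / 2)%R.
  by rewrite /b /bh fmorph_div/= ratr_nat.
pose S : set lebT := `[0%R, M%:R[%classic `&` [set t | b <= g t]%R.
have mS : lmeasurable S.
  apply: measurableI; first exact: lebmeasurable_itv.
  have := mg measurableT _ (measurable_itv `[b, +oo[); rewrite setTI.
  by congr (lmeasurable _); apply/seteqP; split=> t; rewrite /= in_itv/= andbT.
have Sfin : cm S < +oo.
  apply: (@le_lt_trans _ _ (cm `[0%R, M%:R[%classic)).
    by apply: le_measure; rewrite ?inE; [exact: mS|exact: lebmeasurable_itv|exact: subIsetl].
  rewrite -[X in X < _]/(lebesgue_measure ([set` `[0%R, M%:R[] : set R)).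
  by rewrite lebesgue_measure_itv/=; case: ifPn => _; rewrite ?sube0 ltry.
pose g' (t : lebT) : R := (g t - b * \1_S t)%R.
have mg' : measurable_fun [set: lebT] g'.
  apply: measurable_funB; first exact: mg.
  by apply: measurable_funM; [exact: measurable_cst|exact: measurable_indic].
have g'B t : t \in `[0%R, M%:R[ -> (0 <= g' t <= ratr bh)%R.
  move=> tM; have /andP[g0 gb] := gB t tM; rewrite /g' indicE -/b.
  have [St|St] := boolP (t \in S).
    move: St; rewrite inE => -[_ /= bg]; rewrite mulr1 subr_ge0 bg/= lerBlDr.
    by move: gb; rewrite bE; lra.
  rewrite mulr0 subr0 g0/= leNgt; apply/negP => bg.
  by move: St; rewrite notin_setE; apply; split => //; exact: ltW.
have [L HL] := IH _ _ mg' g'B _ e2.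
have [l Hl] := approximable_fin mS Sfin e2.
exists ((bh, l) :: L).
have mL := measurable_rat_step L; have mU := @measurable_rat_union R l.
apply: (@le_trans _ _ (cm (far_set M g' (rat_step L) (ratr bh / 2 ^+ j)%R `|`
    sym_diff S (rat_union l)))).
  have mD := measurable_sym_diff mS mU.
  have mb := measurable_far_set M (ratr bh / 2 ^+ j)%R mg' mL.
  apply: le_measure; rewrite ?inE.
  - by apply: measurable_far_set => //; exact: measurable_rat_step.
  - exact: measurableU.
  move=> t [tM /=]; rewrite rat_step_cons/= -/b => gt.
  have [SU|nSU] := pselect (sym_diff S (rat_union l) t); first by right.
  left; split => //=; rewrite /g'.
  have -> : (\1_S t = \1_(@rat_union R l) t :> R)%R.
    rewrite !indicE; congr (nat_of_bool _)%:R; apply/idP/idP => /set_mem h; apply/mem_set;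
      apply: contrapT => h'; apply: nSU; [by left|by right].
  move: gt; rewrite opprD addrA -/b bE exprS invfM mulrA.
  by rewrite -bE.
have mD := measurable_sym_diff mS mU.
have mb := measurable_far_set M (ratr bh / 2 ^+ j)%R mg' mL.
apply: (le_trans (measureU2 cm mb mD)).
by rewrite (splitr e) EFinD leeD.
Qed.

(** A countable type: rational coefficients with finite unions of rational
    intervals, and a number M that bounds both the support and the values. *)
Definition step_code : Type := (seq (rat * seq (rat * rat)) * nat)%type.

Definition clamp (M x : R) : R := Num.min (Num.max x 0%R) M.

Lemma clamp_id M x : (0 <= x <= M)%R -> clamp M x = x.
Proof. by move=> /andP[x0 xM]; rewrite /clamp (max_idPl x0) (min_idPl xM). Qed.

Lemma clamp_ge0 M x : (0 <= M)%R -> (0 <= clamp M x <= M)%R.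
Proof. by move=> M0; rewrite /clamp le_min le_max lexx orbT M0/= ge_min lexx orbT. Qed.

Lemma clamp_lip M x y : (`|clamp M x - clamp M y| <= `|x - y|)%R.
Proof.
have h1 := ler_norm (x - y)%R; have h2 := ler_norm (y - x)%R.
rewrite distrC in h2; rewrite ler_norml /clamp.
move: h1 h2; set D := `|x - y|%R => h1 h2.
rewrite !minElt !maxElt; apply/andP.
have [hx|hx] := ltP x 0%R; have [hy|hy] := ltP y 0%R;
  do 2 (case: ltP => ?); split; lra.
Qed.

(** The clamping gives a uniform bound also on the small set where the rational
    step function is a poor approximation; the shift by M serves to approximate a
    nonnegative function first. *)
Definition step_fun (c : step_code) (t : lebT) : R :=
  if (t \in `[0%R, c.2%:R[)%R then (clamp (2 * c.2%:R) (rat_step c.1 t) - c.2%:R)%R else 0%R.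

Lemma measurable_step_fun c : measurable_fun [set: lebT] (step_fun c).
Proof.
have -> : step_fun c = (fun t => clamp (2 * c.2%:R) (rat_step c.1 t) - c.2%:R)%R
    \_ (`[0%R, c.2%:R[%classic).
  by apply/funext => t; rewrite patchE mem_setE.
have mI : lmeasurable `[0%R, c.2%:R[%classic by exact: lebmeasurable_itv.
have m1 : measurable_fun [set: lebT] (fun t => clamp (2 * c.2%:R) (rat_step c.1 t) - c.2%:R)%R.
  apply: measurable_funB; last exact: measurable_cst.
  apply: measurable_minr; last exact: measurable_cst.
  by apply: measurable_maxr; [exact: measurable_rat_step|exact: measurable_cst].
exact: (measurable_restrictT _ mI).1 (measurable_funTS m1).
Qed.

Lemma step_fun_bound c t : (`|step_fun c t| <= c.2%:R)%R.
Proof.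
rewrite /step_fun; case: ifP => _; last by rewrite normr0.
have /andP[h1 h2] := @clamp_ge0 (2 * c.2%:R)%R (rat_step c.1 t) (mulr_ge0 (ler0n _ _) (ler0n _ _)).
by rewrite ler_norml; apply/andP; split; lra.
Qed.

End step_functions.

Lemma quarter_chasles (R : realType) (V : lmodType R) (e : R) (x y z : V) :
  4^-1 *: ((4 * e^-1) *: (x - y) + (4 * e^-1) *: (y - z)) = e^-1 *: (x - z).
Proof. by rewrite -scalerDr addrA subrK scalerA mulrA mulVf// mul1r. Qed.

Section step_density.
Local Open Scope ereal_scope.
Variables (R : realType) (gamma : \bar R).
Hypothesis gamma_gt0 : 0 < gamma.
Variables (phi : R -> R).
Hypothesis phi_orlicz : orlicz_function phi.
Local Notation lebT := (caratheodory_type ((wlength (@idfun R))^*)%mu).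
Let cm : {measure set lebT -> \bar R} := @completed_lebesgue_measure R.
Let m := m_gamma gamma.

Definition stepL0 (c : step_code) : L0 m := class_of m (mk_mfun (@measurable_step_fun R c)).

Lemma repr_stepL0 c : {ae m, forall t, Defs.repr_of (stepL0 c) t = step_fun c t}.
Proof.
have := repr_class_of m (mk_mfun (@measurable_step_fun R c)).
by apply: filterS => t /(_ I).
Qed.

Lemma measure_co (M : nat) : cm `[0%R, M%:R[%classic = M%:R%:E.
Proof.
rewrite -[LHS]/(lebesgue_measure ([set` `[0%R, M%:R[] : set R)).
rewrite lebesgue_measure_itv/= lte_fin; case: ltP => h; first by rewrite sube0.
by congr EFin; apply/eqP; rewrite eq_le h ler0n.
Qed.

Lemma le0_distribution (f : L0 m) u (P : set lebT) : {ae m, forall t, P t} ->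
  (forall t, P t -> `|Defs.repr_of f t| <= u)%R -> distribution_fun f u <= 0.
Proof.
move=> aeP fu; apply: (@le_trans _ _ (cm set0)); last by rewrite measure0.
apply: (distribution_le_ae _ aeP) => // t _ /fu; by rewrite ltNge => ->.
Qed.

(** Step functions are bounded with bounded support, so they belong to the space
    of every weight; the dense sequence is thus found in the union of the X_n. *)
Lemma stepL0_in c v : weight gamma v -> orlicz_lorentz phi v (stepL0 c).
Proof.
move=> wv; exists 1%R => //; rewrite scale1r.
have M0 : (0 <= c.2%:R :> R)%R by [].
have fA u : (0 < u)%R -> distribution_fun (stepL0 c) u <= c.2%:R%:E.
  move=> u0; rewrite -measure_co.
  apply: (distribution_le_ae _ (repr_stepL0 c)); first exact: lebmeasurable_itv.
  move=> t _ ->; rewrite /step_fun; case: ifP => [//|_].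
  by rewrite normr0 ltNge ltW.
apply: (le_lt_trans (modular_two_level phi_orlicz wv M0 M0 fA (fun u u0 _ => fA u u0) _)).
  move=> u u0 Mu; apply: (le0_distribution (repr_stepL0 c)) => t ->.
  exact: le_trans (step_fun_bound _ _) Mu.
have Wfin : cumul gamma v c.2%:R%:E \is a fin_num.
  by apply: (cumul_fin_num gamma_gt0 wv); exact: ltry.
by rewrite -(fineK Wfin) -!EFinM -EFinD ltry.
Qed.

Variables (K u0 : R).
Hypotheses (K_gt0 : (0 < K)%R) (u0_ge0 : (0 <= u0)%R) (u0_eq0 : gamma = +oo -> u0 = 0%R).
Hypothesis D2 : forall u, (u0 <= u)%R -> (phi (2 * u) <= K * phi u)%R.
Variable w : R -> R.
Hypothesis ww : weight gamma w.
Let rho := @modular R gamma phi w.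
Let W := cumul gamma w.

(** The difference has modular at most W(M) phi(small) + W(small) phi(2 k M): it
    is small off a set of small measure and bounded by 2 M everywhere. *)
Lemma step_near_truncate (f : L0 m) M k : (0 < k)%R ->
  exists c : step_code, rho (k *: (stepL0 c - truncateL0 f M)%R) <= 1.
Proof.
move=> k0; set h := Defs.repr_of f.
have M0 : (0 <= M%:R :> R)%R by [].
pose b : R := (k * (2 * M%:R))%R.
have b0 : (0 <= b)%R by rewrite mulr_ge0 ?(ltW k0)// mulr_ge0.
have WM : W M%:R%:E = (fine (W M%:R%:E))%:E.
  by rewrite fineK//; apply: (cumul_fin_num gamma_gt0 ww); exact: ltry.
set WMr := fine _ in WM.
have WMr0 : (0 <= WMr)%R by rewrite -lee_fin -WM (cumul_ge0 ww).
have p1 : (0 < phi 1)%R by exact: orlicz_gt0.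
(* l makes W(M) phi(l) <= l W(M) phi(1) <= 1/2; j makes the uniform error at
   most l after scaling by k; d makes W(d) phi(2 k M) <= 1/2. *)
pose l : R := ((2 * (1 + WMr * phi 1))^-1)%R.
have den0 : (0 < 1 + WMr * phi 1)%R by rewrite ltr_pwDl// mulr_ge0// ltW.
have l0 : (0 < l)%R by rewrite invr_gt0 mulr_gt0.
have l1 : (l <= 1)%R.
  rewrite invf_le1 ?mulr_gt0//.
  by have := mulr_ge0 WMr0 (ltW p1); lra.
have [j jl] : exists j : nat, (k * (2 * M%:R / 2 ^+ j) <= l)%R.
  exists (Num.truncn (b / l)).+1.
  rewrite mulrA ler_pdivrMr ?exprn_gt0// [leRHS]mulrC -ler_pdivrMr// -/b.
  by apply: (le_trans (ltW (truncnS_gt _))); rewrite -natrX ler_nat ltnW// ltn_expl.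
set tau := (2 * M%:R / 2 ^+ j)%R in jl.
have tau0 : (0 <= tau)%R by rewrite divr_ge0 ?exprn_ge0// mulr_ge0.
have pb0 : (0 <= phi b)%R by exact: orlicz_ge0.
have e0 : (0 < (2 * (1 + phi b))^-1)%R by rewrite invr_gt0 mulr_gt0// ltr_pwDl.
have [d d0 Wd] := cumul_small gamma_gt0 ww e0.
pose g (t : lebT) : R := (truncate h M t + M%:R)%R.
have mg : measurable_fun [set: lebT] g.
  by apply: measurable_funD; [exact: measurable_truncate|exact: measurable_cst].
have gB t : (t \in `[0%R, M%:R[ -> 0 <= g t <= ratr (2 * M)%:R)%R.
  move=> _; rewrite /g ratr_nat natrM /truncate.
  case: ifPn => [/andP[_]|_]; last by rewrite add0r M0/=; lra.
  by rewrite ler_norml => /andP[h1 h2]; apply/andP; split; lra.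
have [L HL] := @rat_step_approx R M j (2 * M)%:R g mg gB d d0.
exists (L, M); pose c : step_code := (L, M).
pose diff (t : lebT) : R := (step_fun c t - truncate h M t)%R.
have diff_out t : (t \notin `[0%R, M%:R[ -> diff t = 0)%R.
  move=> tM; rewrite /diff /step_fun (negbTE tM) sub0r /truncate.
  by move: tM; rewrite in_itv/= => /negbTE ->; rewrite /= oppr0.
have diff_in t : (t \in `[0%R, M%:R[ ->
    diff t = clamp (2 * M%:R) (rat_step L t) - clamp (2 * M%:R) (g t))%R.
  move=> tM; rewrite /diff /step_fun tM/= (@clamp_id _ _ (g t)).
    by rewrite /g opprD addrA addrAC.
  by have := gB t tM; rewrite ratr_nat natrM.
have diff_b t : (`|diff t| <= 2 * M%:R)%R.
  have [tM|tM] := boolP (t \in `[0%R, M%:R[)%R; last first.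
    by rewrite diff_out// normr0 mulr_ge0.
  have M2 : (0 <= 2 * M%:R :> R)%R by rewrite mulr_ge0.
  rewrite diff_in// ler_norml.
  have /andP[? ?] := clamp_ge0 (rat_step L t) M2.
  have /andP[? ?] := clamp_ge0 (g t) M2.
  by apply/andP; split; lra.
have aeE : {ae m, forall t, Defs.repr_of (k *: (stepL0 c - truncateL0 f M)%R) t = (k * diff t)%R}.
  have ae1 := repr_ofZ k (stepL0 c - truncateL0 f M)%R.
  have ae2 := repr_ofD (stepL0 c) (- truncateL0 f M)%R.
  have ae3 := repr_ofZ (-1)%R (truncateL0 f M); rewrite scaleN1r in ae3.
  have ae4 := repr_truncate f M; have ae5 := repr_stepL0 c.
  apply: filterS (filterI (filterI ae1 ae2) (filterI ae3 (filterI ae4 ae5))) => t /=.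
  move=> [[-> ->] [-> [-> ->]]].
  by rewrite mulN1r.
have fA u : (0 < u)%R -> distribution_fun (k *: (stepL0 c - truncateL0 f M)%R) u <= M%:R%:E.
  move=> u_gt0; rewrite -measure_co.
  apply: (distribution_le_ae _ aeE); first exact: lebmeasurable_itv.
  move=> t _ ->; have [//|tM] := boolP (t \in `[0%R, M%:R[)%R.
  by rewrite diff_out// mulr0 normr0 ltNge ltW.
have fB u : (0 < u)%R -> (k * tau <= u)%R ->
    distribution_fun (k *: (stepL0 c - truncateL0 f M)%R) u <= d%:E.
  move=> u_gt0 ku; apply: le_trans HL.
  apply: (distribution_le_ae _ aeE).
    by apply: measurable_far_set => //; exact: measurable_rat_step.
  move=> t _ ->; have [tM|tM] := boolP (t \in `[0%R, M%:R[)%R; last first.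
    by rewrite diff_out// mulr0 normr0 ltNge ltW.
  rewrite normrM (gtr0_norm k0) => ut; split => //=.
  rewrite ratr_nat natrM -/tau -(ltr_pM2l k0); apply: (le_lt_trans ku).
  apply: (lt_le_trans ut); rewrite ler_pM2l// diff_in// distrC.
  exact: clamp_lip.
have f0 u : (0 < u)%R -> (b <= u)%R ->
    distribution_fun (k *: (stepL0 c - truncateL0 f M)%R) u <= 0.
  move=> u_gt0 bu; apply: (le0_distribution aeE) => t ->.
  rewrite normrM (gtr0_norm k0); apply: le_trans bu.
  by rewrite /b ler_pM2l.
have ktau0 : (0 <= k * tau)%R by rewrite mulr_ge0// ltW.
apply: (le_trans (modular_two_level phi_orlicz ww ktau0 b0 fA fB f0)).
have half_add : (2^-1 + 2^-1 = 1 :> R)%R by field.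
rewrite -/W WM -half_add EFinD; apply: leeD.
  rewrite -EFinM lee_fin.
  have pl : (phi (k * tau) <= l * phi 1)%R.
    apply: (@le_trans _ _ (phi l)); first by exact: (orlicz_le phi_orlicz).
    rewrite -{1}[l]mulr1; apply: (orlicz_scale phi_orlicz) => //.
    by rewrite (ltW l0) l1.
  apply: (le_trans (ler_wpM2l WMr0 pl)).
  rewrite mulrCA /l invfM -mulrA ler_piMr ?invr_ge0//.
  by rewrite mulrC ler_pdivrMr// mul1r lerDr.
apply: (@le_trans _ _ ((2 * (1 + phi b))^-1%R%:E * (phi b)%:E)).
  by apply: lee_wpmul2r => //; rewrite lee_fin.
rewrite -EFinM lee_fin invfM -mulrA ler_piMr ?invr_ge0//.
by rewrite mulrC ler_pdivrMr ?ltr_pwDl// mul1r lerDr.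
Qed.

Lemma step_dense (f : L0 m) (e : R) : orlicz_lorentz phi w f -> (0 < e)%R ->
  exists c, rho (e^-1 *: (stepL0 c - f)%R) <= 1.
Proof.
move=> Xf e0; have k0 : (0 < 4 * e^-1)%R by rewrite mulr_gt0// invr_gt0.
have [M HM] := modular_truncate gamma_gt0 phi_orlicz K_gt0 u0_ge0 u0_eq0 D2 ww Xf k0.
have [c Hc] := step_near_truncate f M k0.
exists c; have := modular_quarter1 phi_orlicz ww Hc HM.
by rewrite quarter_chasles.
Qed.

End step_density.

(** * Lineability in Orlicz-Lorentz spaces *)

(** For infinite gamma the two conditions are merged into one with threshold 0,
    the values between the two thresholds being handled by monotonicity. *)
Lemma Delta2_uniform (R : realType) (gamma : \bar R) (phi : R -> R) :
  orlicz_function phi -> (gamma = +oo%E -> Delta2 phi) ->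
  ((gamma < +oo)%E -> Delta2_infty phi) ->
  exists K u0 : R, [/\ 0 < K, 0 <= u0, (gamma = +oo%E -> u0 = 0) &
    forall u, u0 <= u -> phi (2 * u) <= K * phi u].
Proof.
move=> phi_orlicz Doo Dfin.
have [goo|gfin] := eqVneq gamma +oo%E; last first.
  have [|K [u0 [K2 u0_ge0 D]]] := Dfin; first by rewrite ltey.
  exists K, u0; split => //; first by apply: lt_trans K2.
  by move=> goo; rewrite goo eqxx in gfin.
have [[K1 [a [K1_gt2 a0 D1]]] [K2 [b [K2_gt2 b0 D2]]]] := Doo goo.
have pa : 0 < phi a by exact: orlicz_gt0.
pose C := phi (2 * b) / phi a.
have C0 : 0 <= C by rewrite divr_ge0 ?(ltW pa)// (orlicz_ge0 phi_orlicz)// mulr_ge0.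
have K1_gt0 : 0 < K1 by apply: lt_trans K1_gt2.
have K2_gt0 : 0 < K2 by apply: lt_trans K2_gt2.
exists (K1 + K2 + C), 0; split => //.
  by rewrite ltr_pwDl// addr_gt0.
move=> u u_ge0; have pu := orlicz_ge0 phi_orlicz u_ge0.
rewrite [leRHS]mulrDl [X in X + _]mulrDl.
have h1 := mulr_ge0 (ltW K1_gt0) pu; have h2 := mulr_ge0 (ltW K2_gt0) pu.
have h3 := mulr_ge0 C0 pu.
have [ua|au] := leP u a; first by have := D1 u u_ge0 ua; lra.
have [bu|ub] := leP b u; first by have h4 := D2 u bu; lra.
suff : phi (2 * u) <= C * phi u by lra.
apply: (@le_trans _ _ (phi (2 * b))).
  by apply: (orlicz_le phi_orlicz); [rewrite mulr_ge0|rewrite ler_pM2l// ltW].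
rewrite /C -mulrA ler_peMr//; first by rewrite (orlicz_ge0 phi_orlicz)// mulr_ge0.
by rewrite ler_pdivlMl// mulr1 (orlicz_le phi_orlicz)// ltW.
Qed.

Lemma quarter_chasles_opp (R : realType) (V : lmodType R) (n : R) (x y z : V) :
  4^-1 *: (- (n *: (x - y)) + n *: (x - z)) = (4^-1 * n) *: (y - z).
Proof. by rewrite -scalerN opprB -scalerDr addrA subrK scalerA. Qed.

Lemma quarter_perturb (R : realType) (V : lmodType R) (e : R) (x v z : V) :
  4^-1 *: ((4 * e^-1) *: (x - z) + (4 * e^-1) *: v) = e^-1 *: (x + v - z).
Proof. by rewrite -scalerDr scalerA mulrA mulVf// mul1r addrAC. Qed.

Lemma le_quarter_truncn (R : realType) (k : R) : 0 < k ->
  0 < k <= 4^-1 * (Num.truncn (4 * k)).+1%:R.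
Proof. by move=> k0; rewrite k0 ler_pdivlMl// ltW// truncnS_gt. Qed.

Lemma le_scale_truncn (R : realType) (e c : R) : 0 < e -> 0 < c ->
  0 < 4 * e^-1 * c <= (Num.truncn (4 * e^-1)).+1%:R * c.
Proof.
by move=> e0 c0; rewrite !mulr_gt0 ?invr_gt0//= ler_pM2r// ltW// truncnS_gt.
Qed.

Section lineability_of_orlicz_lorentz.
Variables (R : realType) (gamma : \bar R).
Hypothesis gamma_gt0 : (0 < gamma)%E.
Variables (phi : R -> R) (K u0 : R).
Hypothesis phi_orlicz : orlicz_function phi.
Hypotheses (K_gt0 : 0 < K) (u0_ge0 : 0 <= u0) (u0_eq0 : gamma = +oo%E -> u0 = 0).
Hypothesis D2 : forall u, u0 <= u -> phi (2 * u) <= K * phi u.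
Variable w : R -> R.
Hypothesis ww : weight gamma w.
Let m := m_gamma gamma.
Let X : set (L0 m) := orlicz_lorentz phi w.
Let rho := @modular R gamma phi w.
Let N := @luxemburg_norm R gamma phi w.

(** A bound of primitives passes to the modulars by the layer cake formula. *)
Lemma orlicz_lorentz_sub (w1 w2 : R -> R) (C : R) : weight gamma w1 -> weight gamma w2 ->
  0 <= C ->
  (forall t, I_gamma_pos gamma t -> (primitive w2 t <= C%:E * primitive w1 t)%E) ->
  (orlicz_lorentz phi w1 : set (L0 m)) `<=` orlicz_lorentz phi w2.
Proof.
move=> ww1 ww2 C0 h f [k k0 kf]; exists k => //.
apply: (le_lt_trans (modular_weight_le phi_orlicz (k *: f) ww2 ww1 C0
  (cumul_le_primitive ww2 ww1 C0 h))).
have kfin : modular phi w1 (k *: f) \is a fin_num.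
  by rewrite ge0_fin_numE// (modular_ge0 phi_orlicz ww1).
by rewrite -(fineK kfin) -EFinM ltry.
Qed.

(** The map that sends f to the set of pairs (c, n), where the step function c
    is within 1/(n+1) of f, is injective. *)
Lemma card_orlicz_lorentz : X #<= [set: R].
Proof.
pose code : countType := ((seq (rat * seq (rat * rat)) * nat) * nat)%type.
(* The scale n + 1 plays the role of the inverse of the radius. *)
pose S (f : L0 m) : set code :=
  [set p | (rho (p.2.+1%:R *: (stepL0 gamma p.1 - f)) <= 1)%E].
apply: card_le_trans (card_set_countType R code).
apply: (@card_le_fun _ _ X [set: set code] S); first by move=> f _; exact: I.
move=> f g /set_mem Xf /set_mem Xg Sfg.
apply/eqP; rewrite -subr_eq0; apply/eqP.
apply: (modular_le1_eq0 gamma_gt0 phi_orlicz ww) => k k0.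
pose n := Num.truncn (4 * k).
have kn := le_quarter_truncn k0.
have n0 : 0 < (n.+1%:R : R)^-1 by rewrite invr_gt0.
have [c Hc] := step_dense gamma_gt0 phi_orlicz K_gt0 u0_ge0 u0_eq0 D2 ww Xf n0.
rewrite invrK in Hc.
have Sf : S f (c, n) by exact: Hc.
have Sg : S g (c, n) by rewrite -Sfg.
have Sf' := le_trans (modularN phi_orlicz ww _) Sf.
have := modular_quarter1 phi_orlicz ww Sf' Sg.
rewrite quarter_chasles_opp; apply: le_trans.
exact: (modular_mono phi_orlicz ww).
Qed.

Lemma luxemburg_small_scale (v : L0 m) (e : R) : X v -> 0 < e ->
  exists2 c : R, c != 0 & N (c *: v) < e.
Proof.
move=> Xv e0; have e2 : 0 < e / 2 by rewrite divr_gt0.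
have e2' : 0 < (e / 2)^-1 by rewrite invr_gt0.
have [c c0 Hc] := modular_scale_small phi_orlicz ww Xv e2'.
exists c; first by rewrite gt_eqF.
apply: (luxemburg_lt e2); first by rewrite ltr_pdivrMr// ltr_pMr// ltr1n.
by rewrite scalerA.
Qed.

(** Every step function occurs in the sequence once for each natural number k,
    and there the perturbation is kept smaller than 1/(k+1). *)
Lemma luxemburg_dense_perturb (Y : set (L0 m)) : Y 0 ->
  (forall c, Y (stepL0 gamma c)) ->
  exists2 d : nat -> L0 m, forall n, Y (d n) &
  forall v : nat -> L0 m, (forall n, X (v n)) ->
  exists2 c : nat -> R, forall n, c n != 0 &
  forall f (e : R), X f -> 0 < e -> exists n, N (d n + c n *: v n - f) < e.
Proof.
move=> Y0 Ystep.
pose code : countType := ((seq (rat * seq (rat * rat)) * nat) * nat)%type.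
pose dec n : option code := unpickle n.
exists (fun n => if dec n is Some p then stepL0 gamma p.1 else 0).
  by move=> n; case: (dec n) => [p|//]; exact: Ystep.
move=> v Xv.
pose kk n : nat := if dec n is Some p then p.2 else 0%N.
have /choice[c cP] : forall n, exists c : R, 0 < c /\
    (rho (((kk n).+1%:R * c) *: v n) <= 1)%E.
  move=> n; have k0 : 0 < (kk n).+1%:R :> R by [].
  by have [c c0 Hc] := modular_scale_small phi_orlicz ww (Xv n) k0; exists c.
exists c; first by move=> n; rewrite gt_eqF//; case: (cP n).
move=> f e Xf e0; have e2 : 0 < e / 2 by rewrite divr_gt0.
have e4 : 0 < (4 * (e / 2)^-1)^-1 by rewrite invr_gt0 mulr_gt0// invr_gt0.
have [s Hs] := step_dense gamma_gt0 phi_orlicz K_gt0 u0_ge0 u0_eq0 D2 ww Xf e4.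
rewrite invrK in Hs.
pose k := Num.truncn (4 * (e / 2)^-1).
pose n := pickle ((s, k) : code).
have decn : dec n = Some (s, k) by rewrite /dec pickleK.
exists n; rewrite decn; apply: (luxemburg_lt e2).
  by rewrite ltr_pdivrMr// ltr_pMr// ltr1n.
have [cn0 Hcn] := cP n; rewrite /kk decn/= in Hcn.
have ken := le_scale_truncn e2 cn0.
have Hv : (rho ((4 * (e / 2)^-1) *: (c n *: v n)) <= 1)%E.
  rewrite scalerA; apply: le_trans Hcn; exact: (modular_mono phi_orlicz ww).
by have := modular_quarter1 phi_orlicz ww Hs Hv; rewrite quarter_perturb.
Qed.

End lineability_of_orlicz_lorentz.

Theorem corollary4p11 (R : realType) (gamma : \bar R) (gamma_gt0 : (0 < gamma)%E)
    (phi : R -> R) (phi_orlicz : orlicz_function phi)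
    (phi_Delta2 : gamma = +oo%E -> Delta2 phi)
    (phi_Delta2_infty : (gamma < +oo)%E -> Delta2_infty phi)
    (w : R -> R) (wn : nat -> R -> R)
    (w_weight : weight gamma w) (wn_weight : forall n, weight gamma (wn n))
    (W_le : exists K : nat -> R, (forall n, 0 < K n) /\
       forall n t, I_gamma gamma t ->
         (primitive w t <= (K n)%:E * primitive (wn n) t)%E)
    (wn_increasing : forall n,
       orlicz_lorentz (gamma := gamma) phi (wn n) `<`
       orlicz_lorentz phi (wn n.+1)) :
  let X : set (L0 (m_gamma gamma)) := orlicz_lorentz phi w in
  let tau : set_system (L0 (m_gamma gamma)) := luxemburg_topology phi w in
  let A : set (L0 (m_gamma gamma)) :=
    X `\` \bigcup_n orlicz_lorentz phi (wn n) in
  [/\ (forall a b : Type, card_lt a R -> [set: nat] #<= [set: b] ->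
         [set: a] #<= [set: b] -> [set: b] #<= [set: R] ->
         dense_lineable_pair X tau A a b),
      (pointwise_maximal_dense_lineable X tau A /\
       pointwise_dense_lineable X tau A R),
      (forall a b : Type, [set: nat] #<= [set: a] -> [set: a] #<= [set: b] ->
         ~ spaceable_pair X tau A a b) &
      (forall a : Type, [set: a] #<= [set: R] -> lineable_pair X A a R)].
Proof.
move=> X tau A.
have [K [u0 [K_gt0 u0_ge0 u0_eq0 D2]]] := Delta2_uniform phi_orlicz phi_Delta2 phi_Delta2_infty.
pose Xn n : set (L0 (m_gamma gamma)) := orlicz_lorentz phi (wn n).
pose Y := \bigcup_n Xn n.
have Xn_le n p : (n <= p)%N -> Xn n `<=` Xn p.
  elim: p => [|p IH]; first by rewrite leqn0 => /eqP ->.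
  rewrite leq_eqVlt => /predU1P[-> //|/IH/subset_trans]; apply.
  by case: (wn_increasing p).
have sXn n : vector_subspace (Xn n) by exact: orlicz_lorentz_subspace.
have sX : vector_subspace X by exact: orlicz_lorentz_subspace.
have XnX n : Xn n `<=` X.
  case: W_le => C [C0 CW].
  apply: (orlicz_lorentz_sub phi_orlicz (wn_weight n) w_weight (ltW (C0 n))).
  by move=> t [t0 tg]; apply: CW; split => //; exact: ltW.
have YX : Y `<=` X by move=> f [n _ /XnX].
have sY : vector_subspace Y.
  split; first by exists 0%N => //; exact: (sXn 0%N).1.
  move=> c f g [n _ Xf] [p _ Xg]; exists (maxn n p) => //.
  by apply: (sXn _).2; [apply: Xn_le Xf; exact: leq_maxl|apply: Xn_le Xg; exact: leq_maxr].
(* Otherwise X would be contained in X_n, and X_(n+1) is a subset of X that is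
   not contained in X_n. *)
have unb n (C : R) : 0 <= C -> exists2 t, I_gamma_pos gamma t &
    (C%:E * cumul gamma w t%:E < cumul gamma (wn n) t%:E)%E.
  move=> C0; apply: contrapT => h; case: (wn_increasing n) => _; apply.
  apply: (subset_trans (XnX n.+1)).
  apply: (orlicz_lorentz_sub phi_orlicz w_weight (wn_weight n) C0) => t It.
  have It' : I_gamma gamma t by case: It => t0 tg; split => //; exact: ltW.
  rewrite !(primitive_cumul _ It') leNgt; apply/negP => ht.
  by apply: h; exists t.
have [z zX zY] := exists_independent_family gamma_gt0 phi_orlicz K_gt0 u0_ge0 u0_eq0 D2
  w_weight wn_weight unb.
have [z_inj z_indep] : injective z /\ indep_mod Y (range z).
  apply: (indep_mod_range sY) => rs c urs [n _ Xnz]; apply: (zY rs c urs); by exists n.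
have zX' : range z `<=` X by move=> _ [r _ <-]; exact: zX.
have [y Yy y0] : exists2 y, Y y & y != 0.
  have [_ /existsNP[y /not_implyP[X1y X0y]]] := wn_increasing 0%N.
  exists y; first by exists 1%N.
  by apply/eqP => y0; apply: X0y; rewrite y0; exact: (sXn 0%N).1.
have cX := card_orlicz_lorentz gamma_gt0 phi_orlicz K_gt0 u0_ge0 u0_eq0 D2 w_weight.
have Ystep c : Y (stepL0 gamma c) by exists 0%N => //; exact: stepL0_in.
have dense := luxemburg_dense_perturb gamma_gt0 phi_orlicz K_gt0 u0_ge0 u0_eq0 D2 w_weight
  sY.1 Ystep.
exact: (abstract_lineability sX sY YX z_inj zX' z_indep cX
  (luxemburg_small_scale phi_orlicz w_weight) Yy y0 dense).
Qed.
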